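(* Let $r\ge 3$ be a fixed integer and $p\in(0,1)$ a fixed constant. Let $f_r$ be the number of $r$-cliques in the random graph $G(n,p)$, and let $\mu=\mathbb{E}[f_r]$ and $\sigma^2=\mathrm{Var}(f_r)$. Fix any $\tau$ with $0<\tau<\min\left(\frac1{12},\frac1{2r}\right)$. Then for any $m\in\mathbb{N}$, $$\Pr[f_r=m]=\frac{1}{\sqrt{2\pi}\,\sigma}e^{-\frac{(m-\mu)^2}{2\sigma^2}}+O\left(\frac{1}{\sigma n^{\frac12-\tau}}\right).$$
   Context: $G(n,p)$ is the random graph on vertex set $[n]=\{1,\dots,n\}$ in which each of the $\binom n2$ possible edges is present independently with probability $p$. $f_r$ counts copies of the complete graph $K_r$, i.e. $f_r=\sum_{S}\prod_{e\in S}x_e$ where $S$ ranges over the $\binom nr$ edge sets of $r$-cliques on $[n]$ and $x_e\in\{0,1\}$ is the indicator of edge $e$. Asymptotics are as $n\to\infty$; the implied constant depends only on $r,p,\tau$ (so is uniform in $m$). *)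

(* Defs.v *)
From HB Require Import structures.
From mathcomp Require Import all_boot all_order all_algebra.
From mathcomp Require Import all_classical all_reals all_analysis.

Set Implicit Arguments.
Unset Strict Implicit.
Unset Printing Implicit Defensive.

Import Order.TTheory GRing.Theory Num.Theory.
Import numFieldNormedType.Exports.

Local Open Scope classical_set_scope.
Local Open Scope ring_scope.

Definition edge (n : nat) := {e : {set 'I_n} | #|e| == 2%N}.

Definition graph (n : nat) := {ffun edge n -> bool}.

HB.instance Definition _ n := Finite.on (graph n).
HB.instance Definition _ n :=
  isPointed.Build (graph n) ([ffun=> false] : {ffun edge n -> bool}).
HB.instance Definition _ n := @isMeasurable.Build default_measure_display
  (graph n) discrete_measurable discrete_measurable0
  discrete_measurableC discrete_measurableU.

Definition clique_count (r n : nat) (g : graph n) : nat :=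
  (\sum_(S : {set 'I_n} | #|S| == r)
     \prod_(e : edge n | val e \subset S) g e)%N.

Definition gnp_pmf {R : realType} (n : nat) (p : R) (g : graph n) : R :=
  \prod_(e : edge n) bernoulli_pmf p (g e).

(* As for [bernoulli_prob] and [binomial_prob], the value outside of
   [0 <= p <= 1] is a Dirac mass, so that [gnp] is always a probability. *)
Definition gnp {R : realType} (n : nat) (p : R) : set (graph n) -> \bar R :=
  fun A => if 0 <= p <= 1 then \esum_(g in A) (gnp_pmf p g)%:E
           else \d_(point : graph n) A.

Section gnp_probability.
Context {R : realType} (n : nat) (p : R).

Lemma gnp_pmf_ge0 (g : graph n) : 0 <= p <= 1 -> 0 <= gnp_pmf p g.
Proof. by move=> p01; apply: prodr_ge0 => e _; exact: bernoulli_pmf_ge0. Qed.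

Lemma sum_gnp_pmf : \sum_(g : graph n) gnp_pmf p g = 1.
Proof.
rewrite /gnp_pmf -(bigA_distr_bigA (fun (_ : edge n) b => bernoulli_pmf p b)).
by rewrite big1 // => e _; rewrite big_bool /= /bernoulli_pmf addrC subrK.
Qed.

Let gnp0 : gnp p (@set0 (graph n)) = 0%E.
Proof. by rewrite /gnp measure0; case: ifPn => //; rewrite esum_set0. Qed.

Let gnp_ge0 (A : set (graph n)) : (0 <= gnp p A)%E.
Proof.
rewrite /gnp; case: ifPn => // p01; apply: esum_ge0 => g _.
by rewrite lee_fin gnp_pmf_ge0.
Qed.

Let gnp_sigma_additive : semi_sigma_additive (@gnp R n p).
Proof.
move=> F mF tF mUF; rewrite /gnp; case: ifPn => p01; last first.
  exact: measure_semi_sigma_additive.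
apply: cvg_toP.
  apply: ereal_nondecreasing_is_cvgn => a b ab.
  apply: lee_sum_nneg_natr => // k _ _.
  by apply: esum_ge0 => g _; rewrite lee_fin gnp_pmf_ge0.
by rewrite nneseries_sum_bigcup// => g; rewrite lee_fin gnp_pmf_ge0.
Qed.

HB.instance Definition _ := isMeasure.Build _ _ _ (@gnp R n p)
  gnp0 gnp_ge0 gnp_sigma_additive.

Let gnp_setT : gnp p [set: graph n] = 1%E.
Proof.
rewrite /gnp; case: ifPn => [p01|_]; last by rewrite probability_setT.
have fT : finite_set [set: graph n] by exact: finite_finset.
rewrite esum_fset//; last by move=> g _; rewrite lee_fin gnp_pmf_ge0.
rewrite fsbig_finite//= (perm_big (index_enum (graph n))) /=.
  by rewrite sumEFin sum_gnp_pmf.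
apply: uniq_perm; rewrite ?finmap.fset_uniq ?index_enum_uniq // => g.
rewrite in_fset_set//; transitivity true; first exact/mem_set.
by apply/esym; exact: mem_index_enum.
Qed.

HB.instance Definition _ :=
  @Measure_isProbability.Build _ _ R (@gnp R n p) gnp_setT.

End gnp_probability.

Arguments gnp {R} n p.

Definition clique_mean {R : realType} (r n : nat) (p : R) : R :=
  fine 'E_(gnp n p)[fun g : graph n => (clique_count r g)%:R].

Definition clique_sd {R : realType} (r n : nat) (p : R) : R :=
  Num.sqrt (fine 'V_(gnp n p)[fun g : graph n => (clique_count r g)%:R]).

(* Main.v *)
(* Write f for the clique count, and let y be a small power of n. The law of f is recovered
   from E cos (theta (f - m)), 0 <= theta <= pi, which is compared with its Gaussian analogue.
   For theta <= y / n^(r-1), f is its linear part in the centred edge indicators up to a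
   remainder of variance O(n^(2r-3)) by the Efron-Stein inequality, and the Gaussian appears
   bit by bit. For larger theta, |E cos (h + theta f_j)| decays faster than any power of n,
   where f_j counts the j-cliques in any vertex set and h is any phase not depending on the
   edges inside a linear-sized part A of it. This goes by induction on j. If theta is small,
   the Taylor expansion of the nonlinear part of the phase is a sum of terms depending on few
   edges, hypercontractivity controls the remainder, and the linear part gives the decay. If
   theta is large, conditioning on two copies of the edges at one vertex and
   Cauchy-Schwarz reduce (j+1)-cliques to j-cliques. In between, the same decoupling
   applied to the edges between two small sets M and P leaves a phase whose linear part has
   coefficients with large square sum. *)

Require Import Defs.
From HB Require Import structures.
From mathcomp Require Import all_boot all_order all_algebra.
From mathcomp Require Import all_classical all_reals all_analysis.
From mathcomp Require Import ring lra zify.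

Set Implicit Arguments.
Unset Strict Implicit.
Unset Printing Implicit Defensive.

Import Order.TTheory GRing.Theory Num.Theory.
Import numFieldNormedType.Exports.

Local Open Scope classical_set_scope.
Local Open Scope ring_scope.

(** * The biased cube *)

(** For cliques of size j+1, the coefficient of one edge in the phase is of order theta n^(j-1). A
    linear phase decays only while its coefficients stay below pi, since a bit at angle 2 pi does
    not oscillate; so the direct argument stops near theta n^(j-1) = 1/y. Decoupling a star reduces
    to j-cliques, which are controlled only from theta n^(j-1) = y on. The gap between is closed by
    a decoupling that scales the coefficients down by a factor of order at most |M| / n, which puts
    them back below pi, while the edges from P to A remain numerous enough for a large square sum.
    The phase h and the set A are what make the induction close. A decoupling leaves counts that
    cannot be controlled; they are absorbed into h as soon as they ignore the edges inside a
    smaller, still linear-sized A. Decay faster than every power is forced: each doubling halves the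
    exponent, and the angles up to pi must contribute less than about n^(1/2-r). Hypercontractivity
    provides it by raising a variance of order 1/y to an arbitrary power 2^k. *)

Fact cube_key : unit. Proof. exact: tt. Qed.

Section CubeDefs.
Context {R : realType} {T : finType} (p : R).
Implicit Types (F G H : {ffun T -> bool} -> R) (x y : {ffun T -> bool}).
Implicit Types (B : {set T}) (e : T).

Definition wt x : R := \prod_(e : T) bernoulli_pmf p (x e).

Definition esp F : R := \sum_x wt x * F x.

(* Locked: unification must not unfold finite functions. *)
Definition merge B y x : {ffun T -> bool} :=
  locked_with cube_key [ffun e => if e \in B then y e else x e].

Definition set_at e b x : {ffun T -> bool} :=
  locked_with cube_key [ffun e' => if e' == e then b else x e'].

Lemma mergeE B y x e : merge B y x e = if e \in B then y e else x e.
Proof. by rewrite /merge unlock ffunE. Qed.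

Lemma set_atE e b x e' : set_at e b x e' = if e' == e then b else x e'.
Proof. by rewrite /set_at unlock ffunE. Qed.

Definition cubeE := (mergeE, set_atE).

(** The conditional expectation of [F] given the bits outside [B]. *)
Definition resample B F x : R := esp (fun y => F (merge B y x)).

Definition dif e F x : R := F (set_at e true x) - F (set_at e false x).

Definition chi e x : R := (x e)%:R - p.

(** [B] is the set of bits that [F] ignores: dependence on the bits of [S] alone reads
    [indep (~: S) F]. *)
Definition indep B F := forall x y, (forall e, e \notin B -> x e = y e) -> F x = F y.

End CubeDefs.

Section Cube.
Context {R : realType} {T : finType} {p : R}.
Hypothesis hp : 0 < p < 1.
Implicit Types (F G H : {ffun T -> bool} -> R) (x y : {ffun T -> bool}).
Implicit Types (B : {set T}) (e : T).

Local Notation wt := (@wt R T p).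
Local Notation esp := (@esp R T p).
Local Notation resample := (@resample R T p).

Lemma bernoulli_pmf_ge0' b : 0 <= bernoulli_pmf p b.
Proof. by apply: bernoulli_pmf_ge0; case/andP: hp => /ltW -> /ltW ->. Qed.

Lemma wt_ge0 x : 0 <= wt x.
Proof. by apply: prodr_ge0 => e _; exact: bernoulli_pmf_ge0'. Qed.

Lemma esp_prod (f : T -> bool -> R) :
  esp (fun x => \prod_e f e (x e)) =
  \prod_e (p * f e true + (1 - p) * f e false).
Proof.
transitivity (\sum_(x : {ffun T -> bool}) \prod_(e : T) (bernoulli_pmf p (x e) * f e (x e))).
  by apply: eq_bigr => x _; rewrite big_split.
rewrite -(bigA_distr_bigA (fun e b => bernoulli_pmf p b * f e b)).
by apply: eq_bigr => e _; rewrite big_bool.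
Qed.

Lemma sum_wt : \sum_(x : {ffun T -> bool}) wt x = 1.
Proof.
transitivity (esp (fun=> \prod_(e : T) 1)).
  by apply: eq_bigr => x _; rewrite big1_eq mulr1.
by rewrite (esp_prod (fun _ _ => 1)) big1 // => e _; ring.
Qed.

Lemma eq_esp F G : F =1 G -> esp F = esp G.
Proof. by move=> FG; apply: eq_bigr => x _; rewrite FG. Qed.

Lemma espD F G : esp (fun x => F x + G x) = esp F + esp G.
Proof. by rewrite /esp -big_split /=; apply: eq_bigr => x _; rewrite mulrDr. Qed.

Lemma espZ k F : esp (fun x => k * F x) = k * esp F.
Proof. by rewrite /esp big_distrr /=; apply: eq_bigr => x _; ring. Qed.

Lemma espZr k F : esp (fun x => F x * k) = esp F * k.
Proof. by rewrite mulrC -espZ; apply: eq_esp => x; rewrite mulrC. Qed.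

Lemma espN F : esp (fun x => - F x) = - esp F.
Proof. by rewrite -mulN1r -espZ; apply: eq_esp => x; rewrite mulN1r. Qed.

Lemma espB F G : esp (fun x => F x - G x) = esp F - esp G.
Proof. by rewrite espD espN. Qed.

Lemma esp_cst k : esp (fun=> k) = k.
Proof. by rewrite /esp -big_distrl /= sum_wt mul1r. Qed.

Lemma esp_sum (I : Type) (r : seq I) (P : pred I) (F : I -> {ffun T -> bool} -> R) :
  esp (fun x => \sum_(i <- r | P i) F i x) = \sum_(i <- r | P i) esp (F i).
Proof.
rewrite /esp exchange_big /=; apply: eq_bigr => x _.
by rewrite big_distrr.
Qed.

Lemma le_esp F G : (forall x, F x <= G x) -> esp F <= esp G.
Proof. by move=> FG; apply: ler_sum => x _; rewrite ler_wpM2l ?wt_ge0. Qed.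

Lemma esp_ge0 F : (forall x, 0 <= F x) -> 0 <= esp F.
Proof. by move=> F0; rewrite -(esp_cst 0); exact: le_esp. Qed.

Lemma ler_norm_esp F : `|esp F| <= esp (fun x => `|F x|).
Proof.
rewrite (le_trans (ler_norm_sum _ _ _))//; apply: ler_sum => x _.
by rewrite normrM (ger0_norm (wt_ge0 x)).
Qed.

Lemma esp_le_cst F k : (forall x, F x <= k) -> esp F <= k.
Proof. by move=> Fk; rewrite -[k]esp_cst; exact: le_esp. Qed.

Lemma esp_abs_le F k : (forall x, `|F x| <= k) -> `|esp F| <= k.
Proof. by move=> Fk; rewrite (le_trans (ler_norm_esp F)) ?esp_le_cst. Qed.

Lemma esp_CS F G :
  esp (fun x => F x * G x) ^+ 2 <=
  esp (fun x => F x ^+ 2) * esp (fun x => G x ^+ 2).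
Proof.
set a := esp (fun x => F x ^+ 2); set c := esp (fun x => G x ^+ 2).
set b := esp (fun x => F x * G x).
have q u v : 0 <= u ^+ 2 * a + 2 * u * v * b + v ^+ 2 * c.
  rewrite -!espZ -!espD; apply: esp_ge0 => x.
  have -> : u ^+ 2 * F x ^+ 2 + 2 * u * v * (F x * G x) + v ^+ 2 * G x ^+ 2
    = (u * F x + v * G x) ^+ 2 by ring.
  exact: sqr_ge0.
have a0 : 0 <= a by apply: esp_ge0 => x; exact: sqr_ge0.
have c0 : 0 <= c by apply: esp_ge0 => x; exact: sqr_ge0.
have [c00|cn0] := eqVneq c 0.
  have [->|bn0] := eqVneq b 0; first by rewrite expr0n /= c00 mulr0.
  (* With [c = 0] the form is affine in its second argument, which is chosen here so that the value
     is [- a - 2]. *)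
  have := q 1 (- (a + 1) / b); rewrite c00 mulr0 addr0.
  have -> : 1 ^+ 2 * a + 2 * 1 * (- (a + 1) / b) * b = - a - 2 by field.
  lra.
have cp : 0 < c by rewrite lt_def cn0.
have := q c (- b).
have -> : c ^+ 2 * a + 2 * c * (- b) * b + (- b) ^+ 2 * c = c * (a * c - b ^+ 2)
  by ring.
by rewrite pmulr_rge0// subr_ge0.
Qed.

Lemma esp_sqr_le F : esp F ^+ 2 <= esp (fun x => F x ^+ 2).
Proof.
have := esp_CS F (fun=> 1); rewrite expr1n esp_cst mulr1.
by under eq_esp do rewrite mulr1.
Qed.

(* [(x, y) |-> (merge B y x, merge B x y)] is a weight-preserving involution. *)
Lemma esp_resample B F : esp (resample B F) = esp F.
Proof.
transitivity (\sum_(u : {ffun T -> bool} * {ffun T -> bool})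
   wt u.1 * wt u.2 * F (merge B u.2 u.1)).
  rewrite -(pair_bigA _ (fun x y => wt x * wt y * F (merge B y x))) /=.
  apply: eq_bigr => x _; rewrite /resample /esp big_distrr /=.
  by apply: eq_bigr => y _; rewrite mulrA.
pose s (u : {ffun T -> bool} * {ffun T -> bool}) :=
  (merge B u.2 u.1, merge B u.1 u.2).
have sK : involutive s.
  move=> [x y]; rewrite /s /=; congr (_, _); apply/ffunP => e;
  by rewrite /= !cubeE; case: (e \in B).
rewrite (reindex_inj (inv_inj sK)) /=.
transitivity (\sum_(u : {ffun T -> bool} * {ffun T -> bool})
   wt u.1 * wt u.2 * F u.1).
  apply: eq_bigr => -[x y] _ /=; congr (_ * _).
    rewrite /wt -!big_split /=; apply: eq_bigr => e _; rewrite !cubeE.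
    by case: ifP => // _; rewrite mulrC.
  by congr F; apply/ffunP => e; rewrite !cubeE; case: (e \in B).
rewrite -(pair_bigA _ (fun x y => wt x * wt y * F x)) /=.
apply: eq_bigr => x _; rewrite -big_distrl /= -big_distrr /= sum_wt mulr1.
by [].
Qed.

Lemma esp_coord e (f : bool -> R) :
  esp (fun x => f (x e)) = p * f true + (1 - p) * f false.
Proof.
have := esp_prod (fun e' b => if e' == e then f b else 1).
rewrite (bigD1 e) //= eqxx big1 => [|e' /negPf ->]; last by ring.
rewrite mulr1 => <-; apply: eq_esp => x.
rewrite (bigD1 e) //= eqxx big1 ?mulr1 // => e' /negPf -> //.
Qed.

Lemma resample1 e F x :
  resample [set e] F x = p * F (set_at e true x) + (1 - p) * F (set_at e false x).
Proof.
rewrite -(esp_coord e (fun b => F (set_at e b x))) /resample.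
apply: eq_esp => y; congr F; apply/ffunP => e'; rewrite !cubeE finset.in_set1.
by case: eqP => [->|].
Qed.

Lemma esp_av e F :
  esp F = esp (fun x => p * F (set_at e true x) + (1 - p) * F (set_at e false x)).
Proof. by rewrite -(esp_resample [set e]); apply: eq_esp => x; rewrite resample1. Qed.

Lemma indep_resample B F : indep B (resample B F).
Proof.
move=> x y xy; apply: eq_esp => z; congr F; apply/ffunP => e; rewrite !cubeE.
by case: ifP => // /negbT /xy.
Qed.

Lemma indepS B B' F : B' \subset B -> indep B F -> indep B' F.
Proof.
move=> sB iF x y xy; apply: iF => e eB; apply: xy.
by apply: contraNN eB => /(fintype.subsetP sB).
Qed.

Lemma indep_set_at B F e b x : indep B F -> e \in B -> F (set_at e b x) = F x.
Proof.
move=> iF eB; apply: iF => e' e'B; rewrite set_atE; case: eqP => // ee.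
by rewrite ee eB in e'B.
Qed.

Lemma indep_merge B F y x : indep B F -> F (merge B y x) = F x.
Proof. by move=> iF; apply: iF => e /negPf eB; rewrite mergeE eB. Qed.

Lemma resample_indep B F x : indep B F -> resample B F x = F x.
Proof.
move=> iF; rewrite /resample -[RHS]esp_cst; apply: eq_esp => y.
exact: indep_merge.
Qed.

Lemma esp_exchange (F : {ffun T -> bool} -> {ffun T -> bool} -> R) :
  esp (fun x => esp (F x)) = esp (fun y => esp (F^~ y)).
Proof.
rewrite /esp; under eq_bigr do rewrite big_distrr /=.
rewrite exchange_big; apply: eq_bigr => y _; rewrite big_distrr /=.
by apply: eq_bigr => x _; ring.
Qed.

(* Cauchy-Schwarz followed by [cos u * cos v + sin u * sin v = cos (u - v)]. *)
Lemma doubling B F :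
  esp (fun x => cos (F x)) ^+ 2 <=
  esp (fun y => esp (fun y' =>
    `|esp (fun x => cos (F (merge B y x) - F (merge B y' x)))|)).
Proof.
rewrite -(esp_resample B) (le_trans (esp_sqr_le _))//.
apply: (@le_trans _ _ (esp (fun y => esp (fun y' => esp (fun x =>
   cos (F (merge B y x) - F (merge B y' x))))))); last first.
  by apply: le_esp => y; apply: le_esp => y'; exact: ler_norm.
have -> : esp (fun y => esp (fun y' => esp (fun x =>
   cos (F (merge B y x) - F (merge B y' x))))) =
  esp (fun x => resample B (fun x => cos (F x)) x ^+ 2 +
                resample B (fun x => sin (F x)) x ^+ 2).
  have h x : resample B (fun x => cos (F x)) x ^+ 2 +
      resample B (fun x => sin (F x)) x ^+ 2 =
      esp (fun y => esp (fun y' => cos (F (merge B y x) - F (merge B y' x)))).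
    rewrite !expr2 /resample -!espZr -espD; apply: eq_esp => y.
    rewrite -!espZ -espD; apply: eq_esp => y'.
    by rewrite cosB.
  under [RHS]eq_esp do rewrite h.
  under [LHS]eq_esp do rewrite esp_exchange.
  exact: esp_exchange.
by apply: le_esp => x; rewrite lerDl sqr_ge0.
Qed.

End Cube.

(** * Discrete derivatives and hypercontractivity *)

Section Hypercontractivity.
Context {R : realType} {T : finType} {p : R}.
Hypothesis hp : 0 < p < 1.
Implicit Types (F G H : {ffun T -> bool} -> R) (x y : {ffun T -> bool}).
Implicit Types (B S : {set T}) (e : T).

Local Notation esp := (@esp R T p).
Local Notation resample := (@resample R T p).
Local Notation chi := (@chi R T p).

Lemma set_at_id e b b' x : set_at e b (set_at e b' x) = set_at e b x.
Proof. by apply/ffunP => e'; rewrite !cubeE; case: eqP. Qed.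

Lemma set_atC e e' b b' x : e != e' ->
  set_at e b (set_at e' b' x) = set_at e' b' (set_at e b x).
Proof.
move=> ee; apply/ffunP => e''; rewrite !cubeE.
by case: eqP => [->|//]; rewrite (negPf ee).
Qed.

Lemma merge_set_at B e b y x :
  merge B y (set_at e b x) = if e \in B then merge B y x else set_at e b (merge B y x).
Proof.
case: ifP => eB; apply/ffunP => e'; rewrite !cubeE.
  by case: ifP => // e'B; case: eqP => // ee; rewrite ee eB in e'B.
by case: (eqVneq e' e) => [->|//]; rewrite eB.
Qed.

Lemma resampleU B1 B2 F x :
  resample (B1 :|: B2) F x = resample B1 (resample B2 F) x.
Proof.
rewrite {1}/resample -(esp_resample B2); apply: eq_esp => y.
apply: eq_esp => z; congr F; apply/ffunP => e; rewrite !cubeE finset.in_setU.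
by case: (e \in B2); rewrite ?orbT ?orbF.
Qed.

Lemma resampleT F x : resample [set: T]%SET F x = esp F.
Proof.
by apply: eq_esp => y; congr F; apply/ffunP => e; rewrite !cubeE finset.in_setT.
Qed.

Lemma resampleB B F G x :
  resample B (fun x => F x - G x) x = resample B F x - resample B G x.
Proof. exact: espB. Qed.

(** The Fourier expansion of [F] in the single bit [e]: neither the mean nor the derivative depends
    on that bit. *)
Lemma dif_decomp e F x : F x = resample [set e] F x + chi e x * dif e F x.
Proof.
rewrite resample1 /chi /dif.
have -> : F x = F (set_at e (x e) x).
  by congr F; apply/ffunP => e'; rewrite !cubeE; case: eqP => [->|].
by case: (x e) => /=; ring.
Qed.

Lemma indep_dif e F : indep [set e] (dif e F).
Proof.
move=> x y xy; congr (F _ - F _); apply/ffunP => e'; rewrite !cubeE;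
by case: eqP => // /eqP ne; rewrite xy // finset.in_set1.
Qed.

Lemma esp_coordM e (f : bool -> R) G : indep [set e] G ->
  esp (fun x => f (x e) * G x) = (p * f true + (1 - p) * f false) * esp G.
Proof.
move=> iG; rewrite (esp_av e) -espZ; apply: eq_esp => x.
by rewrite !(indep_set_at _ _ iG) ?finset.in_set1// !set_atE eqxx; ring.
Qed.

Lemma esp_chiM e G : indep [set e] G -> esp (fun x => chi e x * G x) = 0.
Proof.
by move=> iG; rewrite (esp_coordM (fun b => b%:R - p) iG) /=; ring.
Qed.

Lemma indepM B F G : indep B F -> indep B G -> indep B (fun x => F x * G x).
Proof. by move=> iF iG x y xy; rewrite (iF _ _ xy) (iG _ _ xy). Qed.

Lemma indepD B F G : indep B F -> indep B G -> indep B (fun x => F x + G x).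
Proof. by move=> iF iG x y xy; rewrite (iF _ _ xy) (iG _ _ xy). Qed.

Lemma indepN B F : indep B F -> indep B (fun x => - F x).
Proof. by move=> iF x y xy; rewrite (iF _ _ xy). Qed.

Lemma esp_dif_sqr e F :
  esp (fun x => (F x - resample [set e] F x) ^+ 2) =
  p * (1 - p) * esp (fun x => dif e F x ^+ 2).
Proof.
have -> : p * (1 - p) = p * (true%:R - p) ^+ 2 + (1 - p) * (false%:R - p) ^+ 2.
  by rewrite /=; ring.
rewrite -(@esp_coordM e (fun b : bool => (b%:R - p) ^+ 2)); last first.
  by move=> x y xy; rewrite (indep_dif _ xy).
apply: eq_esp => x; rewrite {1}(dif_decomp e F x) addrAC subrr add0r.
by rewrite exprMn.
Qed.

Lemma pq_ge0 : 0 <= p * (1 - p).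
Proof. by case/andP: hp => p0 p1; rewrite mulr_ge0 ?ltW ?subr_gt0. Qed.

(** Induction on [B]: the fluctuation [D] in one bit [e] is a multiple of [chi e], hence orthogonal
    to whatever ignores [e], and averaging the remaining fluctuation [H] over [e] only lowers its
    second moment. *)
Lemma efron_stein B F :
  esp (fun x => (F x - resample B F x) ^+ 2) <=
  p * (1 - p) * \sum_(e in B) esp (fun x => dif e F x ^+ 2).
Proof.
move: {2}#|B| (erefl #|B|) => k; elim: k B => [|k IH] B cB.
  have -> : B = finset.set0 by apply/eqP; rewrite -cards_eq0 cB.
  rewrite big_set0 mulr0 le_eqVlt; apply/orP; left; apply/eqP.
  rewrite -[RHS](@esp_cst _ T p); apply: eq_esp => x.
  rewrite resample_indep ?subrr ?expr0n // => u v uv; congr F; apply/ffunP => e.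
  by apply: uv; rewrite finset.in_set0.
have /card_gt0P[e eB] : (0 < #|B|)%N by rewrite cB.
pose B' := B :\ e.
have cB' : #|B'| = k by have := cardsD1 e B; rewrite eB cB add1n => -[->].
rewrite (bigD1 e eB) /= mulrDr.
rewrite (eq_bigl (mem B')); last by move=> i; rewrite /= !finset.inE andbC.
have {}IH := IH B' cB'.
pose D x := F x - resample [set e] F x.
pose H x := F x - resample B' F x.
have DE x : F x - resample B F x = D x + resample [set e] H x.
  rewrite -[in LHS](finset.setD1K eB) resampleU /H resampleB /D.
  by rewrite addrA subrK.
have -> : esp (fun x => (F x - resample B F x) ^+ 2) =
  esp (fun x => D x ^+ 2) + esp (fun x => resample [set e] H x ^+ 2).
  have z0 : esp (fun x => D x * resample [set e] H x) = 0.
    rewrite -(@esp_chiM e (fun x => dif e F x * resample [set e] H x)).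
      apply: eq_esp => x; rewrite /D {1}(dif_decomp e F x); ring.
    by apply: indepM; [exact: indep_dif|exact: indep_resample].
  rewrite -[RHS]addr0 -(mulr0 2) -z0 -espZ -!espD.
  by apply: eq_esp => x; rewrite DE; ring.
rewrite esp_dif_sqr lerD2l (le_trans _ IH)//.
rewrite -(esp_resample [set e] (fun x => (F x - resample B' F x) ^+ 2)).
by apply: le_esp => // x; exact: esp_sqr_le.
Qed.

Lemma efron_stein_var F :
  esp (fun x => (F x - esp F) ^+ 2) <=
  p * (1 - p) * \sum_e esp (fun x => dif e F x ^+ 2).
Proof.
have := efron_stein [set: T]%SET F.
under [X in _ <= _ * X -> _]eq_bigl do rewrite finset.in_setT.
by apply: le_trans; rewrite le_eqVlt (@eq_esp _ _ _ _
  (fun x => (F x - resample [set: T]%SET F x) ^+ 2)) ?eqxx // => x; rewrite resampleT.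
Qed.

(* Degree at most [d] as a polynomial in the bits, through discrete derivatives. *)
Fixpoint deg d F : Prop :=
  if d is d'.+1 then forall e, deg d' (dif e F) else forall x y, F x = F y.

Lemma dif_indep B e F : indep B F -> e \in B -> dif e F = fun=> 0.
Proof.
by move=> iF eB; apply/funext => x; rewrite /dif !(indep_set_at _ _ iF)// subrr.
Qed.

Lemma deg_cst d k : deg d (fun=> k).
Proof.
elim: d k => [|d IH] k //= e.
by rewrite (_ : dif _ _ = fun=> 0) //; apply/funext => x; rewrite /dif subrr.
Qed.

Lemma difD e F G : dif e (fun x => F x + G x) = fun x => dif e F x + dif e G x.
Proof. by apply/funext => x; rewrite /dif; ring. Qed.

Lemma difN e F : dif e (fun x => - F x) = fun x => - dif e F x.
Proof. by apply/funext => x; rewrite /dif; ring. Qed.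

Lemma degD d F G : deg d F -> deg d G -> deg d (fun x => F x + G x).
Proof.
elim: d F G => [|d IH] F G dF dG; first by move=> x y; rewrite (dF x y) (dG x y).
by move=> e; rewrite difD; exact: IH.
Qed.

Lemma deg_set_at d e b F : deg d F -> deg d (fun x => F (set_at e b x)).
Proof.
elim: d F => [|d IH] F dF; first by move=> x y; exact: dF.
move=> e'; have [<-|ee] := eqVneq e e'.
  rewrite (_ : dif _ _ = fun=> 0); first exact: deg_cst.
  by apply/funext => x; rewrite /dif !set_at_id subrr.
rewrite (_ : dif _ _ = fun x => dif e' F (set_at e b x)); first exact: IH.
by apply/funext => x; rewrite /dif !(set_atC _ _ _ ee).
Qed.

Lemma degM d d' F G : deg d F -> deg d' G -> deg (d + d') (fun x => F x * G x).
Proof.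
move: {2}(d + d')%N (leqnn (d + d')) => n.
elim: n d d' F G => [|n IH] d d' F G le dF dG.
  move: le dF dG; case: d => // ; case: d' => // _ dF dG x y.
  by rewrite (dF x y) (dG x y).
have key m m' F' G' : (m + m' <= n)%N -> deg m F' -> deg m' G' ->
    deg (d + d').-1 (fun x => F' x * G' x) \/ (m + m' != (d + d').-1)%N.
  move=> mn dF' dG'; have [<-|_] := eqVneq (m + m')%N (d + d').-1; last by right.
  by left; exact: IH.
case: d le dF key => [|d] le dF key.
  case: d' le dG key => [|d'] le dG key.
    by move=> x y; rewrite (dF x y) (dG x y).
  move=> e; rewrite (_ : dif _ _ = fun x => F x * dif e G x).
    by case: (key 0%N d' F (dif e G) le dF (dG e)); rewrite ?eqxx.
  apply/funext => x; rewrite /dif (dF (set_at e true x) x) (dF (set_at e false x) x).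
  by ring.
move=> e; rewrite (_ : dif _ _ =
  fun x => dif e F x * G (set_at e true x) + F (set_at e false x) * dif e G x);
  last by apply/funext => x; rewrite /dif; ring.
apply: degD.
  by case: (key d d' _ _ le (dF e) (deg_set_at e true dG)); rewrite ?eqxx.
case: d' le dG key => [|d'] le dG key.
  rewrite (_ : (fun x => _) = fun=> 0); first exact: deg_cst.
  apply/funext => x; rewrite /dif (dG (set_at e true x) (set_at e false x)) subrr.
  by rewrite mulr0.
have le' : (d.+1 + d' <= n)%N by move: le; rewrite !addSn !addnS ltnS.
have E : (d.+1 + d' = (d.+1 + d'.+1).-1)%N by rewrite !addSn addnS.
by case: (key d.+1 d' _ _ le' (deg_set_at e false dF) (dG e)); rewrite // E eqxx.
Qed.

Lemma degX d k F : deg d F -> deg (d * k) (fun x => F x ^+ k).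
Proof.
move=> dF; elim: k => [|k IH]; first by rewrite muln0.
rewrite mulnS (_ : (fun x => _) = fun x => F x * F x ^+ k); first exact: degM.
by apply/funext => x; rewrite exprS.
Qed.

Lemma deg_junta d S F : (#|S| <= d)%N -> indep (~: S) F -> deg d F.
Proof.
elim: d S F => [|d IH] S F; rewrite ?leqn0 => cS iF.
  move=> x y; apply: iF => e; rewrite finset.inE negbK.
  by move: cS; rewrite cards_eq0 => /eqP ->; rewrite finset.in_set0.
move=> e; have [eS|eS] := boolP (e \in S); last first.
  by rewrite (dif_indep iF) ?finset.inE//; exact: deg_cst.
apply: (IH (S :\ e)); first by move: cS; rewrite (cardsD1 e) eS add1n ltnS.
move=> x y xy; congr (_ - _); apply: iF => e'; rewrite !cubeE !finset.inE negbK => e'S;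
by case: eqP => // /eqP ne; apply: xy; rewrite !finset.inE negbK ne.
Qed.

Lemma resample_dif B e F : dif e (resample B F) =
  if e \in B then fun=> 0 else resample B (dif e F).
Proof.
case: ifP => eB.
  by apply: dif_indep eB; exact: indep_resample.
apply/funext => x; rewrite /dif /resample -espB; apply: eq_esp => y.
by rewrite !merge_set_at eB.
Qed.

Lemma deg_resample d B F : deg d F -> deg d (resample B F).
Proof.
elim: d F => [|d IH] F dF.
  by move=> x y; rewrite !resample_indep// => u v _; exact: dF.
by move=> e; rewrite resample_dif; case: ifP => _; [exact: deg_cst|exact: IH].
Qed.

Definition kap : R := 4 / (p * (1 - p)).

Lemma pq_gt0 : 0 < p * (1 - p).
Proof. by case/andP: hp => p0 p1; rewrite mulr_gt0 ?subr_gt0. Qed.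

Lemma pq_le : p * (1 - p) <= 1 / 4.
Proof. have : 0 <= (p - 1 / 2) ^+ 2 by exact: sqr_ge0. nra. Qed.

(** Bonami's lemma for biased bits, by induction on the bits outside [A], the set of those already
    removed. In [F = G + chi e * D], both [G] and [D] ignore [e] and [D] has one degree less; the
    mixed moment of [G] and [D] is handled by Cauchy-Schwarz. *)
Lemma hypercontractive d F : deg d F ->
  esp (fun x => F x ^+ 4) <= (kap ^+ d * esp (fun x => F x ^+ 2)) ^+ 2.
Proof.
have s0 := pq_gt0; have sq := pq_le.
have ks : kap * (p * (1 - p)) = 4 by rewrite /kap divfK ?gt_eqF.
have k0 : 0 < kap by rewrite /kap divr_gt0.
move: {2}#|~: finset.set0 : {set T}| (leqnn #|~: finset.set0 : {set T}|) => n.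
have : indep finset.set0 F.
  by move=> x y xy; congr F; apply/ffunP => e; apply: xy; rewrite finset.inE.
move: (finset.set0 : {set T}) => A.
elim: n d A F => [|n IH] d A F iF cA dF.
  have [c Fc] : exists c, F = fun=> c.
    exists (F [ffun=> false]); apply/funext => x; apply: iF => e.
    have : ~: A = finset.set0 by apply/eqP; rewrite -cards_eq0 -leqn0.
    by move/setP/(_ e); rewrite !finset.inE => ->.
  rewrite Fc !esp_cst //.
  rewrite exprMn -exprM [leRHS]mulrC -[leLHS]mulr1 -exprM ler_wpM2l//.
    by rewrite (_ : 4 = (2 * 2))%N// exprM sqr_ge0.
  rewrite exprn_ege1 //; nra.
have [/eqP An|] := eqVneq (~: A) finset.set0.
  by apply: IH iF _ dF; rewrite (eqP An) cards0.
case/set0Pn => e; rewrite finset.inE => eA.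
have cA' : (#|~: (e |: A)| <= n)%N.
  have := cardsD1 e (~: A); rewrite finset.inE eA add1n => c1.
  rewrite (_ : ~: (e |: A) = (~: A) :\ e); first by move: cA; rewrite c1.
  by apply/setP => i; rewrite !finset.inE negb_or.
pose G := resample [set e] F; pose D := dif e F.
have iG : indep (e |: A) G.
  move=> x y xy; apply: eq_esp => z; apply: iF => i iA; rewrite !cubeE finset.in_set1.
  by case: eqP => // /eqP ne; apply: xy; rewrite !finset.inE negb_or ne.
have iD : indep (e |: A) D.
  move=> x y xy; congr (_ - _); apply: iF => i iA; rewrite !cubeE;
  by case: eqP => // /eqP ne; apply: xy; rewrite !finset.inE negb_or ne.
have iGe : indep [set e] G by apply: indepS iG; exact: finset.subsetUl.
have iDe : indep [set e] D by apply: indepS iD; exact: finset.subsetUl.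
have FE x : F x = G x + chi e x * D x by exact: dif_decomp.
have {}IHG := IH d (e |: A) G iG cA' (deg_resample _ dF).
case: d dF IHG => [|d] dF IHG.
  have FG : F = G.
    by apply/funext => x; rewrite FE /D /dif (dF _ x) (dF (set_at e false x) x)
      subrr mulr0 addr0.
  by rewrite FG.
have {IH}IHD := IH d (e |: A) D iD cA' (dF e).
set s := p * (1 - p) in s0 sq ks *.
set g := esp (fun x => G x ^+ 2) in IHG *.
set h := esp (fun x => D x ^+ 2) in IHD *.
have g0 : 0 <= g by apply: esp_ge0 => // x; exact: sqr_ge0.
have h0 : 0 <= h by apply: esp_ge0 => // x; exact: sqr_ge0.
have E2 : esp (fun x => F x ^+ 2) = g + s * h.
  have -> : esp (fun x => F x ^+ 2) =
     esp (fun x => (F x - G x) ^+ 2) + g + 2 * esp (fun x => chi e x * (G x * D x)).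
    by rewrite -espZ -!espD; apply: eq_esp => x; rewrite FE; ring.
  rewrite esp_chiM; last exact: indepM.
  by rewrite esp_dif_sqr mulr0 addr0 addrC.
have E4 : esp (fun x => F x ^+ 4) <= esp (fun x => G x ^+ 4) +
    8 * s * esp (fun x => G x ^+ 2 * D x ^+ 2) + 3 * s * esp (fun x => D x ^+ 4).
  rewrite (esp_av e) -!espZ -!espD; apply: le_esp => // x.
  rewrite !FE !(indep_set_at _ _ iGe) ?finset.in_set1// !(indep_set_at _ _ iDe)
    ?finset.in_set1// /chi !set_atE eqxx /=.
  set a := G x; set b := D x.
  have -> : p * (a + (1 - p) * b) ^+ 4 + (1 - p) * (a + (0 - p) * b) ^+ 4 =
    a ^+ 4 + 6 * s * (a ^+ 2 * b ^+ 2) + 4 * s * (1 - 2 * p) * (a * b ^+ 3)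
    + s * (1 - 3 * s) * b ^+ 4 by rewrite /s; ring.
  (* A biased bit has a third moment of either sign; this splits its term between the two even
     ones. *)
  have h1 : (1 - 2 * p) * (a * b ^+ 3) <= (a ^+ 2 * b ^+ 2 + b ^+ 4) / 2.
    have : 0 <= (a * b - (1 - 2 * p) * b ^+ 2) ^+ 2 by exact: sqr_ge0.
    have : (1 - 2 * p) ^+ 2 * b ^+ 4 <= 1 * b ^+ 4.
      rewrite ler_wpM2r //; first by rewrite (_ : 4 = (2 * 2))%N// exprM sqr_ge0.
      by move/andP: hp => [hp0 hp1]; nra.
    nra.
  have b4 : 0 <= b ^+ 4 by rewrite (_ : 4 = (2 * 2))%N// exprM sqr_ge0.
  have : 4 * s * (1 - 2 * p) * (a * b ^+ 3) <= 4 * s * ((a ^+ 2 * b ^+ 2 + b ^+ 4) / 2).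
    by rewrite -mulrA ler_pM2l// mulr_gt0.
  have : s * (1 - 3 * s) * b ^+ 4 <= s * b ^+ 4.
    rewrite ler_wpM2r// ; nra.
  nra.
have EGD : esp (fun x => G x ^+ 2 * D x ^+ 2) <= (kap ^+ d.+1 * g) * (kap ^+ d * h).
  rewrite -ler_sqr ?nnegrE; last 2 first.
  - by apply: esp_ge0 => // x; rewrite mulr_ge0 ?sqr_ge0.
  - by rewrite !mulr_ge0 ?exprn_ge0// ltW.
  rewrite (le_trans (esp_CS hp _ _))// [leRHS]exprMn.
  rewrite ler_pM ?esp_ge0//; do ?by move=> x; rewrite -exprM sqr_ge0 || rewrite exprn_ge0 ?sqr_ge0.
  - by under eq_esp do rewrite -exprM.
  - by under eq_esp do rewrite -exprM.
rewrite E2 (le_trans E4)//.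
rewrite (exprS kap d) in IHG EGD *.
set K := kap ^+ d in IHG IHD EGD *.
have K0 : 0 < K by rewrite exprn_gt0.
have t1 : 8 * s * esp (fun x => G x ^+ 2 * D x ^+ 2) <= 8 * s * (kap * K * g * (K * h)).
  by rewrite ler_pM2l// mulr_gt0.
have t2 : 3 * s * esp (fun x => D x ^+ 4) <= 3 * s * (K * h) ^+ 2.
  by rewrite ler_pM2l// mulr_gt0.
rewrite (le_trans (lerD (lerD IHG t1) t2))//.
have -> : (kap * K * (g + s * h)) ^+ 2 = (kap * K * g) ^+ 2 +
   2 * kap * (kap * s) * (K * g) * (K * h)+ (kap * s) ^+ 2 * (K * h) ^+ 2 by ring.
(* The value of [kap] is chosen for this comparison: with [kap * s = 4] the mixed terms have
   coefficients 32 and [8 * kap], the last squares [3 * s] and 16. *)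
rewrite ks.
have -> : 8 * s * (kap * K * g * (K * h)) = 8 * (kap * s) * (K * g) * (K * h) by ring.
rewrite ks -!addrA lerD2l.
have k1 : 4 <= kap by nra.
have P0 : 0 <= K * g * (K * h) by rewrite !mulr_ge0// ltW.
have Q0 : 0 <= (K * h) ^+ 2 by exact: sqr_ge0.
nra.
Qed.

Fixpoint hcst d k : R :=
  if k is k'.+1 then kap ^+ (2 * (d * 2 ^ k')) * hcst d k' ^+ 2 else 1.

Lemma kap_gt0 : 0 < kap.
Proof. by rewrite /kap divr_gt0// pq_gt0. Qed.

Lemma hcst_gt0 d k : 0 < hcst d k.
Proof. by elim: k => //= k IH; rewrite mulr_gt0 ?exprn_gt0 ?kap_gt0. Qed.

(** Iterates the fourth-moment bound: [F ^+ (2 ^ k)] has degree [d * 2 ^ k], and [hcst] collects the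
    constants. *)
Lemma hypercontractive_pow d k F : deg d F ->
  esp (fun x => F x ^+ (2 ^ k.+1)) <= hcst d k * esp (fun x => F x ^+ 2) ^+ (2 ^ k).
Proof.
move=> dF; elim: k => [|k IH]; first by rewrite /= mul1r expr1.
have := hypercontractive (degX (2 ^ k) dF).
under eq_esp do rewrite -exprM.
under [X in _ <= (_ * X) ^+ 2 -> _]eq_esp do rewrite -exprM -expnSr.
rewrite (_ : (2 ^ k * 4 = 2 ^ k.+2)%N); last by rewrite !expnS mulnC mulnA.
move=> /le_trans -> //; rewrite /= exprMn -exprM -mulnC -mulrA ler_wpM2l//.
  by rewrite exprn_ge0// ltW// kap_gt0.
rewrite [in leRHS]expnS mulnC exprM -exprMn ler_sqr ?nnegrE//.
- by apply: esp_ge0 => // x; rewrite expnS exprM exprn_ge0// sqr_ge0.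
- rewrite mulr_ge0 ?exprn_ge0 ?esp_ge0// ?ltW ?hcst_gt0// => x; exact: sqr_ge0.
Qed.

(** Markov's inequality for a moment of order [2 ^ k.+1]. As [k] is free, a deviation slightly above
    the standard deviation already has probability below any prescribed power. *)
Lemma concentration d (k : nat) (Y : {ffun T -> bool} -> R) (lam : R) : deg d Y -> 0 <= lam ->
  esp (fun x => (lam <= `|Y x - esp Y|)%R%:R) * lam ^+ (2 ^ k.+1) <=
  hcst d k * (\sum_e esp (fun x => dif e Y x ^+ 2)) ^+ (2 ^ k).
Proof.
move=> dY l0; rewrite -espZr.
have dY' : deg d (fun x => Y x - esp Y) by apply: degD => //; exact: deg_cst.
apply: (@le_trans _ _ (esp (fun x => (Y x - esp Y) ^+ (2 ^ k.+1)))).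
  apply: le_esp => // x; case: (boolP (lam <= _)) => [h|_]; rewrite ?mul1r ?mul0r.
    rewrite expnS !exprM -[_ ^+ 2 in leRHS]real_normK ?num_real//.
    by rewrite ler_pXn2r ?nnegrE ?expn_gt0 ?sqr_ge0// ler_sqr ?nnegrE.
  by rewrite expnS exprM exprn_ge0// sqr_ge0.
rewrite (le_trans (hypercontractive_pow k dY'))// (ler_wpM2l (ltW (hcst_gt0 _ _)))//.
have q0 : 0 <= \sum_e esp (fun x => dif e Y x ^+ 2).
  by apply: sumr_ge0 => e _; apply: esp_ge0 => // x; exact: sqr_ge0.
rewrite ler_pXn2r ?nnegrE ?expn_gt0//.
- rewrite (le_trans (efron_stein_var Y))// -[leRHS]mul1r ler_wpM2r//.
  by have := pq_le; lra.
- by apply: esp_ge0 => // x; exact: sqr_ge0.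
Qed.

End Hypercontractivity.

Arguments kap {R} p.
Arguments hcst {R} p d k.

(** * Phases with a large linear part *)

Section Trig.
Context {R : realType}.

Lemma polar (a b : R) : exists rho psi : R,
  [/\ 0 <= rho, rho ^+ 2 = a ^+ 2 + b ^+ 2, a = rho * cos psi & b = rho * sin psi].
Proof.
have s0 : 0 <= a ^+ 2 + b ^+ 2 by rewrite addr_ge0 ?sqr_ge0.
pose rho := Num.sqrt (a ^+ 2 + b ^+ 2).
have r2 : rho ^+ 2 = a ^+ 2 + b ^+ 2 by rewrite sqr_sqrtr.
have [r0|rn0] := eqVneq rho 0.
  have : a ^+ 2 + b ^+ 2 = 0 by rewrite -r2 r0 expr0n.
  move/eqP; rewrite paddr_eq0 ?sqr_ge0// !sqrf_eq0 => /andP[/eqP-> /eqP->].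
  by exists 0, 0; rewrite !mul0r expr0n /= addr0.
have rp : 0 < rho by rewrite lt_def rn0 sqrtr_ge0.
pose t := a / rho.
have t2 : t ^+ 2 + (b / rho) ^+ 2 = 1.
  by rewrite /t !expr_div_n -mulrDl -r2 divff// sqrf_eq0.
have t1 : -1 <= t <= 1.
  by rewrite -ler_norml -ler_sqr ?nnegrE// expr1n real_normK ?num_real// -t2 lerDl sqr_ge0.
have ct := acosK t1.
have st : sin (acos t) = `|b / rho|.
  rewrite sin_acos // (_ : 1 - t ^+ 2 = (b / rho) ^+ 2) ?sqrtr_sqr//.
  by rewrite -t2; ring.
have [b0|b0] := leP 0 b.
  exists rho, (acos t); split => //; first exact: ltW.
    by rewrite ct /t mulrC divfK.
  by rewrite st (ger0_norm (divr_ge0 b0 (ltW rp))) mulrC divfK.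
exists rho, (- acos t); split => //; first exact: ltW.
  by rewrite cosN ct /t mulrC divfK.
rewrite sinN st normrM ltr0_norm// gtr0_norm ?invr_gt0//.
by rewrite mulNr opprK mulrC divfK.
Qed.

Lemma sin_ge_half (x : R) : 0 <= x <= pi / 4 -> x / 2 <= sin x.
Proof.
move=> /andP[x0 x4].
have [->|xn0] := eqVneq x 0; first by rewrite sin0 mul0r.
have xp : 0 < x by rewrite lt_def xn0.
have [y yx] : exists2 y, y \in `]0, x[ & sin x - sin 0 = cos y * (x - 0).
  apply: (@MVT _ sin cos) => //; apply: continuous_subspaceT => z.
  exact: continuous_sin.
rewrite sin0 !subr0 => ->; rewrite mulrC ler_wpM2r//.
have p0 : 0 < pi :> R := pi_gt0 R.
move: yx; rewrite in_itv /= => /andP[y0 yx].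
have y4 : y <= pi / 4 by rewrite (le_trans (ltW yx)).
have : cos (pi / 4 : R) <= cos y.
  have := y4; rewrite le_eqVlt => /predU1P[->//|yl].
  rewrite ltW// ltr_cos ?in_itv //=; apply/andP; split; lra.
apply: le_trans.
have c0 : 0 <= cos (pi / 4 : R).
  apply: cos_ge0_pihalf; apply/andP; split; lra.
have : cos (pi / 4 : R) ^+ 2 = 1 / 2.
  have := cos_pihalf R; have -> : pi / 2 = pi / 4 + pi / 4 :> R by field.
  by rewrite cosD; have := cos2Dsin2 (pi / 4 : R); rewrite -!expr2; lra.
by nra.
Qed.

(** Two half-angle formulas reduce the angle to [u / 4], in the range of [sin_ge_half]. *)
Lemma one_sub_cos (u : R) : `|u| <= pi -> u ^+ 2 / 16 <= 1 - cos u.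
Proof.
wlog u0 : u / 0 <= u.
  move=> H; have [/H//|/ltW ul] := leP 0 u => hu.
  by have := H (- u); rewrite oppr_ge0 normrN sqrrN cosN => ->.
rewrite ger0_norm// => ul.
have p0 : 0 < pi :> R := pi_gt0 R.
have s4 : u / 4 / 2 <= sin (u / 4) by apply: sin_ge_half; apply/andP; split; lra.
have c4 : 0 <= cos (u / 4) by apply: cos_ge0_pihalf; apply/andP; split; lra.
have e1 : cos u = 2 * cos (u / 2) ^+ 2 - 1.
  rewrite [in LHS](_ : u = u / 2 + u / 2); last by field.
  by rewrite cosD; have := cos2Dsin2 (u / 2); rewrite -!expr2; lra.
have e2 : cos (u / 2) = 1 - 2 * sin (u / 4) ^+ 2.
  rewrite [in LHS](_ : u / 2 = u / 4 + u / 4); last by field.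
  by rewrite cosD; have := cos2Dsin2 (u / 4); rewrite -!expr2; lra.
have e3 : 0 <= cos (u / 2) by apply: cos_ge0_pihalf; apply/andP; split; lra.
have s8 : (u / 8) ^+ 2 <= sin (u / 4) ^+ 2.
  rewrite ler_sqr ?nnegrE//; [|by lra|by lra].
  by rewrite (_ : u / 8 = u / 4 / 2)//; field.
rewrite e1 e2; rewrite e2 in e3; nra.
Qed.

(** The squared modulus of the characteristic function of a bit is
    [1 - 2 * p * (1 - p) * (1 - cos u)]; the 16 is that of [one_sub_cos]. *)
Definition crho (p : R) := p * (1 - p) / 16.

(* [rho * expR ('i psi)] is the characteristic function of a [p]-Bernoulli bit at [u]. *)
Lemma bit_phase (p u : R) : 0 < p < 1 -> `|u| <= pi -> exists rho psi : R,
  [/\ 0 <= rho, rho <= expR (- (crho p * u ^+ 2)) &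
  forall c, p * cos (c + u) + (1 - p) * cos c = rho * cos (c + psi)].
Proof.
move=> hp hu; have [rho [psi [r0 r2 ra rb]]] := polar (1 - p + p * cos u) (p * sin u).
exists rho, psi; split => //; last first.
  move=> c; rewrite !cosD.
  have -> : rho * (cos c * cos psi - sin c * sin psi) =
    cos c * (rho * cos psi) - sin c * (rho * sin psi) by ring.
  by rewrite -ra -rb; ring.
have pq := pq_gt0 hp.
rewrite -ler_sqr ?nnegrE ?expR_ge0// r2 -expRM_natl.
apply: (@le_trans _ _ (1 - 2 * (p * (1 - p)) * (1 - cos u))).
  by have := cos2Dsin2 u; nra.
have := one_sub_cos hu => h.
apply: (@le_trans _ _ (1 + 2 * - (crho p * u ^+ 2))); last exact: expR_ge1Dx.
by rewrite /crho; nra.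
Qed.

(** Differentiating the cosine shifts its phase by [pi / 2], so the derivative of a Taylor remainder
    is the remainder of one order less at the shifted phase. The Taylor bounds then follow by
    induction. *)
Lemma is_derive_cos_taylor (K : nat) (u w : R) :
  is_derive w 1
    (fun w => cos (u + w) - \sum_(m < K.+1) w ^+ m / m`!%:R * cos (u + m%:R * (pi / 2)))
    (cos (u + pi / 2 + w) - \sum_(m < K) w ^+ m / m`!%:R * cos (u + pi / 2 + m%:R * (pi / 2))).
Proof.
pose k (m : nat) := cos (u + m%:R * (pi / 2)).
set r := (X in is_derive _ _ X).
have -> : r = (cos \o (fun w => u + w)) - (cst (k 0%N) +
    \sum_(m < K) (fun w => w ^+ m.+1 / m.+1`!%:R * k m.+1)).
  apply/funext => z; rewrite /r big_ord_recl /= fct_sumE /= expr0 fact0.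
  by rewrite divr1 mul1r.
have dc : is_derive w 1 (cos \o (fun w => u + w)) (- sin (u + w) * 1).
  have d1 : is_derive w 1 (cst u + @id R) 1.
    by apply: is_derive_eq; rewrite add0r.
  exact: (@is_derive1_comp _ cos (cst u + @id R) w _ _ (is_derive_cos _) d1).
have dm (m : 'I_K) : is_derive w 1 (fun w : R => w ^+ m.+1 / m.+1`!%:R * k m.+1)
    (w ^+ m / m`!%:R * k m.+1).
  have -> : (fun w : R => w ^+ m.+1 / m.+1`!%:R * k m.+1) =
     (k m.+1 / m.+1`!%:R) *: ((@id R) ^+ m.+1).
    by apply/funext => z; rewrite /= exprfctE /GRing.scale /= mulrC [_ / _]mulrC mulrA.
  apply: is_derive_eq; rewrite /GRing.scale /= factS natrM.
  have n1 : m.+1%:R != 0 :> R by rewrite pnatr_eq0.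
  have n2 : m`!%:R != 0 :> R by rewrite pnatr_eq0 -lt0n fact_gt0.
  have fld (a b kk ww : R) : a != 0 -> b != 0 ->
    kk / (a * b) * (a * ww * 1) = ww / b * kk.
    by move=> a0 b0; field; rewrite a0 b0.
  exact: fld.
apply: is_derive_eq.
rewrite mulr1 add0r; congr (_ - _).
  by rewrite addrAC cosDpihalf.
apply: eq_bigr => m _; congr (_ * cos _); rewrite -[m.+1%:R]natr1; ring.
Qed.

Lemma cos_taylor (K : nat) (u v : R) :
  `|cos (u + v) - \sum_(m < K) v ^+ m / m`!%:R * cos (u + m%:R * (pi / 2))| <= `|v| ^+ K.
Proof.
elim: K u v => [|K IH] u v; first by rewrite big_ord0 subr0 expr0 ler_norml cos_le1 cos_geN1.
pose r (w : R) := cos (u + w) - \sum_(m < K.+1) w ^+ m / m`!%:R * cos (u + m%:R * (pi / 2)).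
pose r' (w : R) := cos (u + pi / 2 + w) -
  \sum_(m < K) w ^+ m / m`!%:R * cos (u + pi / 2 + m%:R * (pi / 2)).
have dr (w : R) : is_derive w 1 r (r' w) := is_derive_cos_taylor K u w.
have r0 : r 0 = 0.
  rewrite /r big_ord_recl big1 => [|m _]; last by rewrite expr0n /= !mul0r.
  by rewrite fact0 expr0 divr1 mul1r mul0r !addr0 subrr.
have r'le (w : R) : `|r' w| <= `|w| ^+ K by exact: IH.
have rc (a b : R) : {within `[a, b], continuous r}.
  by apply: derivable_within_continuous => z _; apply: ex_derive.
have -> : cos (u + v) - \sum_(m < K.+1) v ^+ m / m`!%:R * cos (u + m%:R * (pi / 2)) = r v by [].
rewrite exprSr; have [v0|v0|v0] := ltgtP v 0; last by rewrite v0 r0 !normr0 mulr0.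
  have [z zv] := MVT v0 (fun x _ => dr x) (rc v 0).
  rewrite r0 !sub0r => /eqP; rewrite eqr_oppLR => /eqP ->.
  rewrite mulrN opprK normrM ler_wpM2r// (le_trans (r'le z))// lerXn2r ?nnegrE//.
  by move: zv; rewrite in_itv /= => /andP[vz z0]; rewrite !ltr0_norm// lerN2 ltW.
have [z zv] := MVT v0 (fun x _ => dr x) (rc 0 v).
rewrite r0 !subr0 => ->.
rewrite normrM ler_wpM2r// (le_trans (r'le z))// lerXn2r ?nnegrE//.
by move: zv; rewrite in_itv /= => /andP[z0 vz]; rewrite !gtr0_norm// ltW.
Qed.

End Trig.

Section CharBound.
Context {R : realType} {T : finType} {p : R}.
Hypothesis hp : 0 < p < 1.
Implicit Types (F G H J : {ffun T -> bool} -> R) (x y : {ffun T -> bool}).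
Implicit Types (B S D : {set T}) (e : T).

Local Notation esp := (@esp R T p).
Local Notation resample := (@resample R T p).
Local Notation chi := (@chi R T p).
Local Notation crho := (crho p).

Lemma crho_gt0 : 0 < crho.
Proof. by rewrite /crho divr_gt0// pq_gt0. Qed.

(** The bits of [D] are integrated out one at a time. By [bit_phase], each yields a damping factor
    [rho] and a shift [psi], and the shift joins [c]; this is why [c] is general. *)
Lemma junta_linear_phase D (u : T -> R) J (c : {ffun T -> bool} -> R) (M : R) :
  {in D, forall e, `|u e| <= pi} -> indep D J -> indep D c -> (forall x, `|J x| <= M) ->
  `|esp (fun x => J x * cos (c x + \sum_(e in D) u e * (x e)%:R))| <=
  M * expR (- (crho * \sum_(e in D) u e ^+ 2)).
Proof.
move: {2}#|D| (erefl #|D|) => n; elim: n D c => [|n IH] D c cD uD iJ ic JM.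
  have -> : D = finset.set0 by apply/eqP; rewrite -cards_eq0 cD.
  rewrite big_set0 mulr0 oppr0 expR0 mulr1; apply: esp_abs_le => // x.
  rewrite normrM -[M]mulr1 ler_pM//.
  by rewrite ler_norml cos_le1 cos_geN1.
have /card_gt0P[e eD] : (0 < #|D|)%N by rewrite cD.
have cD' : #|D :\ e| = n by have := cardsD1 e D; rewrite eD cD add1n => -[->].
have [rho [psi [r0 rle rE]]] := bit_phase hp (uD e eD).
have sD : D :\ e \subset D by exact: subD1set.
have -> : esp (fun x => J x * cos (c x + \sum_(e in D) u e * (x e)%:R)) =
   rho * esp (fun x => J x * cos (c x + psi + \sum_(i in D :\ e) u i * (x i)%:R)).
  rewrite (esp_av e) -espZ; apply: eq_esp => x.
  have sE b : \sum_(i in D) u i * (set_at e b x i)%:R =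
      u e * b%:R + \sum_(i in D :\ e) u i * (x i)%:R.
    rewrite (big_setD1 e eD) /= set_atE eqxx; congr (_ + _).
    apply: eq_bigr => i; rewrite !finset.inE set_atE => /andP[/negPf -> _] //.
  rewrite !sE !(indep_set_at _ _ iJ)// !(indep_set_at _ _ ic)//= mulr1 mulr0 add0r.
  set s := \sum_(i in D :\ e) _.
  have -> : c x + psi + s = c x + s + psi by ring.
  have -> : c x + (u e + s) = c x + s + u e by ring.
  by rewrite [RHS]mulrCA -rE; ring.
rewrite normrM (ger0_norm r0) (big_setD1 e eD) /= mulrDr opprD expRD mulrCA.
rewrite ler_pM//; apply: IH => //.
- by move=> i /(fintype.subsetP sD)/uD.
- exact: indepS iJ.
- by move=> x y xy; rewrite (indepS sD ic xy).
Qed.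

(** Sums of functions of at most [d] bits each. The index bounds the sum of their sup norms, so that
    an estimate linear in each junta passes to the sum. *)
Inductive juntas (d : nat) : R -> ({ffun T -> bool} -> R) -> Prop :=
| juntas_nil : juntas d 0 (fun=> 0)
| juntas_cons S (M : R) J M' F : (#|S| <= d)%N -> indep (~: S) J ->
    (forall x, `|J x| <= M) -> juntas d M' F ->
    juntas d (M + M') (fun x => J x + F x).

Lemma juntas_ge0 d M F : juntas d M F -> 0 <= M.
Proof.
elim=> // {}S {}M J M' {}F _ _ JM _ M'0; rewrite addr_ge0//.
by rewrite (le_trans _ (JM [ffun=> false])).
Qed.

Lemma juntas_deg d M F : juntas d M F -> deg d F.
Proof.
elim=> [|{}S {}M J M' {}F cS iJ _ _ dF]; first exact: deg_cst.
by apply: degD => //; exact: deg_junta iJ.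
Qed.

Lemma juntas1 d S M J : (#|S| <= d)%N -> indep (~: S) J ->
  (forall x, `|J x| <= M) -> juntas d M J.
Proof.
move=> cS iJ JM; have := juntas_cons cS iJ JM (juntas_nil d).
by rewrite addr0; under eq_fun do rewrite addr0.
Qed.

Lemma juntas_weak d M M' F : juntas d M F -> M <= M' -> juntas d M' F.
Proof.
move=> jF MM; rewrite -(subrK M M') (_ : F = fun x => 0 + F x); last first.
  by apply/funext => x; rewrite add0r.
apply: (@juntas_cons _ finset.set0) jF; rewrite ?cards0// => x.
by rewrite normr0 subr_ge0.
Qed.

Lemma juntasD d M M' F G : juntas d M F -> juntas d M' G ->
  juntas d (M + M') (fun x => F x + G x).
Proof.
move=> jF jG; elim: jF => [|{}S {}M J M1 {}F cS iJ JM _ jF].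
  by rewrite add0r; under eq_fun do rewrite add0r.
by rewrite -addrA; under eq_fun do rewrite -addrA; exact: juntas_cons iJ JM jF.
Qed.

Lemma juntas_sum d (I : Type) (r : seq I) (P : pred I) (M : I -> R)
    (F : I -> {ffun T -> bool} -> R) :
  (forall i, P i -> juntas d (M i) (F i)) ->
  juntas d (\sum_(i <- r | P i) M i) (fun x => \sum_(i <- r | P i) F i x).
Proof.
move=> jF; elim: r => [|i r IH].
  by rewrite big_nil; under eq_fun do rewrite big_nil; exact: juntas_nil.
have -> : (fun x => \sum_(j <- i :: r | P j) F j x) =
    if P i then (fun x => F i x + \sum_(j <- r | P j) F j x)
    else (fun x => \sum_(j <- r | P j) F j x).
  by apply/funext => x; rewrite big_cons; case: ifP.
by rewrite big_cons; case: ifP => // Pi; exact: juntasD (jF _ Pi) IH.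
Qed.

Lemma juntasN d M F : juntas d M F -> juntas d M (fun x => - F x).
Proof.
elim=> [|{}S {}M J M1 {}F cS iJ JM _ jF].
  by under eq_fun do rewrite oppr0; exact: juntas_nil.
under eq_fun do rewrite opprD; apply: juntas_cons cS _ _ jF.
- exact: indepN.
- by move=> x; rewrite normrN.
Qed.

Lemma juntas_resample d M F B : juntas d M F -> juntas d M (resample B F).
Proof.
elim=> [|{}S {}M J M1 {}F cS iJ JM _ jF].
  by rewrite (_ : resample _ _ = fun=> 0); [exact: juntas_nil|
    apply/funext => x; rewrite /resample esp_cst].
rewrite (_ : resample _ _ = fun x => resample B J x + resample B F x); last first.
  by apply/funext => x; rewrite /resample espD.
apply: juntas_cons cS _ _ jF.
- move=> x y xy; apply: eq_esp => z; apply: iJ => e eS; rewrite !cubeE.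
  by case: ifP => // _; exact: xy.
- by move=> x; exact: esp_abs_le.
Qed.

Lemma juntasM d d' M M' F G : juntas d M F -> juntas d' M' G ->
  juntas (d + d') (M * M') (fun x => F x * G x).
Proof.
move=> jF jG; elim: jF => [|S {}M J M1 {}F cS iJ JM _ jF].
  by rewrite mul0r; under eq_fun do rewrite mul0r; exact: juntas_nil.
rewrite mulrDl; under eq_fun do rewrite mulrDl; apply: juntasD => //.
clear jF; elim: jG => [|S' {}M' J' M1' {}G cS' iJ' JM' _ jG].
  by rewrite mulr0; under eq_fun do rewrite mulr0; exact: juntas_nil.
rewrite mulrDr; under eq_fun do rewrite mulrDr; apply: (@juntas_cons _ (S :|: S')) jG.
- by rewrite (leq_trans (leq_card_setU S S'))// leq_add.
- move=> x y xy; rewrite (iJ x y) 1?(iJ' x y)// => e; rewrite finset.inE negbK => eS;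
  by apply: xy; rewrite !finset.inE negbK eS ?orbT.
- by move=> x; rewrite normrM ler_pM.
Qed.

Lemma juntasX d M F m : juntas d M F -> juntas (d * m) (M ^+ m) (fun x => F x ^+ m).
Proof.
move=> jF; elim: m => [|m IH].
  rewrite muln0 expr0; under eq_fun do rewrite expr0.
  by apply: (@juntas1 _ finset.set0); rewrite ?cards0// => x; rewrite normr1.
by rewrite mulnS exprS; under eq_fun do rewrite exprS; exact: juntasM.
Qed.

(** For each junta, the at most [d] bits it depends on are taken out of the linear phase. Each costs
    [u e ^+ 2 <= pi ^+ 2 <= 16] in the exponent, hence the correction [16 * d]. *)
Lemma juntas_phase d M F B (u : T -> R) (c : {ffun T -> bool} -> R) :
  juntas d M F -> {in B, forall e, `|u e| <= pi} -> indep B c ->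
  `|esp (fun x => F x * cos (c x + \sum_(e in B) u e * (x e)%:R))| <=
  M * expR (- (crho * (\sum_(e in B) u e ^+ 2 - 16 * d%:R))).
Proof.
move=> jF uB ic; elim: jF => [|S {}M J M1 {}F cS iJ JM _ IH].
  by rewrite mul0r; under eq_esp do rewrite mul0r; rewrite esp_cst normr0.
under eq_esp do rewrite mulrDl.
rewrite espD (le_trans (ler_normD _ _))// mulrDl lerD//.
pose D := B :\: S.
have sD : D \subset B by exact: subsetDl.
pose c' x := c x + \sum_(e in B :&: S) u e * (x e)%:R.
have cE x : c x + \sum_(e in B) u e * (x e)%:R = c' x + \sum_(e in D) u e * (x e)%:R.
  rewrite (big_setID S) /= /c' -addrA; congr (_ + (_ + _)).
under eq_esp do rewrite cE.
have M0 : 0 <= M by rewrite (le_trans _ (JM [ffun=> false])).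
have uD : {in D, forall e, `|u e| <= pi} by move=> e /(fintype.subsetP sD)/uB.
have iJD : indep D J.
  by apply: indepS iJ; apply/fintype.subsetP => e; rewrite !finset.inE => /andP[].
have icD : indep D c'.
  move=> x y xy; rewrite /c' (ic x y).
    congr (_ + _); apply: eq_bigr => e; rewrite !finset.inE => /andP[eB eS].
    by rewrite xy// !finset.inE eS.
  by move=> e eB; apply: xy; rewrite !finset.inE negb_and eB orbT.
apply: (le_trans (junta_linear_phase uD iJD icD JM)).
rewrite ler_wpM2l// ler_expR lerN2 ler_wpM2l ?(ltW crho_gt0)//.
rewrite (big_setID S) /= -/D lerBlDr addrC lerD2l.
apply: (@le_trans _ _ (\sum_(e in B :&: S) 16)).
  apply: ler_sum => e; rewrite finset.inE => /andP[eB _].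
  rewrite -real_normK ?num_real// (_ : 16 = 4 ^+ 2)%R; last by ring.
  rewrite ler_sqr ?nnegrE// (le_trans (uB e eB))//.
  by have /andP[_ /ltW] := pihalf_02 R; lra.
rewrite sumr_const -[leLHS]mulr_natr ler_wpM2l// ler_nat (leq_trans _ cS)//.
by rewrite subset_leq_card// subsetIr.
Qed.

(* [cos] of the nonlinear part is expanded by Taylor: its powers are sums of juntas, whose
   small supports leave most of the linear phase intact. *)
Lemma char_bound d k g h B (a : T -> R) (M Ma : R) :
  (0 < d)%N -> juntas d M g -> indep B h -> {in B, forall e, `|a e| <= pi} ->
  \sum_(e in B) `|a e| <= Ma ->
  `|esp (fun x => cos (h x + g x))| <=
  (2 ^ k.+1)%:R * (1 + 2 * M + Ma) ^+ (2 ^ k.+1) *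
    expR (- (crho * (\sum_(e in B) a e ^+ 2 - 16 * (d * 2 ^ k.+1)%:R))) +
  hcst p d k * (\sum_(e in B) esp (fun x => (dif e g x - a e) ^+ 2)) ^+ (2 ^ k).
Proof.
(* The Taylor order is a power of two, so that the error term is a moment covered by
   [hypercontractive_pow]. *)
move=> d0 jg ih aB Mab; set N := (2 ^ k.+1)%N.
pose l x := \sum_(e in B) a e * chi e x.
(* The mean of [g] over [B] ignores [B] and joins [h], the part [l] keeps oscillating, and only [Q]
   is expanded. *)
pose Q x := g x - resample B g x - l x.
pose A := \sum_(e in B) a e * p.
have jl : juntas d Ma l.
  have : juntas d (\sum_(e in B) `|a e|) l.
    apply: juntas_sum => e eB; apply: (@juntas1 _ [set e]); rewrite ?cards1//.
      move=> x y xy; rewrite /chi xy// !finset.inE negbK//.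
    move=> x; rewrite normrM -[leRHS]mulr1 ler_pM// /chi ler_norml.
    by case/andP: hp => p0 p1; case: (x e) => /=; apply/andP; split; lra.
  by move=> j; exact: juntas_weak j Mab.
have jQ : juntas d (M + M + Ma) Q.
  rewrite /Q; apply: juntasD; last exact: juntasN.
  by apply: juntasD => //; apply: juntasN; exact: juntas_resample.
pose c x := h x + resample B g x - A.
have ic : indep B c.
  by move=> x y xy; rewrite /c (ih _ _ xy) (indep_resample _ xy).
have lE x : l x = - A + \sum_(e in B) a e * (x e)%:R.
  rewrite addrC -sumrB; apply: eq_bigr => e _; rewrite /chi; ring.
have fE x : h x + g x = (c x + \sum_(e in B) a e * (x e)%:R) + Q x.
  by rewrite /Q lE /c; ring.
set X := _ * expR _.
pose tm (m : nat) x := Q x ^+ m / m`!%:R *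
   cos (c x + m%:R * (pi / 2) + \sum_(e in B) a e * (x e)%:R).
have tmle (m : nat) : (m <= N)%N -> `|esp (tm m)| <= (1 + 2 * M + Ma) ^+ N *
    expR (- (crho * (\sum_(e in B) a e ^+ 2 - 16 * (d * N)%:R))).
  move=> mN.
  have -> : esp (tm m) = (m`!%:R)^-1 * esp (fun x => Q x ^+ m *
     cos (c x + m%:R * (pi / 2) + \sum_(e in B) a e * (x e)%:R)).
    by rewrite -espZ; apply: eq_esp => x; rewrite /tm; ring.
  rewrite normrM -[leRHS]mul1r ler_pM//.
    by rewrite normfV ger0_norm// invf_le1 ?ltr0n ?fact_gt0// ler1n fact_gt0.
  have icm : indep B (fun x => c x + m%:R * (pi / 2)).
    by move=> x y xy; rewrite (ic _ _ xy).
  apply: (le_trans (juntas_phase (juntasX m jQ) aB icm)).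
  have M0 := juntas_ge0 jg; have Ma0 := juntas_ge0 jl.
  rewrite ler_pM ?exprn_ge0 ?addr_ge0 ?expR_ge0//.
    apply: (@le_trans _ _ ((1 + 2 * M + Ma) ^+ m)).
      by rewrite lerXn2r ?nnegrE ?addr_ge0 ?mulr_ge0//; lra.
    by rewrite ler_weXn2l//; lra.
  rewrite ler_expR lerN2 ler_wpM2l ?(ltW crho_gt0)// lerD2l lerN2 ler_wpM2l//.
  by rewrite ler_nat leq_mul2l mN orbT.
have EQ : esp (fun x => Q x ^+ 2) <=
    \sum_(e in B) esp (fun x => (dif e g x - a e) ^+ 2).
  (* [l] has mean zero over [B], so [Q] is the fluctuation of [g - l] in the bits of [B]; the
     derivatives of [g - l] along [B] are those of [g] minus [a], as Efron-Stein requires. *)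
  pose r x := g x - l x.
  have rl x : resample B l x = 0.
    rewrite /resample /l esp_sum big1// => e eB; rewrite espZ.
    rewrite (_ : esp _ = 0) ?mulr0// /chi; under eq_esp do rewrite mergeE eB.
    by rewrite (esp_coord e (fun b => b%:R - p)) /=; ring.
  have := efron_stein hp B r.
  have -> : esp (fun x => (r x - resample B r x) ^+ 2) = esp (fun x => Q x ^+ 2).
    by apply: eq_esp => x; rewrite /r resampleB rl /Q; ring.
  move=> /le_trans; apply; rewrite -[leRHS]mul1r ler_pM ?pq_ge0//.
  - by apply: sumr_ge0 => e _; apply: esp_ge0 => // x; exact: sqr_ge0.
  - by have := @pq_le _ p; lra.
  rewrite le_eqVlt; apply/orP; left; apply/eqP; apply: eq_bigr => e eB.
  apply: eq_esp => x; congr (_ ^+ 2); rewrite /r /dif.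
  suff : l (set_at e true x) - l (set_at e false x) = a e by move=> <-; ring.
  rewrite /l !(big_setD1 e eB) /= /chi !set_atE eqxx /=.
  rewrite (eq_bigr (fun i => a i * ((set_at e false x i)%:R - p))); first by ring.
  by move=> i; rewrite !finset.inE !set_atE => /andP[/negPf -> _].
have -> : esp (fun x => cos (h x + g x)) =
   \sum_(m < N) esp (tm m) + esp (fun x => cos (h x + g x) - \sum_(m < N) tm m x).
  by rewrite espB esp_sum; ring.
rewrite (le_trans (ler_normD _ _))// lerD//.
  rewrite (le_trans (ler_norm_sum _ _ _))//.
  apply: (@le_trans _ _ (\sum_(m < N) ((1 + 2 * M + Ma) ^+ N *
    expR (- (crho * (\sum_(e in B) a e ^+ 2 - 16 * (d * N)%:R)))))).
    by apply: ler_sum => m _; exact/tmle/ltnW/ltn_ord.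
  by rewrite sumr_const card_ord -[leLHS]mulr_natl /X mulrA.
apply: (@le_trans _ _ (esp (fun x => Q x ^+ N))).
  rewrite (le_trans (ler_norm_esp hp _))//; apply: le_esp => // x.
  have -> : Q x ^+ N = `|Q x| ^+ N.
    by rewrite /N expnS !exprM real_normK ?num_real.
  apply: le_trans (cos_taylor N (c x + \sum_(e in B) a e * (x e)%:R) (Q x)).
  rewrite fE le_eqVlt; apply/orP; left; apply/eqP; congr (`|_ - _|); apply: eq_bigr => m _.
  by rewrite /tm addrAC.
rewrite (le_trans (hypercontractive_pow hp k (juntas_deg jQ)))//.
rewrite ler_wpM2l ?(ltW (hcst_gt0 hp _ _))//.
rewrite lerXn2r ?nnegrE//; first by apply: esp_ge0 => // x; exact: sqr_ge0.
by apply: sumr_ge0 => e _; apply: esp_ge0 => // x; exact: sqr_ge0.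
Qed.

End CharBound.

(** * Clique counts *)

Fact clq_key : unit. Proof. exact: tt. Qed.

Section CliqueDefs.
Context {R : realType} {V E : finType} (en : E -> {set V}).
Implicit Types (x : {ffun E -> bool}) (S N W : {set V}).

Definition eset S : {set E} := [set e : E | en e \subset S].

(* Locked: unification must not try to decide cliques by computation. *)
Definition clq S x : bool :=
  locked_with clq_key [forall e : E, (en e \subset S) ==> x e].

Definition cliques N (j : nat) x : R :=
  \sum_(S : {set V} | (#|S| == j) && (S \subset N)) (clq S x)%:R.

Definition nsup W N (j : nat) : R :=
  #|[set S : {set V} | [&& #|S| == j, S \subset N & W \subset S]]%SET|%:R.

(** The mean derivative of the [j]-clique count of [N] vertices along one edge: the [j]-sets through
    the edge, times the probability that their other edges are present. *)
Definition kappa (p : R) (N j : nat) : R := p ^+ ('C(j, 2)).-1 * 'C(N - 2, j - 2)%:R.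

End CliqueDefs.

Section Cliques.
Context {R : realType} {V E : finType} {p : R} {en : E -> {set V}}.
Hypothesis hp : 0 < p < 1.
Hypothesis en_inj : injective en.
Hypothesis card_edge : forall e, #|en e| = 2%N.
Context {ed : V -> V -> E}.
Hypothesis edE : forall u v, u != v -> en (ed u v) = [set u; v]%SET.
Local Notation n := #|V|.
Local Notation eset := (eset en).
Local Notation clq := (clq en).
Local Notation cliques := (@cliques R V E en).
Local Notation nsup := (@nsup R V).
Implicit Types (x y : {ffun E -> bool}) (S N W : {set V}) (e : E).

Local Notation esp := (@esp R E p).

Lemma clqP S x : reflect (forall e, en e \subset S -> x e) (clq S x).
Proof.
rewrite /clq locked_withE; apply: (iffP idP) => [/fintype.forallP h e eS|h].
  by have := h e; rewrite eS.
by apply/fintype.forallP => e; apply/implyP => eS; exact: h.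
Qed.

Lemma card_eset S : #|eset S| = 'C(#|S|, 2).
Proof.
rewrite -cards_draws -(card_imset _ en_inj); apply: eq_card => X.
rewrite !finset.inE; apply/imsetP/andP => [[e]|[XS X2]].
  by rewrite finset.inE => eS ->; rewrite card_edge.
have [u [v [uv XE]]] := cards2P _ X2.
by exists (ed u v); rewrite ?finset.inE edE// -XE.
Qed.

Lemma leq_bin_exp (m k : nat) : ('C(m, k) <= m ^ k)%N.
Proof.
apply: (@leq_trans (m ^_ k)).
  by rewrite -bin_ffact leq_pmulr// fact_gt0.
elim: k => [|k IH]; first by rewrite ffactn0.
by rewrite ffactnSr expnSr leq_mul// leq_subr.
Qed.

Lemma card_supset W N (j : nat) : W \subset N ->
  #|[set S : {set V} | [&& #|S| == j, S \subset N & W \subset S]]%SET| =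
  if (#|W| <= j)%N then 'C(#|N| - #|W|, j - #|W|) else 0%N.
Proof.
move=> WN; case: ifP => Wj; last first.
  apply/eqP; rewrite cards_eq0; apply/eqP/setP => S; rewrite !finset.inE.
  case: and3P => // -[/eqP cS _ WS].
  by have := subset_leq_card WS; rewrite cS Wj.
rewrite -(cardsDS WN) -cards_draws.
rewrite -[RHS](@card_in_imset _ _ (fun X : {set V} => W :|: X)); last first.
  move=> X Y; rewrite !finset.inE => /andP[XN _] /andP[YN _] XY.
  have d (Z : {set V}) : Z \subset N :\: W -> Z = (W :|: Z) :\: W.
    move=> ZN; apply/setP => i; rewrite !finset.inE.
    have := fintype.subsetP ZN i; rewrite !finset.inE.
    by case: (i \in Z) => [/(_ isT)/andP[->]|_]; rewrite ?orbT// orbF; case: (i \in W).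
  by rewrite (d X)// (d Y)// XY.
apply: eq_card => S; rewrite !finset.inE; apply/and3P/imsetP.
  move=> [/eqP cS SN WS]; exists (S :\: W).
    by rewrite !finset.inE finset.setSD//= cardsDS// cS.
  by rewrite -[LHS](finset.setID S W) (finset.setIidPr WS).
move=> [X]; rewrite !finset.inE => /andP[XN /eqP cX] ->.
have XN' i : i \in X -> (i \in N) && (i \notin W).
  by move=> /(fintype.subsetP XN); rewrite finset.inE andbC.
split; last exact: finset.subsetUl.
  rewrite cardsU (_ : W :&: X = finset.set0) ?cards0 ?subn0 ?cX ?subnKC//.
  apply/setP => i; rewrite !finset.inE; apply/negbTE/negP => /andP[iW /XN'].
  by rewrite iW andbF.
rewrite finset.subUset WN; apply/fintype.subsetP => i /XN' /andP[] //.
Qed.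


Lemma clqE S x : (clq S x)%:R =
  \prod_(e : E) (if en e \subset S then (x e)%:R else 1) :> R.
Proof.
case: (boolP (clq S x)) => [/clqP h|/clqP h].
  by rewrite big1// => e _; case: ifP => // eS; rewrite h.
have [e eS /negPf xe] : exists2 e : E, en e \subset S & ~~ x e.
  apply: contrapT => ne; apply: h => e eS; apply: contrapT => xe; apply: ne.
  by exists e => //; apply/negP.
by rewrite (bigD1 e)//= eS xe mul0r.
Qed.

Lemma esp_clq1 S e : en e \subset S ->
  esp (fun x => (clq S (set_at e true x))%:R) = p ^+ ('C(#|S|, 2)).-1.
Proof.
move=> eS; under eq_esp do rewrite clqE.
transitivity (esp (fun x => \prod_(e' : E)
    (if (en e' \subset S) && (e' != e) then (x e')%:R else 1))).
  apply: eq_esp => x; apply: eq_bigr => e' _; rewrite set_atE.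
  by case: (eqVneq e' e) => [->|_]; rewrite ?andbT// andbF eS.
rewrite (esp_prod (fun (e' : E) (b : bool) =>
   if (en e' \subset S) && (e' != e) then b%:R else 1)).
rewrite (eq_bigr (fun e' => if e' \in eset S :\ e then p else 1)); last first.
  by move=> e' _; rewrite !finset.inE andbC; case: ifP => _ /=; ring.
rewrite -big_mkcond prodr_const; congr (_ ^+ _).
by rewrite -card_eset (cardsD1 e (eset S)) finset.inE eS.
Qed.

Lemma clq_set_at_false S e x : en e \subset S -> clq S (set_at e false x) = false.
Proof.
by move=> eS; apply/negbTE/negP => /clqP/(_ e eS); rewrite set_atE eqxx.
Qed.

Lemma clq_set_at S e b x : ~~ (en e \subset S) -> clq S (set_at e b x) = clq S x.
Proof.
move=> eS; apply/clqP/clqP => h e' eS'; have := h e' eS';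
by rewrite set_atE; case: eqP => // ee; rewrite ee (negPf eS) in eS'.
Qed.

Lemma dif_cliques N j e x : dif e (cliques N j) x =
  \sum_(S : {set V} | [&& #|S| == j, S \subset N & en e \subset S])
    (clq S (set_at e true x))%:R.
Proof.
rewrite /dif /cliques -sumrB (bigID (fun S => en e \subset S)) /=.
rewrite addrC big1 ?add0r => [|S /andP[_ eS]]; last by rewrite !clq_set_at// subrr.
apply: eq_big => [S|S /andP[_ eS]]; first by rewrite andbA.
rewrite (clq_set_at_false x eS); set u := (clq _ _).
  by rewrite /= mulr0n subr0.
Qed.

(** Fixing the vertices of [W] saves a factor [n] for each. The product form also covers [W] larger
    than [j], where nothing is counted. *)
Lemma nsup_le W N j : W \subset N -> nsup W N j * n%:R ^+ #|W| <= n%:R ^+ j.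
Proof.
move=> WN; rewrite /nsup card_supset//; case: ifP => Wj; last first.
  by rewrite mul0r exprn_ge0.
rewrite -!natrX -natrM ler_nat -[in leqRHS](subnK Wj) expnD leq_mul2r; apply/orP; right.
rewrite (leq_trans (leq_bin_exp _ _))//; case: (j - #|W|)%N => // k.
by rewrite leq_exp2r// (leq_trans (leq_subr _ _))// max_card.
Qed.

Lemma esp_dif_cliques N j e : en e \subset N -> (2 <= j)%N ->
  esp (dif e (cliques N j)) = kappa p #|N| j.
Proof.
move=> eN j2.
have -> : esp (dif e (cliques N j)) =
    \sum_(S : {set V} | [&& #|S| == j, S \subset N & en e \subset S])
      esp (fun x => (clq S (set_at e true x))%:R).
  by rewrite -esp_sum; apply: eq_esp => x; rewrite dif_cliques.
rewrite (eq_bigr (fun=> p ^+ ('C(j, 2)).-1)); last first.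
  by move=> S /and3P[/eqP cS _ eS]; rewrite esp_clq1// cS.
rewrite sumr_const -mulr_natr /kappa; congr (_ * _%:R).
have := @card_supset (en e) N j eN; rewrite card_edge j2 => <-.
by apply: eq_card => S; rewrite !finset.inE.
Qed.

Lemma dif_le_nsup N j e e' x :
  `|dif e' (dif e (cliques N j)) x| <=
  if e' == e then 0 else nsup (en e :|: en e') [set: V]%SET j.
Proof.
case: eqP => [->|/eqP ee].
  by rewrite (dif_indep (@indep_dif R _ e (cliques N j))) ?normr0// finset.in_set1.
rewrite {1}/dif !dif_cliques -sumrB (bigID (fun S => en e' \subset S)) /=.
rewrite addrC big1 ?add0r; last first.
  move=> S /andP[_ eS']; have ne : e != e' by rewrite eq_sym.
  by rewrite (set_atC true true x ne) (set_atC true false x ne) !(clq_set_at _ _ eS') subrr.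
rewrite (le_trans (ler_norm_sum _ _ _))//.
rewrite /nsup -sum1_card natr_sum /= big_mkcond [leRHS]big_mkcond /=.
apply: ler_sum => S _; rewrite !finset.inE finset.subUset finset.subsetT /=.
case: (#|S| == j) => //=; case: (en e \subset S); rewrite ?andbF ?andbT //=.
case: (S \subset N) => //=; last by case: ifP.
case: ifP => // _; case: (clq _ _); case: (clq _ _) => /=;
  rewrite ?subrr ?subr0 ?sub0r ?normrN ?normr0 ?normr1//.
Qed.

(** Double counting: a [j]-set through [e] contains at most ['C(j, 2)] other edges. *)
Lemma sum_nsup e j : \sum_(e' : E | e' != e) nsup (en e :|: en e') [set: V]%SET j <=
  'C(j, 2)%:R * nsup (en e) [set: V]%SET j.
Proof.
rewrite /nsup; under eq_bigr do rewrite -sum1_card natr_sum big_mkcond /=.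
rewrite exchange_big /= -sum1_card natr_sum mulr_sumr [leRHS]big_mkcond /=.
apply: ler_sum => S _; rewrite !finset.inE finset.subsetT /=.
under eq_bigr do rewrite !finset.inE finset.subsetT finset.subUset /=.
case: (boolP (#|S| == j)) => [/eqP cS|_] /=; last by rewrite big1.
case: (boolP (en e \subset S)) => [eS|_] /=; last by rewrite big1.
rewrite mulr1 -cS -card_eset -big_mkcondr /= -natr_sum ler_nat sum1_card.
by apply: subset_leq_card; apply/fintype.subsetP => e'; rewrite !finset.inE => /andP[].
Qed.

Lemma edge_gt1 e : (1 < n)%N.
Proof. by rewrite -(card_edge e) max_card. Qed.

Lemma card_edgeU e e' : e' != e -> (3 <= #|en e :|: en e'|)%N.
Proof.
move=> ee; have : (#|en e| < #|en e :|: en e'|)%N; last by rewrite card_edge.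
apply: proper_card; rewrite properE finset.subsetUl finset.subUset subxx /=.
apply: contra ee => s; apply/eqP/en_inj/eqP.
by rewrite eqEcard s !card_edge.
Qed.

(** Efron-Stein for the derivative. Two distinct edges span at least three vertices, so each second
    derivative is at most n^(j-3), and over all second edges their bounds add up to O(n^(j-2)): the
    variance is O(n^(2j-5)), a factor n below the square of the mean. *)
Lemma var_dif_cliques N j e : en e \subset N -> (2 <= j)%N ->
  esp (fun x => (dif e (cliques N j) x - kappa p #|N| j) ^+ 2) * n%:R ^+ 5 <=
  'C(j, 2)%:R * n%:R ^+ (2 * j).
Proof.
move=> eN j2; rewrite -(esp_dif_cliques eN j2).
have n0 : 0 < n%:R :> R by rewrite ltr0n (ltn_trans _ (edge_gt1 e)).
have n1 : 1 <= n%:R :> R by rewrite ler1n (ltn_trans _ (edge_gt1 e)).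
set ns := fun W => nsup W [set: V]%SET j.
have ns0 W : 0 <= ns W by rewrite /ns /nsup.
have ns3 e' : e' != e -> ns (en e :|: en e') * n%:R ^+ 3 <= n%:R ^+ j.
  move=> ee; apply: le_trans (nsup_le j (finset.subsetT (en e :|: en e'))).
  by rewrite ler_wpM2l// ler_weXn2l// card_edgeU.
have ns2 : ns (en e) * n%:R ^+ 2 <= n%:R ^+ j.
  by have := nsup_le j (finset.subsetT (en e)); rewrite card_edge.
apply: (@le_trans _ _ ((\sum_(e' | e' != e) ns (en e :|: en e') ^+ 2) * n%:R ^+ 5)).
  rewrite ler_wpM2r ?exprn_ge0//.
  rewrite (le_trans (efron_stein_var hp _))// -[leRHS]mul1r ler_pM ?pq_ge0//.
  - by apply: sumr_ge0 => e' _; apply: esp_ge0 => // x; exact: sqr_ge0.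
  - by have := @pq_le _ p; lra.
  rewrite [leRHS]big_mkcond /=; apply: ler_sum => e' _.
  apply: esp_le_cst => // x; have := dif_le_nsup N j e e' x.
  case: eqP => [_|_] /=; first by rewrite normr_le0 => /eqP ->; rewrite expr0n.
  by move=> h; rewrite -real_normK ?num_real// ler_sqr ?nnegrE.
have s1 : (\sum_(e' | e' != e) ns (en e :|: en e') ^+ 2) * n%:R ^+ 3 <=
    (\sum_(e' | e' != e) ns (en e :|: en e')) * n%:R ^+ j.
  rewrite !mulr_suml; apply: ler_sum => e' ee.
  by rewrite expr2 -mulrA ler_wpM2l// ns3.
have n2 : 0 <= n%:R ^+ 2 :> R by rewrite exprn_ge0.
have nj : 0 <= n%:R ^+ j :> R by rewrite exprn_ge0.
rewrite (exprD _ 3 2) mulrA (le_trans (ler_wpM2r n2 s1))//.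
apply: (@le_trans _ _ ('C(j, 2)%:R * ns (en e) * n%:R ^+ j * n%:R ^+ 2)).
  by rewrite !ler_wpM2r//; exact: sum_nsup.
rewrite mul2n -addnn exprD.
have -> : 'C(j, 2)%:R * ns (en e) * n%:R ^+ j * n%:R ^+ 2 =
  'C(j, 2)%:R * (n%:R ^+ j * (ns (en e) * n%:R ^+ 2)) by ring.
by rewrite !ler_wpM2l.
Qed.

Lemma juntas_cliques N j : juntas ('C(j, 2)) (n%:R ^+ j) (cliques N j : _ -> R).
Proof.
apply: (@juntas_weak _ _ _ (\sum_(S : {set V} | (#|S| == j) && (S \subset N)) 1)).
  apply: juntas_sum => S /andP[/eqP cS _].
  apply: (@juntas1 _ _ _ (eset S)); rewrite ?card_eset ?cS//.
    move=> x y xy; congr (_%:R); congr (nat_of_bool _).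
    by apply/clqP/clqP => h e eS; have := h e eS; rewrite xy// !finset.inE negbK.
  by move=> x; case: (clq _ _); rewrite ?normr1 ?normr0.
rewrite sumr_const; apply: le_trans (nsup_le j (finset.sub0set [set: V])).
rewrite cards0 expr0 mulr1 /nsup ler_nat; apply: subset_leq_card.
by apply/fintype.subsetP => S; rewrite !inE /= => /andP[-> _]; rewrite finset.subsetT finset.sub0set.
Qed.

End Cliques.

(** * Resampling stars and crosses *)

Section Neighbourhoods.
Context {R : realType} {V E : finType} {en : E -> {set V}}.
Hypothesis en_inj : injective en.
Hypothesis card_edge : forall e, #|en e| = 2%N.
Context {ed : V -> V -> E}.
Hypothesis edE : forall u v, u != v -> en (ed u v) = [set u; v]%SET.
Local Notation n := #|V|.
Local Notation eset := (eset en).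
Local Notation clq := (clq en).
Local Notation cliques := (@cliques R V E en).
Local Notation nsup := (@nsup R V).
Implicit Types (x y z : {ffun E -> bool}) (S N W M P : {set V}) (e : E).

Definition nbr x v : {set V} := [set w | (v != w) && x (ed v w)]%SET.

Definition star v : {set E} := [set e | v \in en e]%SET.

Definition cross M P : {set E} := [set ed u.1 u.2 | u in finset.setX M P]%SET.

Lemma edgeP e v : v \in en e -> exists2 w, v != w & e = ed v w.
Proof.
move=> ve; have [u [w [uw eE]]] := cards2P _ (introT eqP (card_edge e)).
move: ve; rewrite eE !finset.inE => /orP[] /eqP ->.
  by exists w => //; apply: en_inj; rewrite edE.
by exists u; rewrite 1?eq_sym//; apply: en_inj; rewrite edE 1?eq_sym// finset.setUC.
Qed.

Lemma sub_ed u v S : u != v -> (en (ed u v) \subset S) = (u \in S) && (v \in S).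
Proof. by move=> uv; rewrite edE// finset.subUset !finset.sub1set. Qed.

Lemma ed_eq u v u' v' : u != v -> u' != v' -> ed u v = ed u' v' ->
  (u = u' /\ v = v') \/ (u = v' /\ v = u').
Proof.
move=> uv uv' E1; have : en (ed u v) = en (ed u' v') by rewrite E1.
rewrite !edE// => E2.
have := finset.set21 u v; have := finset.set22 u v; rewrite E2 !finset.inE.
move=> /orP[] /eqP vE /orP[] /eqP uE; subst; rewrite ?eqxx// in uv *; by [left|right].
Qed.

Lemma clqU1 v S x : v \notin S -> clq (v |: S) x = clq S x && (S \subset nbr x v).
Proof.
move=> vS; apply/clqP/andP => [h|[/clqP h1 /fintype.subsetP h2] e eS].
  split; first by apply/clqP => e eS; apply: h; rewrite (fintype.subset_trans eS)// finset.subsetUr.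
  apply/fintype.subsetP => w wS; have vw : v != w by apply: contraNneq vS => ->.
  by rewrite finset.inE vw h// sub_ed// !finset.inE eqxx wS orbT.
case: (boolP (v \in en e)) => [/edgeP[w vw eE]|ve].
  move: eS; rewrite eE sub_ed// !finset.inE eqxx /= eq_sym (negPf vw) /= => /h2.
  by rewrite finset.inE vw.
apply: h1; apply/fintype.subsetP => u ue; have := fintype.subsetP eS u ue.
by rewrite !finset.inE => /orP[/eqP uv|//]; rewrite uv (negPf ve) in ue.
Qed.

Lemma sum_setU1 v N (j : nat) (F : {set V} -> R) : v \in N ->
  \sum_(S : {set V} | [&& #|S| == j.+1, S \subset N & v \in S]) F S =
  \sum_(S : {set V} | (#|S| == j) && (S \subset N :\ v)) F (v |: S).
Proof.
move=> vN; rewrite (reindex_onto (fun S => v |: S) (fun S => S :\ v)) /=; last first.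
  by move=> S /and3P[_ _ vS]; rewrite finset.setD1K.
apply: eq_bigl => S; rewrite finset.subsetD1 finset.subUset finset.sub1set vN /=.
rewrite finset.setU11 andbT cardsU1.
case: (boolP (v \in S)) => vS /=.
  rewrite !andbF; apply/negbTE/negP => /andP[_ /eqP/setP/(_ v)].
  by rewrite !finset.inE eqxx vS.
by rewrite finset.setU1K// eqxx andbT andbT add1n eqSS.
Qed.

Lemma cliques_star v N j x : v \in N ->
  cliques N j.+1 x = cliques (N :\ v) j.+1 x + cliques (N :&: nbr x v) j x.
Proof.
move=> vN; rewrite /cliques (bigID (fun S => v \in S)) /= addrC; congr (_ + _).
  by apply: eq_bigl => S; rewrite finset.subsetD1 andbA.
under eq_bigl do rewrite -andbA.
rewrite sum_setU1// [LHS]big_mkcond [RHS]big_mkcond; apply: eq_bigr => S _.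
rewrite finset.subsetI finset.subsetD1; case: (#|S| == j) => //=.
case: (S \subset N) => //=; case: (boolP (v \in S)) => vS /=.
  case: ifP => // /fintype.subsetP/(_ v vS); rewrite finset.inE eqxx//.
by rewrite clqU1//; case: (S \subset nbr x v); rewrite ?andbT ?andbF.
Qed.

Lemma indep_cliques N j (D : {set E}) : (forall e, e \in D -> ~~ (en e \subset N)) ->
  indep D (cliques N j).
Proof.
move=> DN x y xy; apply: eq_bigr => S /andP[_ SN]; congr (_%:R); congr (nat_of_bool _).
have eD e : en e \subset S -> x e = y e.
  move=> eS; apply: xy; apply/negP => /DN/negP; apply.
  exact: fintype.subset_trans SN.
by apply/clqP/clqP => h e eS; have := h e eS; rewrite eD.
Qed.

Lemma merge_indep (D U : {set E}) (F : {ffun E -> bool} -> R) y :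
  indep D F -> indep D (fun x => F (merge U y x)).
Proof.
move=> iF x x' xx; apply: iF => e eD; rewrite !mergeE; case: ifP => // _; exact: xx.
Qed.

(** The first summand does not see [y], so it cancels between two copies of the star; only cliques
    of one size less survive. *)
Lemma cliques_merge_star v N j y x : v \in N ->
  cliques N j.+1 (merge (star v) y x) =
  cliques (N :\ v) j.+1 x + cliques (N :&: nbr y v) j x.
Proof.
move=> vN; rewrite (cliques_star j _ vN).
have -> : nbr (merge (star v) y x) v = nbr y v.
  apply/setP => w; rewrite !finset.inE; case: (boolP (v == w)) => //= vw.
  by rewrite mergeE finset.inE edE// finset.set21.
congr (_ + _); apply: indep_merge; apply: indep_cliques => e; rewrite finset.inE => ve;
apply/negP => /fintype.subsetP/(_ v ve); rewrite !finset.inE eqxx ?andbF//.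
Qed.

(** * Derivatives after decoupling the edges between two vertex sets *)

Section Cross.
Context {M P N : {set V}}.
Hypothesis MP : [disjoint M & P]%bool.
Hypothesis MN : M \subset N.
Context {z : {ffun E -> bool}}.
Local Notation Q := (M :|: P).

Definition touch : {set E} := [set e | en e :&: M != finset.set0]%SET :\: cross M P.

(** All edges meeting [M] are fixed: those of the cross by [y], the others by [z]. Only edges
    avoiding [M] are still read from [x]. *)
Definition reveal y x := merge touch z (merge (cross M P) y x).

Lemma cross_touch e : e \in cross M P -> en e :&: M != finset.set0.
Proof.
case/imsetP => -[v a] /=; rewrite finset.inE /= => /andP[vM aP] ->.
have va : v != a by apply: contraTneq vM => ->; rewrite (disjointFl MP).
by apply/set0Pn; exists v; rewrite finset.inE edE// finset.set21.
Qed.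

Lemma notin_reveal e : en e :&: M == finset.set0 -> (e \notin touch) /\ (e \notin cross M P).
Proof.
move=> eM; split; first by rewrite !finset.inE eM andbF.
by apply/negP => /cross_touch; rewrite eM.
Qed.

Lemma revealE e y x : en e :&: M == finset.set0 -> reveal y x e = x e.
Proof. by move=> /notin_reveal[/negPf e1 /negPf e2]; rewrite /reveal !mergeE e1 e2. Qed.

Lemma reveal_cross v a y x : v \in M -> a \in P -> reveal y x (ed v a) = y (ed v a).
Proof.
move=> vM aP; have c : ed v a \in cross M P.
  by apply/imsetP; exists (v, a); rewrite // finset.inE vM.
by rewrite /reveal !mergeE finset.inE c.
Qed.

Lemma reveal_touch v w y x : v \in M -> w \notin P -> v != w ->
  reveal y x (ed v w) = z (ed v w).
Proof.
move=> vM wP vw; rewrite /reveal !mergeE !finset.inE.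
have -> /= : ed v w \notin cross M P.
  apply/negP => /imsetP[[v' a] /=]; rewrite finset.inE /= => /andP[v'M aP].
  have va : v' != a by apply: contraTneq v'M => ->; rewrite (disjointFl MP).
  move=> /(ed_eq vw va)[[_ wa]|[va' _]]; first by rewrite wa aP in wP.
  by rewrite va' (disjointFl MP aP) in vM.
rewrite (_ : _ != _)//; apply/set0Pn; exists v; by rewrite finset.inE edE// finset.set21.
Qed.

Lemma clq_reveal0 S y x : S :&: M == finset.set0 -> clq S (reveal y x) = clq S x.
Proof.
move=> SM; have h e : en e \subset S -> reveal y x e = x e.
  move=> eS; apply: revealE; rewrite -finset.subset0 -(eqP SM).
  exact: finset.setSI.
by apply/clqP/clqP => k e eS; have := k e eS; rewrite h.
Qed.

Context {a b : V}.
Hypothesis aP : a \in P.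
Hypothesis bQ : b \notin Q.
Hypothesis aN : a \in N.
Context {j : nat}.
Context {y y' : {ffun E -> bool}}.

Let ab : a != b.
Proof. by apply: contraNneq bQ => <-; rewrite finset.inE aP orbT. Qed.

Let e := ed a b.
Let eE : en e = [set a; b]%SET.
Proof. exact: edE. Qed.

Let aM : a \notin M.
Proof. by apply/negP => /(disjointFr MP); rewrite aP. Qed.

Let bM : b \notin M.
Proof. by apply: contraNN bQ => bM; rewrite finset.inE bM. Qed.

Let eM : en e :&: M == finset.set0.
Proof.
rewrite -finset.subset0; apply/fintype.subsetP => u; rewrite eE !finset.inE => /andP[].
by move=> /orP[] /eqP ->; rewrite ?(negPf aM) ?(negPf bM).
Qed.

Definition zeta v : R := (y (ed v a))%:R - (y' (ed v a))%:R.

Definition cross_dif x : R := cliques N j.+1 (reveal y x) - cliques N j.+1 (reveal y' x).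

(** What is available to a clique through [a] that meets [M] only in [v] and [P] only in [a], once
    [v] is removed. The fixed [z] decides it, so the clique is found among edges of [x]. *)
Definition priv v : {set V} := a |: (N :&: nbr z v :\: Q).

Definition cross_main x : R := \sum_(v in M) zeta v * dif e (cliques (priv v) j) x.

Let t x S : R := (clq S (reveal y (set_at e true x)))%:R -
                 (clq S (reveal y' (set_at e true x)))%:R.

Let good S := (#|S :&: M| == 1%N) && (S :&: P == [set a]%SET).

Let Z S := [&& #|S| == j.+1, S \subset N & en e \subset S].

Let dif_cross_dif x : dif e cross_dif x = \sum_(S | Z S) t x S.
Proof.
have [e1 e2] := notin_reveal eM.
have r u b' : reveal u (set_at e b' x) = set_at e b' (reveal u x).
  by rewrite /reveal [merge (cross M P) _ _]merge_set_at (negPf e2) merge_set_at (negPf e1).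
have d u : dif e (fun x => cliques N j.+1 (reveal u x)) x =
    \sum_(S | Z S) (clq S (reveal u (set_at e true x)))%:R.
  rewrite {1}/dif !r; have := dif_cliques (R := R) (en := en) N j.+1 e (reveal u x).
  by rewrite {1}/dif.
by rewrite /cross_dif difD difN /= !d -sumrB.
Qed.

Let t_le1 x S : `|t x S| <= 1.
Proof.
rewrite /t; case: (clq _ _); case: (clq _ _);
by rewrite /= ?subrr ?subr0 ?sub0r ?normrN ?normr0 ?normr1.
Qed.

Let t_notM x S : S :&: M == finset.set0 -> t x S = 0.
Proof. by move=> SM; rewrite /t !clq_reveal0// subrr. Qed.

Let sum_good x : \sum_(S | Z S && good S) t x S =
  \sum_(v in M) \sum_(S | [&& Z S, good S & v \in S]) t x S.
Proof.
rewrite (exchange_big_dep (fun S => Z S && good S)) /=; last by move=> v S _ /and3P[-> ->].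
apply: eq_bigr => S /andP[ZS gS]; rewrite ZS gS /=.
rewrite sumr_const -[LHS]mulr1n; congr (_ *+ _).
have /andP[/eqP <- _] := gS; apply: eq_card => v; rewrite !finset.inE andbC//.
Qed.

Let notin_priv v S : v \in M -> S \subset priv v -> S :&: M == finset.set0.
Proof.
move=> vM /fintype.subsetP Sp; rewrite -finset.subset0; apply/fintype.subsetP => u.
rewrite !finset.inE => /andP[/Sp]; rewrite !finset.inE => /orP[/eqP ->|].
  by rewrite (negPf aM).
by case/andP => + _ => /norP[/negPf -> _].
Qed.

(** The set [v |: S] is a clique when [S] is one, [z] joins [v] to the rest of [S], and the cross
    edge from [v] to [a] is present. Only the last condition differs between the two copies, hence
    the factor [zeta v]. *)
Let good_term x v S : v \in M -> #|S| = j -> S \subset N :\ v ->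
  (if (en e \subset v |: S) && good (v |: S) then t x (v |: S) else 0) =
  (if (S \subset priv v) && (en e \subset S) then
     zeta v * (clq S (set_at e true x))%:R else 0).
Proof.
move=> vM cS SNv.
have vS : v \notin S by move: SNv; rewrite finset.subsetD1 => /andP[].
have SN : S \subset N by move: SNv; rewrite finset.subsetD1 => /andP[].
have va : v != a by apply: contraNneq aM => <-.
have vP : v \notin P by rewrite (disjointFr MP vM).
have -> : (en e \subset v |: S) = (en e \subset S).
  rewrite eE !finset.subUset !finset.sub1set !finset.inE.
  have -> : (a == v) = false by rewrite eq_sym (negPf va).
  have -> : (b == v) = false by apply/negbTE; apply: contraNneq bM => ->.
  by [].
case: (boolP (en e \subset S)) => [eS|_]; last by rewrite andbF.
have aS : a \in S by apply: (fintype.subsetP eS); rewrite eE finset.set21.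
rewrite andbT /=.
have SMP : (v |: S) :&: P = S :&: P.
  apply/setP => u; rewrite !finset.inE; case: (eqVneq u v) => [->|//].
  by rewrite (negPf vP) !andbF.
have gE : good (v |: S) = (S :&: M == finset.set0) && (S :&: P == [set a]%SET).
  rewrite /good SMP finset.setIUl (finset.setIidPl _) ?finset.sub1set//.
  rewrite cardsU1 finset.inE (negPf vS) /= add1n eqSS cards_eq0//.
rewrite gE; case: (boolP (S :&: M == finset.set0)) => SM /=; last first.
  by case: ifP => // /(notin_priv vM); rewrite (negPf SM).
case: (boolP (S :&: P == [set a]%SET)) => /= [/eqP SP|/negP SP]; last first.
  case: ifP => // /fintype.subsetP Sp; case: SP; apply/eqP/setP => u.
  rewrite !finset.inE; case: (eqVneq u a) => [->|ua]; first by rewrite aS aP.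
  apply/negbTE/negP => /andP[/Sp + uP]; rewrite !finset.inE (negPf ua) /= uP orbT //.
have SM' u : u \in S -> u \notin M.
  by move=> uS; apply/negP => uM; have := finset.in_set0 u;
    rewrite -(eqP SM) finset.inE uS uM.
have SP' u : u \in S -> u != a -> u \notin P.
  by move=> uS ua; apply/negP => uP; have := finset.in_set1 u a;
    rewrite -SP finset.inE uS uP (negPf ua).
have nE u x1 : (S \subset nbr (reveal u x1) v) = u (ed v a) && (S \subset priv v).
  apply/fintype.subsetP/andP => [h|[ua /fintype.subsetP h] w wS].
    split; first by have := h a aS; rewrite finset.inE va reveal_cross.
    apply/fintype.subsetP => w wS; rewrite !finset.inE.
    case: (eqVneq w a) => //= wa; rewrite (fintype.subsetP SN)//= ?andbT.
    have := h w wS; rewrite finset.inE => /andP[vw].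
    rewrite reveal_touch// ?SP'// => zw.
    by rewrite (negPf (SM' w wS)) (negPf (SP' w wS wa)) vw zw.
  rewrite finset.inE; have vw : v != w by apply: contraNneq vS => ->.
  rewrite vw /=; have [wa|wa] := eqVneq w a; first by rewrite wa reveal_cross.
  rewrite reveal_touch// ?SP'//; have := h w wS.
  by rewrite !finset.inE (negPf wa) /= => /and3P[_ _ /andP[]].
rewrite /t !clqU1// !nE !clq_reveal0//.
case: (S \subset priv v); rewrite ?andbF ?subrr// !andbT /zeta.
by case: (clq _ _); rewrite ?andbF /= ?subrr ?mulr0 ?mulr1.
Qed.

Let sum_main x v : v \in M ->
  \sum_(S | [&& Z S, good S & v \in S]) t x S = zeta v * dif e (cliques (priv v) j) x.
Proof.
move=> vM; have vN := fintype.subsetP MN v vM.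
rewrite dif_cliques mulr_sumr.
transitivity (\sum_(S : {set V} | [&& #|S| == j.+1, S \subset N & v \in S])
    if (en e \subset S) && good S then t x S else 0).
  rewrite -big_mkcondr; apply: eq_bigl => S; rewrite /Z.
  by rewrite -!andbA; case: (#|S| == _); case: (_ \subset _) => //=;
    case: (v \in S); rewrite ?andbF ?andbT.
rewrite sum_setU1// [LHS]big_mkcond [RHS]big_mkcond /=; apply: eq_bigr => S _.
have [cS|] := eqVneq #|S| j => //=.
case: (boolP (S \subset N :\ v)) => SN; first exact: good_term.
case: ifP => // /andP[Sp _]; case/negP: SN; rewrite finset.subsetD1.
apply/andP; split; last first.
  have := notin_priv vM Sp; apply: contraTN => vS; apply/set0Pn; exists v.
  by rewrite finset.inE vS.
apply/fintype.subsetP => u /(fintype.subsetP Sp); rewrite !finset.inE => /orP[/eqP ->//|].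
by case/and3P.
Qed.

(** Sets missing [M] cancel. A set that meets [M] in some [v] without being [good] has another
    vertex in [M] or in [P]: with [a], [b] and [v] this prescribes four vertices, hence n^4, and the
    two in [M] and [Q] are chosen in at most [#|M| * #|Q|] ways. *)
Lemma cross_error x : `|dif e cross_dif x - cross_main x| * n%:R ^+ 4 <=
  #|M|%:R * #|Q|%:R * n%:R ^+ j.+1.
Proof.
rewrite dif_cross_dif (bigID good) /= sum_good.
rewrite (eq_bigr (fun v => zeta v * dif e (cliques (priv v) j) x)); last first.
  by move=> v vM; exact: sum_main.
rewrite /cross_main addrAC subrr add0r.
pose W v u := en e :|: [set v; u]%SET.
pose ns v u := nsup (W v u) [set: V]%SET j.+1.
apply: (@le_trans _ _ ((\sum_(v in M) \sum_(u in Q | (u != v) && (u != a)) ns v u) * n%:R ^+ 4)).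
  rewrite ler_wpM2r ?exprn_ge0// (le_trans (ler_norm_sum _ _ _))//.
  have -> : \sum_(v in M) \sum_(u in Q | (u != v) && (u != a)) ns v u =
     \sum_(S : {set V}) \sum_(v in M) \sum_(u in Q | (u != v) && (u != a))
       (if [&& #|S| == j.+1, S \subset [set: V]%SET & W v u \subset S] then 1 else 0).
    rewrite [RHS]exchange_big; apply: eq_bigr => v _.
    rewrite [RHS]exchange_big; apply: eq_bigr => u _.
    rewrite /ns /nsup -sum1_card natr_sum big_mkcond /=.
    by apply: eq_bigr => S _; rewrite finset.inE.
  rewrite [leLHS]big_mkcond /=; apply: ler_sum => S _.
  have nn v u : 0 <= (if [&& #|S| == j.+1, S \subset [set: V]%SET & W v u \subset S]
    then 1 else 0) :> R by case: ifP.
  have nns v : 0 <= \sum_(u in Q | (u != v) && (u != a))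
      (if [&& #|S| == j.+1, S \subset [set: V]%SET & W v u \subset S] then 1 else 0) :> R.
    by apply: sumr_ge0 => u _.
  case: ifP => [/andP[ZS ngS]|_]; last by apply: sumr_ge0 => v _.
  have [SM|/set0Pn[v]] := eqVneq (S :&: M) finset.set0.
    by rewrite t_notM ?SM// normr0; apply: sumr_ge0 => v _.
  rewrite finset.inE => /andP[vS vM].
  have /and3P[/eqP cS SN eS] := ZS.
  have aS : a \in S by apply: (fintype.subsetP eS); rewrite eE finset.set21.
  have [u /and3P[uQ uv ua] uS] : exists2 u, [&& u \in Q, u != v & u != a] & u \in S.
    move: ngS; rewrite /good negb_and => /orP[c1|SP].
      have : (0 < #|(S :&: M) :\ v|)%N.
        by move: c1; rewrite (cardsD1 v) finset.inE vS vM add1n eqSS lt0n.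
      move=> /card_gt0P[u]; rewrite !finset.inE => /and3P[uv uS uM].
      by exists u => //; rewrite finset.inE uM uv /=; apply: contraNneq aM => <-.
    have : (0 < #|(S :&: P) :\ a|)%N.
      rewrite lt0n cards_eq0; apply: contraNN SP => /eqP h; apply/eqP/setP => u.
      have := finset.in_set0 u; rewrite -h !finset.inE.
      by case: (eqVneq u a) => [->|_] //=; rewrite aS aP.
    move=> /card_gt0P[u]; rewrite !finset.inE => /and3P[ua uS uP].
    exists u => //; rewrite finset.inE uP orbT ua andbT /=.
    by apply: contraTneq uP => ->; rewrite (disjointFr MP vM).
  rewrite (bigD1 v vM) /= (bigD1 u) /=; last by rewrite uQ uv ua.
  rewrite cS eqxx finset.subsetT !finset.subUset eS !finset.sub1set vS uS /=.
  rewrite -addrA (le_trans (t_le1 x S))// lerDl.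
  apply: addr_ge0; apply: sumr_ge0 => i _; first by case: ifP.
  by apply: sumr_ge0 => k _; case: ifP.
apply: (@le_trans _ _ (\sum_(v in M) \sum_(u in Q) n%:R ^+ j.+1)).
  rewrite mulr_suml; apply: ler_sum => v vM; rewrite mulr_suml.
  rewrite big_mkcondr /=; apply: ler_sum => u uQ.
  case: ifP => [/andP[uv ua]|_]; last by rewrite exprn_ge0.
  have := nsup_le (R := R) j.+1 (finset.subsetT (W v u)).
  have -> // : #|W v u| = 4%N.
  rewrite /W cardsU card_edge cards2 eq_sym uv /= (_ : _ :&: _ = finset.set0) ?cards0//.
  apply/setP => w; rewrite eE !finset.inE; apply/negbTE/negP => /andP[].
  have av : a != v by apply: contraNneq aM => ->.
  have bv : b != v by apply: contraNneq bM => ->.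
  have bu : b != u by apply: contraNneq bQ => ->.
  move=> /orP[] /eqP ->; rewrite ?(negPf av) ?(negPf bv) ?(negPf bu) //=.
  by rewrite eq_sym (negPf ua).
by rewrite !sumr_const -[_ *+ #|Q|]mulr_natl -[_ *+ #|M|]mulr_natl mulrA.
Qed.

End Cross.
End Neighbourhoods.

Arguments nbr {V E} ed x v.
Arguments star {V E} en v.
Arguments cross {V E} ed M P.
Arguments touch {V E} en ed M P.
Arguments reveal {V E} en ed M P z y x.
Arguments zeta {R V E} ed a y y' v.
Arguments priv {V E} ed M P N z a v.
Arguments cross_dif {R V E} en ed M P N z j y y' x.
Arguments cross_main {R V E} en ed M P N z a b j y y' x.

(** * Tails and Gram matrices *)

Section Tails.
Context {R : realType} {T : finType} {p : R}.
Hypothesis hp : 0 < p < 1.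
Implicit Types (F G : {ffun T -> bool} -> R) (x y : {ffun T -> bool}).
Implicit Types (D S : {set T}) (e : T).

Local Notation esp := (@esp R T p).

(** Since the supports are disjoint, each bit influences at most one summand; at most [d * #|A|]
    bits matter, each with a derivative bounded by 1. *)
Lemma disjoint_sum_tail (I : finType) (A : {set I}) (G : I -> {ffun T -> bool} -> R)
    (S : I -> {set T}) (d k : nat) (lam : R) (Y : {ffun T -> bool} -> R) :
  (forall x, Y x = \sum_(b in A) G b x) ->
  {in A &, forall b b', b != b' -> S b :&: S b' = finset.set0} ->
  (forall b, #|S b| <= d)%N -> (forall b, indep (~: S b) (G b)) ->
  (forall b x, 0 <= G b x <= 1) -> 0 < lam ->
  esp (fun x => (lam <= `|Y x - esp Y|)%R%:R) <=
    hcst p d k * (d%:R * #|A|%:R / lam ^+ 2) ^+ (2 ^ k).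
Proof.
move=> YE dS cS iG G01 l0.
have {YE} -> : Y = fun x => \sum_(b in A) G b x by apply/funext.
move=> {Y}; pose Y x := \sum_(b in A) G b x; rewrite -/Y.
have dY : deg d Y.
  apply: (@juntas_deg _ _ _ (\sum_(b in A) 1)); apply: juntas_sum => b bA.
  apply: (@juntas1 _ _ _ (S b)) => // x; have /andP[G0 G1] := G01 b x.
  by rewrite ger0_norm.
have hv : \sum_e esp (fun x => dif e Y x ^+ 2) <= d%:R * #|A|%:R.
  have hd b e x : `|dif e (G b) x| <= 1.
    have /andP[a0 a1] := G01 b (set_at e true x).
    have /andP[b0 b1] := G01 b (set_at e false x).
    by rewrite /dif ler_norml; apply/andP; split; lra.
  have dYE e x : dif e Y x = \sum_(b in A) dif e (G b) x.
    by rewrite /dif /Y -sumrB.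
  apply: (@le_trans _ _ (\sum_e \sum_(b in A) (e \in S b)%:R)).
    apply: ler_sum => e _; apply: esp_le_cst => // x; rewrite dYE.
    case: (pickP (fun b => (b \in A) && (e \in S b))) => [b0 /andP[b0A eb0]|nob].
      rewrite (bigD1 b0) //= [X in (_ + X) ^+ 2]big1 ?addr0; last first.
        move=> b /andP[bA bb0]; rewrite (@dif_indep _ _ (~: S b))//.
        rewrite finset.inE; apply/negP => eb; have := finset.in_set0 e.
        by rewrite -(dS _ _ bA b0A bb0) finset.inE eb eb0.
      rewrite (bigD1 b0) //= eb0 -[leLHS]addr0 lerD//; last by rewrite sumr_ge0.
      by rewrite -real_normK ?num_real// exprn_ile1.
    rewrite big1 ?expr0n ?sumr_ge0// => b bA; rewrite (@dif_indep _ _ (~: S b))//.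
    by rewrite finset.inE; have := nob b; rewrite bA /= => ->.
  rewrite exchange_big /= mulr_natr -sumr_const; apply: ler_sum => b _.
  by rewrite -natr_sum ler_nat -big_mkcond sum1_card.
have := concentration hp k dY (ltW l0).
rewrite -ler_pdivlMr ?exprn_gt0// => /le_trans; apply.
rewrite -[leLHS]mulrA ler_wpM2l ?(ltW (hcst_gt0 hp _ _))//.
have l2 : 0 <= lam ^+ 2 by exact: sqr_ge0.
rewrite expnS exprM -expr_div_n lerXn2r ?nnegrE//.
- rewrite divr_ge0// sumr_ge0// => e _; apply: esp_ge0 => // x; exact: sqr_ge0.
- by rewrite divr_ge0// mulr_ge0.
- by rewrite ler_wpM2r// invr_ge0.
Qed.

Lemma linear_tail (k : nat) D (lam : R) : 0 < lam ->
  esp (fun x => (lam <= `|\sum_(e in D) (x e)%:R - p * #|D|%:R|)%R%:R) <=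
    hcst p 1 k * (#|D|%:R / lam ^+ 2) ^+ (2 ^ k).
Proof.
move=> l0; pose Y x : R := \sum_(e in D) (x e)%:R.
have EY : esp Y = p * #|D|%:R.
  rewrite esp_sum (eq_bigr (fun=> p)) ?sumr_const -?[p *+ _]mulr_natr// => e _.
  by rewrite (esp_coord e (fun b => b%:R)) /=; ring.
have := @disjoint_sum_tail T D (fun e x => (x e)%:R) (fun e => [set e]%SET) 1 k lam Y.
rewrite mul1r EY; apply => //.
- move=> b b' _ _ bb; apply/setP => e; rewrite !finset.inE.
  by case: eqP => // ->; rewrite (negPf bb).
- by move=> b; rewrite cards1.
- by move=> b x y xy; rewrite xy// !finset.inE negbK.
- by move=> b x; case: (x b) => /=; rewrite lexx ler01.
Qed.

(** Two linear tails in succession: [y] has about [p * #|D|] ones on [D], and for such a [y] about a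
    share [1 - p] of them are zeros of [y']. Half of each mean is enough. *)
Lemma pair_tail (k : nat) D : (0 < #|D|)%N ->
  esp (fun y => esp (fun y' =>
    (\sum_(e in D) (y e && ~~ y' e)%:R < p * (1 - p) * #|D|%:R / 4)%R%:R)) <=
  2 * hcst p 1 k * (8 / ((p * (1 - p)) ^+ 2 * #|D|%:R)) ^+ (2 ^ k).
Proof.
move=> D0; have := hp => /andP[p0 p1]; have q0 := pq_gt0 hp.
have d0 : 0 < #|D|%:R :> R by rewrite ltr0n.
set d := #|D|%:R in d0 *; set q := p * (1 - p) in q0 *.
set X := hcst p 1 k * (8 / (q ^+ 2 * d)) ^+ (2 ^ k).
have h0 : 0 < hcst p 1 k := hcst_gt0 hp _ _.
have X0 : 0 <= X.
  by rewrite mulr_ge0 ?exprn_ge0 ?(ltW h0)// divr_ge0// mulr_ge0 ?exprn_ge0// ltW.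
have qp : q <= p by rewrite /q; nra.
have t1 : esp (fun y => (p * d / 2 <= `|\sum_(e in D) (y e)%:R - p * d|)%R%:R) <= X.
  have l0 : 0 < p * d / 2 by rewrite divr_gt0// mulr_gt0.
  have /le_trans -> // := linear_tail k D l0.
  rewrite /X ler_wpM2l ?(ltW h0)// lerXn2r ?nnegrE ?divr_ge0 ?exprn_ge0 ?mulr_ge0 ?invr_ge0//; try lra.
  rewrite -/d (_ : d / (p * d / 2) ^+ 2 = 4 / (p ^+ 2 * d)); last by field; rewrite !gt_eqF.
  rewrite ler_pM ?invr_ge0 ?mulr_ge0 ?exprn_ge0//; try lra.
  have pd : 0 < p ^+ 2 * d by rewrite mulr_gt0 ?exprn_gt0.
  have qd : 0 < q ^+ 2 * d by rewrite mulr_gt0 ?exprn_gt0.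
  rewrite lef_pV2 ?posrE// ler_wpM2r ?(ltW d0)//.
  by rewrite lerXn2r ?nnegrE// ltW.
have t2 (y : {ffun T -> bool}) : p * d / 2 <= \sum_(e in D) (y e)%:R ->
    esp (fun y' => (\sum_(e in D) (y e && ~~ y' e)%:R < q * d / 4)%R%:R) <= X.
  move=> hy; pose Dy := [set e in D | y e].
  have cD : #|Dy|%:R = \sum_(e in D) (y e)%:R :> R.
    rewrite -sum1_card natr_sum /= [RHS]big_mkcond [LHS]big_mkcond /=.
    by apply: eq_bigr => e _; rewrite finset.inE; case: (e \in D); case: (y e).
  have dy0 : 0 < #|Dy|%:R :> R by rewrite cD (lt_le_trans _ hy)// divr_gt0// mulr_gt0.
  have l0 : 0 < (1 - p) * #|Dy|%:R / 2 by rewrite divr_gt0// mulr_gt0// subr_gt0.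
  apply: (@le_trans _ _ (esp (fun y' =>
      ((1 - p) * #|Dy|%:R / 2 <= `|\sum_(e in Dy) (y' e)%:R - p * #|Dy|%:R|)%R%:R))).
    apply: le_esp => // y'; case: (ltP _ (q * d / 4)) => // h.
    suff -> : (1 - p) * #|Dy|%:R / 2 <= `|\sum_(e in Dy) (y' e)%:R - p * #|Dy|%:R| by [].
    apply: le_trans (ler_norm _).
    have : \sum_(e in D) (y e && ~~ y' e)%:R =
        #|Dy|%:R - \sum_(e in Dy) (y' e)%:R :> R.
      rewrite -sum1_card natr_sum -sumrB /= [RHS]big_mkcond [LHS]big_mkcond /=.
      apply: eq_bigr => e _; rewrite finset.inE.
      by case: (e \in D); case: (y e); case: (y' e); rewrite /= ?subrr ?subr0.
    move=> hE; rewrite hE in h.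
    have : (1 - p) * (p * d / 2) <= (1 - p) * #|Dy|%:R.
      by rewrite ler_wpM2l ?cD// subr_ge0 ltW.
    rewrite /q in h; lra.
  have /le_trans -> // := linear_tail k Dy l0.
  rewrite /X ler_wpM2l ?(ltW h0)// lerXn2r ?nnegrE ?divr_ge0 ?exprn_ge0 ?mulr_ge0 ?invr_ge0//; try lra.
  set c := #|Dy|%:R in dy0 *.
  rewrite (_ : c / ((1 - p) * c / 2) ^+ 2 = 4 / ((1 - p) ^+ 2 * c)); last first.
    by field; rewrite !gt_eqF// subr_gt0.
  rewrite ler_pdivrMr ?mulr_gt0 ?exprn_gt0 ?subr_gt0// mulrAC ler_pdivlMr; last first.
    by rewrite mulr_gt0// exprn_gt0.
  have hc : p * d / 2 <= c by rewrite /c cD.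
  have : (1 - p) ^+ 2 * (p * d / 2) <= (1 - p) ^+ 2 * c by rewrite ler_wpM2l ?sqr_ge0.
  have : q ^+ 2 * d <= (1 - p) ^+ 2 * (p * d).
    rewrite -subr_ge0 (_ : _ - _ = (1 - p) ^+ 2 * q * d); last by rewrite /q; ring.
    exact: (mulr_ge0 (mulr_ge0 (sqr_ge0 _) (ltW q0)) (ltW d0)).
  lra.
rewrite -[2 * _ * _]mulrA -/X (_ : 2 * X = X + X); last by ring.
apply: (@le_trans _ _ (esp (fun y => (p * d / 2 <= `|\sum_(e in D) (y e)%:R - p * d|)%R%:R + X))).
  apply: le_esp => // y.
  have [hy|hy] := leP (p * d / 2) (\sum_(e in D) (y e)%:R).
    by rewrite (le_trans (t2 y hy))// lerDr.
  have -> : p * d / 2 <= `|\sum_(e in D) (y e)%:R - p * d|.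
    by rewrite distrC (le_trans _ (ler_norm _))//; lra.
  rewrite -[leLHS]addr0 lerD//; apply: esp_le_cst => // y'; by case: (_ < _).
by rewrite espD esp_cst lerD2r.
Qed.

End Tails.

Lemma sqr_sum_le (R : realType) (I : finType) (M : {set I}) (t : I -> R) :
  (\sum_(v in M) t v) ^+ 2 <= #|M|%:R * \sum_(v in M) t v ^+ 2.
Proof.
have : 0 <= \sum_(v in M) \sum_(w in M) (t v - t w) ^+ 2.
  by apply: sumr_ge0 => v _; apply: sumr_ge0 => w _; exact: sqr_ge0.
have -> : \sum_(v in M) \sum_(w in M) (t v - t w) ^+ 2 =
    \sum_(v in M) (t v ^+ 2 * #|M|%:R - 2 * t v * \sum_(w in M) t w +
      \sum_(w in M) t w ^+ 2).
  apply: eq_bigr => v _; rewrite mulr_natr -sumr_const mulr_sumr -sumrB -big_split /=.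
  by apply: eq_bigr => w _; ring.
rewrite big_split sumrB /= -mulr_suml -[in X in _ - X + _]mulr_suml -mulr_sumr sumr_const.
rewrite -[_ *+ #|M|]mulr_natl; lra.
Qed.

(** The Gram matrix of the vectors [s v] is bounded below by [c] times the identity plus [a] times
    the all-ones matrix, which is positive, up to entries of size [eta]; these errors cost at most
    [eta * #|M|] in operator norm. *)
Lemma gram_lower (R : realType) (V I : finType) (M : {set V}) (A : {set I})
    (s : V -> I -> R) (w : V -> R) (a c eta : R) :
  0 <= a ->
  {in M, forall v, c + a - eta <= \sum_(b in A) s v b ^+ 2} ->
  {in M &, forall v v', v != v' -> `|\sum_(b in A) s v b * s v' b - a| <= eta} ->
  0 <= eta ->
  (c - eta * #|M|%:R) * (\sum_(v in M) w v ^+ 2) <=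
  \sum_(b in A) (\sum_(v in M) w v * s v b) ^+ 2.
Proof.
move=> a0 hd ho eta0.
pose G v v' := \sum_(b in A) s v b * s v' b.
have -> : \sum_(b in A) (\sum_(v in M) w v * s v b) ^+ 2 =
    \sum_(v in M) \sum_(v' in M) w v * w v' * G v v'.
  rewrite [RHS](eq_bigr (fun v => \sum_(b in A) \sum_(v' in M)
      (w v * s v b) * (w v' * s v' b))); last first.
    move=> v _; rewrite exchange_big /=; apply: eq_bigr => v' _.
    by rewrite mulr_sumr; apply: eq_bigr => b _; ring.
  rewrite exchange_big /=; apply: eq_bigr => b _.
  by rewrite expr2 mulr_suml; apply: eq_bigr => v _; rewrite mulr_sumr.
have key v v' : v \in M -> v' \in M ->
    w v * w v' * a + (v == v')%:R * c * w v ^+ 2 - eta * (`|w v| * `|w v'|)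
    <= w v * w v' * G v v'.
  move=> vM v'M; have [<-|vv] := eqVneq v v'.
    have := hd v vM; rewrite (eq_bigr (fun b => s v b * s v b)); last by move=> b _; rewrite expr2.
    rewrite -/(G v v) => h; rewrite -normrM ger0_norm; last by rewrite -expr2 sqr_ge0.
    have : 0 <= w v ^+ 2 * (G v v - (c + a - eta)) by rewrite mulr_ge0 ?sqr_ge0 ?subr_ge0.
    by rewrite mul1r; nra.
  have := ho _ _ vM v'M vv; rewrite -/(G v v') => h.
  rewrite mul0r mul0r addr0 -normrM.
  have : `|w v * w v' * (G v v' - a)| <= `|w v * w v'| * eta.
    by rewrite normrM ler_wpM2l.
  by rewrite ler_norml => /andP[]; lra.
apply: (@le_trans _ _ (\sum_(v in M) \sum_(v' in M)
    (w v * w v' * a + (v == v')%:R * c * w v ^+ 2 - eta * (`|w v| * `|w v'|)))); last first.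
  by apply: ler_sum => v vM; apply: ler_sum => v' v'M; exact: key.
have -> : \sum_(v in M) \sum_(v' in M)
    (w v * w v' * a + (v == v')%:R * c * w v ^+ 2 - eta * (`|w v| * `|w v'|)) =
  (\sum_(v in M) w v) ^+ 2 * a + c * (\sum_(v in M) w v ^+ 2)
    - eta * (\sum_(v in M) `|w v|) ^+ 2.
  have e1 (f : V -> R) : (\sum_(v in M) f v) ^+ 2 = \sum_(v in M) \sum_(v' in M) f v * f v'.
    by rewrite expr2 mulr_suml; apply: eq_bigr => v _; rewrite mulr_sumr.
  rewrite !e1 mulr_suml !mulr_sumr -big_split -sumrB /=; apply: eq_bigr => v vM.
  rewrite sumrB big_split /= -mulr_suml mulr_sumr; congr (_ + _ - _).
  rewrite (bigD1 v vM) /= eqxx mul1r big1 ?addr0// => v' /andP[_ /negPf vv].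
  by rewrite eq_sym vv !mul0r.
have cs : (\sum_(v in M) `|w v|) ^+ 2 <= #|M|%:R * \sum_(v in M) w v ^+ 2.
  rewrite (le_trans (sqr_sum_le _ _))// ler_wpM2l//; apply: ler_sum => v _.
  by rewrite real_normK ?num_real.
have q0 : 0 <= (\sum_(v in M) w v) ^+ 2 * a by rewrite mulr_ge0 ?sqr_ge0.
have : eta * (\sum_(v in M) `|w v|) ^+ 2 <= eta * (#|M|%:R * \sum_(v in M) w v ^+ 2).
  by rewrite ler_wpM2l.
lra.
Qed.

(** * Estimates at scale y *)

Section Asymptotics.
Context {R : realType} (p : R).
Hypothesis hp : 0 < p < 1.

Lemma near_ge (z : R) : \forall y \near +oo, z <= y.
Proof. by apply: nbhs_pinfty_ge; rewrite num_real. Qed.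

Lemma near_exp (C c : R) (K : nat) : 0 < c ->
  \forall y \near +oo, C * y ^+ K * expR (- (c * y)) <= 1.
Proof.
move=> c0; pose d := c / K.+1%:R.
have d0 : 0 < d by rewrite divr_gt0.
near=> y.
have y1 : 1 <= y by near: y; exact: near_ge.
have y0 : 0 < y by lra.
have h1 : (d * y) ^+ K.+1 <= expR (c * y).
  have -> : c * y = K.+1%:R * (d * y) by rewrite /d; field.
  have dy : 0 <= d * y := mulr_ge0 (ltW d0) (ltW y0).
  rewrite expRM_natl lerXn2r ?nnegrE ?expR_ge0//.
  by rewrite (le_trans _ (expR_ge1Dx _))//; lra.
rewrite expRN ler_pdivrMr ?expR_gt0// mul1r (le_trans _ h1)//.
rewrite exprMn (exprS y) mulrA ler_wpM2r ?exprn_ge0 ?(ltW y0)//.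
by rewrite mulrC -ler_pdivrMr ?exprn_gt0//; near: y; exact: near_ge.
Unshelve. all: by end_near. Qed.

(** The two terms of [char_bound] at [k = K.+1], for a phase of size [X], a linear square sum [S2]
    and an error [W]. The exponential beats every power of [y], and [2 ^ K.+1] exceeds [K].
    Uniformity in the three variables is needed because the graph is chosen after [y]. *)
Lemma near_small_terms (d L K : nat) (C1 C2 c : R) : 0 < c -> 0 <= C1 -> 0 <= C2 ->
  \forall y \near +oo, forall X S2 W : R,
  0 <= X <= C1 * y ^+ L -> c * y <= S2 -> 0 <= W <= C2 / y ->
  (2 ^ K.+2)%:R * (1 + X) ^+ (2 ^ K.+2) *
    expR (- (crho p * (S2 - 16 * (d * 2 ^ K.+2)%:R))) + hcst p d K.+1 * W ^+ (2 ^ K.+1)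
  <= (y ^+ K)^-1.
Proof.
move=> c0 C10 C20.
have r0 : 0 < crho p := crho_gt0 hp.
have rc0 : 0 < crho p * c by rewrite mulr_gt0.
near=> y => X S2 W /andP[X0 X1] hS /andP[W0 W1].
have y1 : 1 <= y by near: y; exact: near_ge.
have y0 : 0 < y by lra.
have yK : 0 < y ^+ K by rewrite exprn_gt0.
set N2 := (2 ^ K.+2)%N; set N1 := (2 ^ K.+1)%N.
have cX : 1 + X <= (1 + C1) * y ^+ L.
  have : 1 <= y ^+ L by rewrite exprn_ege1.
  lra.
pose D := 2 * N2%:R * (1 + C1) ^+ N2 * expR (crho p * (16 * (d * N2)%:R)).
have h1 : D * y ^+ (L * N2 + K) * expR (- (crho p * c * y)) <= 1.
  by near: y; exact: near_exp.
have h2 : 2 * hcst p d K.+1 * C2 ^+ N1 <= y by near: y; exact: near_ge.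
have -> : (y ^+ K)^-1 = (y ^+ K)^-1 / 2 + (y ^+ K)^-1 / 2 by field; rewrite gt_eqF.
apply: lerD.
  have e1 : N2%:R * (1 + X) ^+ N2 * expR (- (crho p * (S2 - 16 * (d * N2)%:R))) <=
     N2%:R * ((1 + C1) * y ^+ L) ^+ N2 *
       (expR (crho p * (16 * (d * N2)%:R)) * expR (- (crho p * c * y))).
    have t0 : 0 <= 1 + X by lra.
    rewrite ler_pM ?expR_ge0 ?mulr_ge0 ?exprn_ge0//.
      by rewrite ler_wpM2l// lerXn2r ?nnegrE// (le_trans t0).
    rewrite -expRD ler_expR mulrBr opprB lerD2l lerN2 -mulrA ler_wpM2l// ltW//.
  apply: (le_trans e1); rewrite -[y ^- K]div1r ler_pdivlMr// ler_pdivlMr//.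
  apply: le_trans h1; rewrite le_eqVlt; apply/orP; left; apply/eqP.
  by rewrite /D exprMn -exprM exprD; ring.
have e2 : hcst p d K.+1 * W ^+ N1 <= hcst p d K.+1 * (C2 / y) ^+ N1.
  by rewrite ler_wpM2l ?(ltW (hcst_gt0 hp _ _))// lerXn2r ?nnegrE// (le_trans W0).
apply: (le_trans e2); rewrite exprMn exprVn mulrA.
have yN : 0 < y ^+ N1 by rewrite exprn_gt0.
rewrite ler_pdivrMr// [leRHS]mulrC -ler_pdivrMr ?divr_gt0 ?invr_gt0//.
rewrite invf_div invrK.
have : y * y ^+ K <= y ^+ N1.
  by rewrite -exprS ler_weXn2l// ltnW// ltn_expl.
have : hcst p d K.+1 * C2 ^+ N1 * (2 * y ^+ K) <= y * y ^+ K.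
  rewrite [leLHS](_ : _ = 2 * hcst p d K.+1 * C2 ^+ N1 * y ^+ K); last by ring.
  by rewrite ler_wpM2r// ltW.
lra.
Unshelve. all: by end_near. Qed.

Lemma kappa_ge (c : R) (j n m : nat) : 0 <= c -> (2 <= j)%N ->
  c * n%:R <= m%:R -> 2 * j%:R <= m%:R :> R ->
  p ^+ ('C(j, 2)).-1 * (c / 2) ^+ (j - 2) / (j - 2)`!%:R * n%:R ^+ (j - 2) <= kappa p m j.
Proof.
move=> c0 j2 cn jm; have /andP[p0 p1] := hp.
rewrite /kappa -!mulrA ler_wpM2l ?exprn_ge0 ?(ltW p0)//.
set i := (j - 2)%N.
have f0 : 0 < i`!%:R :> R by rewrite ltr0n fact_gt0.
rewrite mulrCA -exprMn mulrC ler_pdivrMr// -natrM bin_ffact.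
apply: (@le_trans _ _ ((m - 2 - i)%:R ^+ i)).
  rewrite lerXn2r ?nnegrE ?mulr_ge0 ?divr_ge0//.
  have jm' : (2 * j <= m)%N by rewrite -(ler_nat R) natrM.
  have -> : (m - 2 - i)%N = (m - j)%N by rewrite /i; lia.
  rewrite natrB; last by lia.
  lra.
rewrite -natrX ler_nat ffact_prod -[leqLHS](_ : \prod_(k < i) (m - 2 - i) = _)%N; last first.
  by rewrite prod_nat_const card_ord.
by apply: leq_prod => k _; rewrite leq_sub2l// ltnW.
Qed.

Lemma kappa_le (j n m : nat) : (m <= n)%N -> kappa p m j <= n%:R ^+ (j - 2).
Proof.
move=> mn; have /andP[p0 p1] := hp; rewrite /kappa -[leRHS]mul1r ler_pM//.
- by rewrite exprn_ge0// ltW.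
- by rewrite exprn_ile1// ltW.
rewrite -natrX ler_nat (leq_trans (leq_bin_exp _ _))//.
by case: (j - 2)%N => // k; rewrite leq_exp2r// (leq_trans (leq_subr _ _)).
Qed.

Lemma kappa_ge0 (j m : nat) : 0 <= kappa p m j.
Proof. by have /andP[p0 p1] := hp; rewrite /kappa mulr_ge0// exprn_ge0// ltW. Qed.

End Asymptotics.

(** * Decay of the characteristic function *)

(** A complete graph with edges of an abstract type; [ed] is left free on the diagonal. *)
Definition edge_system (V E : finType) (en : E -> {set V}) (ed : V -> V -> E) : Prop :=
  [/\ injective en, forall e, #|en e| = 2%N &
      forall u v, u != v -> en (ed u v) = [set u; v]%SET].

(* All quantities are compared with powers of the scale [y], the number of vertices
   being [y ^+ L]: [K] is arbitrary, so the bound beats any power of the number of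
   vertices, and [h] is an arbitrary phase not depending on the edges inside [A]. *)
Definition phase_decay {R : realType} (p : R) (L j : nat) : Prop :=
  forall (c : R) (K : nat), 0 < c -> \forall y \near +oo,
  forall (V E : finType) (en : E -> {set V}) (ed : V -> V -> E),
  edge_system en ed -> #|V|%:R = y ^+ L ->
  forall (A N : {set V}) (h : {ffun E -> bool} -> R) (theta : R),
  A \subset N -> c * #|V|%:R <= #|A|%:R -> indep (eset en A) h ->
  y / #|V|%:R ^+ (j - 1) <= theta <= pi ->
  `|esp p (fun x => cos (h x + theta * cliques en N j x))| <= (y ^+ K)^-1.

(** * Small angles: the linear part of the clique count *)

Section Base.
Context {R : realType} (p : R).
Hypothesis hp : 0 < p < 1.

Lemma bin2_ge (m : nat) : (2 <= m)%N -> m%:R ^+ 2 / 4 <= 'C(m, 2)%:R :> R.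
Proof.
move=> m2; rewrite ler_pdivrMr// -natrX -natrM ler_nat.
by have := mul_bin_diag m 1; rewrite bin1; nia.
Qed.

Lemma pick_subset (T : finType) (A : {set T}) (b : nat) : (b <= #|A|)%N ->
  exists2 B : {set T}, B \subset A & #|B| = b.
Proof.
move=> bA; exists [set x in take b (enum A)].
  by apply/fintype.subsetP => x; rewrite finset.inE => /mem_take; rewrite mem_enum.
rewrite cardsE; apply/eqP; have /card_uniqP -> : uniq (take b (enum A)).
  by rewrite take_uniq// enum_uniq.
rewrite size_take -cardE; move: bA; rewrite leq_eqVlt => /predU1P[->|->//].
by rewrite ltnn.
Qed.

Lemma nat_ceil (z : R) : 0 <= z -> exists b : nat, z <= b%:R <= z + 1.
Proof.
move=> z0; exists (Num.truncn z).+1.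
have /andP[h1 h2] := truncn_itv z0.
by rewrite (ltW h2) -natr1 lerD2r h1.
Qed.

Lemma nat_floor (z : R) : 0 <= z -> exists b : nat, z - 1 <= b%:R <= z.
Proof.
move=> z0; exists (Num.truncn z).
have /andP[h1 h2] := truncn_itv z0.
by rewrite h1 andbT lerBlDr natr1 ltW.
Qed.

Lemma juntasZ (T : finType) d M (F : {ffun T -> bool} -> R) (k : R) : 0 <= k ->
  juntas d M F -> juntas d (k * M) (fun x => k * F x).
Proof.
move=> k0; elim=> [|S M' J M1 F' cS iJ JM _ jF].
  by rewrite mulr0; exact: juntas_nil.
rewrite mulrDr; under eq_fun do rewrite mulrDr; apply: juntas_cons cS _ _ jF.
- by move=> x y xy; rewrite (iJ _ _ xy).
- by move=> x; rewrite normrM ger0_norm// ler_wpM2l.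
Qed.

Lemma pi_le4 : pi <= 4 :> R.
Proof. by have /andP[_ /ltW] := pihalf_02 R; lra. Qed.

Lemma kappa_lower (c : R) (j : nat) : 0 < c -> (2 <= j)%N ->
  exists2 c2 : R, 0 < c2 & forall n m : nat, c * n%:R <= m%:R -> 2 * j%:R <= m%:R :> R ->
    c2 * n%:R ^+ (j - 2) <= kappa p m j.
Proof.
move=> c0 j2; have /andP[p0 p1] := hp.
exists (p ^+ ('C(j, 2)).-1 * (c / 2) ^+ (j - 2) / (j - 2)`!%:R).
  by rewrite !mulr_gt0 ?exprn_gt0 ?divr_gt0// invr_gt0 ltr0n fact_gt0.
by move=> n m cn jm; apply: kappa_ge (ltW c0) j2 cn jm.
Qed.

(** [char_bound] with all coefficients equal to the mean derivative, [var_dif_cliques] supplying the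
    error. *)
Lemma base_phase (V E : finType) (en : E -> {set V}) (ed : V -> V -> E) (k j : nat)
    (B : {set E}) (N : {set V}) (h : {ffun E -> bool} -> R) (theta : R) :
  edge_system en ed -> (2 <= j)%N -> (forall e, e \in B -> en e \subset N) ->
  indep B h -> 0 <= theta -> theta * kappa p #|N| j <= pi ->
  `|esp p (fun x => cos (h x + theta * cliques en N j x))| <=
  (2 ^ k.+1)%:R * (1 + (2 * (theta * #|V|%:R ^+ j) + 4 * #|B|%:R)) ^+ (2 ^ k.+1) *
    expR (- (crho p * (#|B|%:R * (theta * kappa p #|N| j) ^+ 2 - 16 * ('C(j, 2) * 2 ^ k.+1)%:R))) +
  hcst p 'C(j, 2) k * (#|B|%:R * (theta ^+ 2 * ('C(j, 2)%:R * #|V|%:R ^+ (2 * j) / #|V|%:R ^+ 5))) ^+ (2 ^ k).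
Proof.
move=> [ei ce edE] j2 BN ih t0 tk; set n : R := #|V|%:R; set d := 'C(j, 2).
set a := theta * kappa p #|N| j in tk *.
have a0 : 0 <= a by rewrite mulr_ge0 ?kappa_ge0.
have d0 : (0 < d)%N by rewrite bin_gt0.
have jc : juntas d (theta * n ^+ j) (fun x => theta * cliques en N j x).
  apply: juntasZ => //; exact: (juntas_cliques ei ce edE N j).
have aB : {in B, forall e, `|a| <= pi} by move=> e _; rewrite ger0_norm.
have sB : \sum_(e in B) `|a| <= 4 * #|B|%:R.
  rewrite sumr_const -[leLHS]mulr_natr ler_wpM2r// ger0_norm// (le_trans tk)//.
  exact: pi_le4.
have := char_bound hp k d0 jc ih aB sB; rewrite sumr_const -[a ^+ 2 *+ _]mulr_natl addrA.
move=> /le_trans; apply; rewrite lerD2l ler_wpM2l ?(ltW (hcst_gt0 hp _ _))//.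
rewrite lerXn2r ?nnegrE//.
- by apply: sumr_ge0 => e _; apply: esp_ge0 => // x; exact: sqr_ge0.
- by rewrite !mulr_ge0 ?sqr_ge0 ?exprn_ge0 ?invr_ge0 ?exprn_ge0 ?ler0n.
rewrite mulr_natl -sumr_const; apply: ler_sum => e eB.
have eN := BN e eB.
have -> : esp p (fun x => (dif e (fun x0 => theta * cliques en N j x0) x - a) ^+ 2) =
    theta ^+ 2 * esp p (fun x => (dif e (cliques en N j) x - kappa p #|N| j) ^+ 2).
  by rewrite -espZ; apply: eq_esp => x; rewrite /dif /a; ring.
rewrite ler_wpM2l ?sqr_ge0// ler_pdivlMr.
  exact: (var_dif_cliques hp ei ce edE eN j2).
by rewrite exprn_gt0// ltr0n (ltn_trans _ (edge_gt1 ce e)).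
Qed.

(* Here [theta] times a derivative of the count is at most [pi], and the linear part of the
   count on about [y / (theta * kappa) ^+ 2] edges is enough to make the phase decay. *)
Lemma phase_decay_low (L j : nat) (c : R) (K : nat) : (2 <= L)%N -> (2 <= j)%N -> 0 < c ->
  \forall y \near +oo,
  forall (V E : finType) (en : E -> {set V}) (ed : V -> V -> E),
  edge_system en ed -> #|V|%:R = y ^+ L ->
  forall (A N : {set V}) (h : {ffun E -> bool} -> R) (theta : R),
  A \subset N -> c * #|V|%:R <= #|A|%:R -> indep (eset en A) h ->
  y / #|V|%:R ^+ (j - 1) <= theta <= pi ->
  (2 < j)%N ==> (theta <= (y * #|V|%:R ^+ (j - 2))^-1) ->
  `|esp p (fun x => cos (h x + theta * cliques en N j x))| <= (y ^+ K)^-1.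
Proof.
move=> L2 j2 c0.
have j1 : (j - 1 = (j - 2).+1)%N by lia.
have jE : (2 * j = (j - 2) + (j - 2) + 4)%N by lia.
have [c2 c20 kge0] := kappa_lower c0 j2.
(* 8 from [2 * theta] with [theta <= pi <= 4], and 4 from the bound on the sum of the coefficients
   over [B]. *)
pose C1 : R := 8 + 4.
have C10 : 0 <= C1 by rewrite /C1; lra.
(* Rounding the number [b] of edges up adds at most [pi ^+ 2 <= 16] to the square sum [y], whence
   17. *)
pose C2 : R := 17 / c2 ^+ 2 * 'C(j, 2)%:R.
have C20 : 0 <= C2 by rewrite !mulr_ge0 ?invr_ge0 ?sqr_ge0.
near=> y => V E en ed es nE A N h theta AN cA ih /andP[t1 t2] tj.
have y1 : 1 <= y by near: y; exact: near_ge.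
have y0 : 0 < y by lra.
have jy : c^-1 * (2 * j%:R) <= y by near: y; exact: near_ge.
have cy : c^-1 * 2 <= y by near: y; exact: near_ge.
have c8 : 8 / (c2 ^+ 2 * c ^+ 2) <= y by near: y; exact: near_ge.
have c8' : 8 / c ^+ 2 <= y by near: y; exact: near_ge.
have key : forall X S2 W : R, 0 <= X <= C1 * y ^+ (L * (j + 2)) -> 1 * y <= S2 ->
    0 <= W <= C2 / y ->
    (2 ^ K.+2)%:R * (1 + X) ^+ (2 ^ K.+2) *
    expR (- (crho p * (S2 - 16 * ('C(j, 2) * 2 ^ K.+2)%:R))) +
    hcst p 'C(j, 2) K.+1 * W ^+ (2 ^ K.+1) <= (y ^+ K)^-1.
  by near: y; exact: (near_small_terms hp _ _ _ ltr01 C10 C20).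
set n : R := #|V|%:R in nE cA t1 tj *.
have yn : y ^+ 2 <= n by rewrite nE ler_weXn2l.
have yn1 : y <= n by rewrite (le_trans _ yn)// -[leLHS]expr1 ler_weXn2l.
have n0 : 0 < n by lra.
have n1 : 1 <= n by lra.
have t0 : 0 < theta by rewrite (lt_le_trans _ t1)// divr_gt0// exprn_gt0.
have cn : c * n <= #|N|%:R by rewrite (le_trans cA)// ler_nat subset_leq_card.
have jN : 2 * j%:R <= #|N|%:R :> R.
  by rewrite (le_trans _ cn)// -ler_pdivrMl// (le_trans jy).
have kge : c2 * n ^+ (j - 2) <= kappa p #|N| j by exact: kge0.
have kle : kappa p #|N| j <= n ^+ (j - 2) by apply: kappa_le => //; exact: max_card.
have nj : 0 < n ^+ (j - 2) by rewrite exprn_gt0.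
have kp : 0 < kappa p #|N| j by rewrite (lt_le_trans _ kge)// mulr_gt0.
set ka := kappa p #|N| j in kge kle kp.
(* For [j = 2] the count is linear with [ka <= 1], and [theta <= pi] is enough; otherwise the upper
   bound on [theta] is used. *)
have tk : theta * ka <= pi.
  move: tj; rewrite implybE -leqNgt => /orP[j2'|tj].
    have j22 : j = 2%N by apply/eqP; rewrite eqn_leq j2' j2.
    have : ka <= 1 by rewrite (le_trans kle)// j22 expr0.
    by move=> k1; rewrite (le_trans _ t2)// -[leRHS]mulr1 ler_wpM2l// ltW.
  apply: (@le_trans _ _ 1); last by rewrite (le_trans _ (pi_ge2 R))//; lra.
  apply: (@le_trans _ _ ((y * n ^+ (j - 2))^-1 * n ^+ (j - 2))).
    by rewrite ler_pM ?(ltW t0) ?(ltW kp).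
  by rewrite invfM -mulrA mulVf ?gt_eqF// mulr1 invf_le1.
have tk0 : 0 < theta * ka by rewrite mulr_gt0.
have [b /andP[b1 b2]] : exists b : nat, y / (theta * ka) ^+ 2 <= b%:R <= y / (theta * ka) ^+ 2 + 1.
  by apply: nat_ceil; rewrite divr_ge0 ?sqr_ge0 ?ltW.
have tks : 0 < (theta * ka) ^+ 2 by rewrite exprn_gt0.
have b1' : y <= b%:R * (theta * ka) ^+ 2 by rewrite -ler_pdivrMr.
have b2' : b%:R * (theta * ka) ^+ 2 <= 17 * y.
  apply: (@le_trans _ _ (y + (theta * ka) ^+ 2)).
    by rewrite -ler_pdivlMr// mulrDl divff ?gt_eqF.
  have : (theta * ka) ^+ 2 <= 4 ^+ 2.
    by rewrite lerXn2r ?nnegrE ?(ltW tk0)// (le_trans tk)// pi_le4.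
  lra.
have tlow : c2 * y / n <= theta * ka.
  apply: (@le_trans _ _ (y / n ^+ (j - 1) * (c2 * n ^+ (j - 2)))); last first.
    apply: ler_pM => //; last exact: (mulr_ge0 (ltW c20) (ltW nj)).
    exact: (divr_ge0 (ltW y0) (exprn_ge0 _ (ltW n0))).
  rewrite j1 exprS le_eqVlt; apply/orP; left; apply/eqP; field.
  by rewrite !gt_eqF.
have A2 : (2 <= #|A|)%N.
  by rewrite -(ler_nat R) (le_trans _ cA)// -ler_pdivrMl// (le_trans cy).
(* The lower end of the range of [theta] enters here: it gives [b] at most about n^2 / y, below the
   number of edges inside [A]. *)
have bA : (b <= #|eset en A|)%N.
  have [ei ce edE] := es.
  rewrite (card_eset ei ce edE) -(ler_nat R) (le_trans b2)// (le_trans _ (bin2_ge A2))//.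
  apply: (@le_trans _ _ (n ^+ 2 / (c2 ^+ 2 * y) + 1)).
    have l0 : 0 < c2 * y / n := divr_gt0 (mulr_gt0 c20 y0) n0.
    rewrite lerD2r (_ : n ^+ 2 / (c2 ^+ 2 * y) = y / (c2 * y / n) ^+ 2); last first.
      by field; rewrite !gt_eqF.
    rewrite ler_pM2l// lef_pV2 ?posrE ?exprn_gt0//.
    by rewrite lerXn2r ?nnegrE ?(ltW tk0) ?(ltW l0).
  apply: (@le_trans _ _ ((c * n) ^+ 2 / 4)); last first.
    by rewrite ler_wpM2r// lerXn2r ?nnegrE//; exact: (mulr_ge0 (ltW c0) (ltW n0)).
  have n2 : 1 <= n ^+ 2 by rewrite exprn_ege1.
  have n2y : y <= n ^+ 2 by rewrite (le_trans yn1)// -[leLHS]expr1 ler_weXn2l.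
  have h1 : n ^+ 2 / (c2 ^+ 2 * y) <= (c ^+ 2 / 8) * n ^+ 2.
    rewrite mulrC ler_wpM2r ?sqr_ge0// -div1r ler_pdivrMr ?mulr_gt0 ?exprn_gt0//.
    have q0 : 0 < c2 ^+ 2 * c ^+ 2 by rewrite mulr_gt0 ?exprn_gt0.
    by move: c8; rewrite ler_pdivrMr//; lra.
  have h2 : 1 <= (c ^+ 2 / 8) * n ^+ 2.
    have q0 : 0 < c ^+ 2 by rewrite exprn_gt0.
    have : c ^+ 2 * y <= c ^+ 2 * n ^+ 2 by rewrite ler_wpM2l// ltW.
    by move: c8'; rewrite ler_pdivrMr//; lra.
  by rewrite exprMn; lra.
have [B BA cB] := pick_subset bA.
have BN e : e \in B -> en e \subset N.
  by move=> /(fintype.subsetP BA); rewrite finset.inE => /fintype.subset_trans; apply.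
have := base_phase K.+1 es j2 BN (indepS BA ih) (ltW t0) tk.
rewrite cB => /le_trans; apply.
(* The choice of [b] cancels [theta]: the error is of order y / n, and [n >= y ^+ 2]. *)
have Wle : b%:R * (theta ^+ 2 * ('C(j, 2)%:R * n ^+ (2 * j) / n ^+ 5)) <= C2 / y.
  have -> : b%:R * (theta ^+ 2 * ('C(j, 2)%:R * n ^+ (2 * j) / n ^+ 5)) =
     b%:R * (theta * n ^+ (j - 2)) ^+ 2 * 'C(j, 2)%:R / n.
    by rewrite jE !exprD; field; rewrite gt_eqF.
  have hb : b%:R * (theta * n ^+ (j - 2)) ^+ 2 <= 17 / c2 ^+ 2 * y.
    rewrite mulrAC ler_pdivlMr ?exprn_gt0// (le_trans _ b2')//.
    have -> : b%:R * (theta * n ^+ (j - 2)) ^+ 2 * c2 ^+ 2 =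
      b%:R * (theta * (c2 * n ^+ (j - 2))) ^+ 2 by ring.
    rewrite ler_wpM2l// lerXn2r ?nnegrE ?(ltW tk0)//.
      exact: (mulr_ge0 (ltW t0) (mulr_ge0 (ltW c20) (ltW nj))).
    by rewrite ler_wpM2l// ltW.
  rewrite ler_pdivrMr//.
  apply: (@le_trans _ _ (17 / c2 ^+ 2 * y * 'C(j, 2)%:R)); first by rewrite ler_wpM2r.
  rewrite [leLHS](_ : _ = C2 * y); last by rewrite /C2; ring.
  by rewrite -[leRHS]mulrA ler_wpM2l// [y^-1 * n]mulrC ler_pdivlMr.
have Wge : 0 <= b%:R * (theta ^+ 2 * ('C(j, 2)%:R * n ^+ (2 * j) / n ^+ 5)).
  apply: mulr_ge0 => //; apply: mulr_ge0; first exact: sqr_ge0.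
  by apply: divr_ge0; rewrite ?mulr_ge0 ?exprn_ge0 ?(ltW n0).
have Xle : 2 * (theta * n ^+ j) + 4 * b%:R <= C1 * y ^+ (L * (j + 2)).
  have -> : C1 * y ^+ (L * (j + 2)) = 12 * (n ^+ j * n ^+ 2).
    by rewrite exprM -nE exprD /C1; ring.
  have nj1 : 1 <= n ^+ j by rewrite exprn_ege1.
  have n21 : 1 <= n ^+ 2 by rewrite exprn_ege1.
  have h1 : theta * n ^+ j <= 4 * n ^+ j.
    by rewrite ler_wpM2r ?(le_trans t2 pi_le4)//; lra.
  have h2 : b%:R <= n ^+ 2.
    have [ei ce edE] := es.
    rewrite /n -natrX ler_nat (leq_trans bA)// (card_eset ei ce edE).
    by rewrite (leq_trans (leq_bin_exp _ _))// leq_exp2r// max_card.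
  have h3 : n ^+ j <= n ^+ j * n ^+ 2 by rewrite ler_peMr//; lra.
  have h4 : n ^+ 2 <= n ^+ j * n ^+ 2 by rewrite ler_peMl//; lra.
  lra.
have Xge : 0 <= 2 * (theta * n ^+ j) + 4 * b%:R.
  by rewrite addr_ge0 ?mulr_ge0 ?exprn_ge0 ?(ltW n0) ?(ltW t0).
by apply: key; rewrite ?mul1r// ?Xge ?Wge.
Unshelve. all: by end_near. Qed.

End Base.

(** * Large angles: decoupling a star *)

Section StarStep.
Context {R : realType} (p : R).
Hypothesis hp : 0 < p < 1.

Lemma norm_le_of_sqr (a b : R) : 0 <= b -> a ^+ 2 <= b ^+ 2 -> `|a| <= b.
Proof. by move=> b0 ab; rewrite -ler_sqr ?nnegrE// real_normK ?num_real. Qed.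

(** For tails met in a union bound over y^k events: the order of the moment grows with [k] so as to
    pay for this prefactor. *)
Lemma near_tail (C D : R) (K k d : nat) : 0 <= C -> 0 <= D ->
  \forall y \near +oo, forall W : R, 0 <= W <= D / y ->
  y ^+ k * (C * hcst p d (K + k).+1 * W ^+ (2 ^ (K + k).+1)) <= (y ^+ K)^-1.
Proof.
move=> C0 D0; pose N1 := (2 ^ (K + k).+1)%N.
have Nk : (k + K < N1)%N.
  by rewrite addnC; apply: ltn_trans (ltn_expl _ _) => //.
have h0 := hcst_gt0 hp d (K + k).+1.
near=> y => W /andP[W0 W1].
have y1 : 1 <= y by near: y; exact: near_ge.
have y0 : 0 < y by lra.
have yC : C * hcst p d (K + k).+1 * D ^+ N1 <= y by near: y; exact: near_ge.
have Ch : 0 <= C * hcst p d (K + k).+1 by rewrite mulr_ge0// ltW.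
have e1 : C * hcst p d (K + k).+1 * W ^+ N1 <= C * hcst p d (K + k).+1 * (D / y) ^+ N1.
  by rewrite ler_wpM2l// lerXn2r ?nnegrE// (le_trans W0).
have yN : 0 < y ^+ N1 by rewrite exprn_gt0.
have yk : 0 < y ^+ k by rewrite exprn_gt0.
have yK : 0 < y ^+ K by rewrite exprn_gt0.
apply: (@le_trans _ _ (y ^+ k * (y / y ^+ N1))).
  rewrite ler_wpM2l ?(ltW yk)// (le_trans e1)// expr_div_n mulrA ler_wpM2r//.
  by rewrite invr_ge0 ltW.
rewrite mulrA ler_pdivrMr// ler_pdivlMl// -exprSr -exprD ler_weXn2l//.
by move: Nk; clear; lia.
Unshelve. all: by end_near. Qed.

(** The pairs counted by [pair_tail] on a star are the vertices of [A] adjacent to [v] in [y] but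
    not in [y'], which form the next set [A]. *)
Lemma star_card (V E : finType) (en : E -> {set V}) (ed : V -> V -> E) (A : {set V})
    (v : V) (y y' : {ffun E -> bool}) : edge_system en ed ->
  let D := [set ed v w | w in A :\ v]%SET in
  #|D| = #|A :\ v| /\
  \sum_(e in D) (y e && ~~ y' e)%:R = #|(A :&: nbr ed y v) :\: nbr ed y' v|%:R :> R.
Proof.
move=> [ei ce edE] D.
have inj : {in A :\ v &, injective (ed v)}.
  move=> w w'; rewrite !finset.inE => /andP[wv _] /andP[wv' _].
  by rewrite eq_sym in wv; rewrite eq_sym in wv' => /(ed_eq edE wv wv')[[]|[-> ->]].
split; first exact: card_in_imset.
rewrite big_imset//= -sum1_card natr_sum [LHS]big_mkcond [RHS]big_mkcond /=.
apply: eq_bigr => w _; rewrite !finset.inE eq_sym.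
case: (eqVneq v w) => vw; rewrite ?andbF //=.
by case: (w \in A); case: (y _); case: (y' _).
Qed.

(* Decoupling the star of a vertex [v] of [A] turns [j.+1]-cliques through [v] into
   [j]-cliques in the neighbourhood of [v]. *)
Lemma phase_decay_star (L j : nat) (c : R) (K : nat) :
  (0 < L)%N -> (0 < j)%N -> phase_decay p L j -> 0 < c ->
  \forall y \near +oo,
  forall (V E : finType) (en : E -> {set V}) (ed : V -> V -> E),
  edge_system en ed -> #|V|%:R = y ^+ L ->
  forall (A N : {set V}) (h : {ffun E -> bool} -> R) (theta : R),
  A \subset N -> c * #|V|%:R <= #|A|%:R -> indep (eset en A) h ->
  y / #|V|%:R ^+ (j - 1) <= theta <= pi ->
  `|esp p (fun x => cos (h x + theta * cliques en N j.+1 x))| <= (y ^+ K)^-1.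
Proof.
move=> L0 j0 IH c0.
have q0 := pq_gt0 hp; set q := p * (1 - p) in q0.
(* The density of the next [A]: a share [q / 4] of the star, which has at least [c * n / 2] edges
   into [A]. *)
have c'0 : 0 < q * c / 8 by rewrite divr_gt0// mulr_gt0.
have D0 : 0 <= 16 / (q ^+ 2 * c).
  by rewrite divr_ge0// mulr_ge0 ?sqr_ge0 ?ltW.
have two0 : 0 <= 2 :> R by [].
near=> y => V E en ed es nE A N h theta AN cA ih tt.
have y1 : 2 <= y by near: y; exact: near_ge.
have cy : 2 / c <= y by near: y; exact: near_ge.
(* Doubling bounds the square of the expectation, and the two contributions at [2 * K + 1] add up to
   at most y^(-2K) since [y >= 2]. *)
have keyIH : forall (V E : finType) (en : E -> {set V}) (ed : V -> V -> E),
  edge_system en ed -> #|V|%:R = y ^+ L ->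
  forall (A N : {set V}) (h : {ffun E -> bool} -> R) (theta : R),
  A \subset N -> q * c / 8 * #|V|%:R <= #|A|%:R -> indep (eset en A) h ->
  y / #|V|%:R ^+ (j - 1) <= theta <= pi ->
  `|esp p (fun x => cos (h x + theta * cliques en N j x))| <= (y ^+ (2 * K + 1))^-1.
  by near: y; exact: IH c'0.
have key : forall W : R, 0 <= W <= 16 / (q ^+ 2 * c) / y ->
  y ^+ 0 * (2 * hcst p 1 (2 * K + 1 + 0).+1 * W ^+ (2 ^ (2 * K + 1 + 0).+1)) <=
  (y ^+ (2 * K + 1))^-1.
  by near: y; exact: near_tail two0 D0.
have y0 : 0 < y by lra.
set n : R := #|V|%:R in nE cA tt *.
have yn : y <= n by rewrite nE -[leLHS]expr1 ler_weXn2l//; lra.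
have n0 : 0 < n by lra.
have A2 : 2 <= #|A|%:R :> R.
  by rewrite (le_trans _ cA)// -ler_pdivrMl// mulrC (le_trans cy).
have /card_gt0P[v vA] : (0 < #|A|)%N by rewrite -(ltr_nat R); lra.
have vN := fintype.subsetP AN v vA.
have [ei ce edE] := es.
have [cD _] := star_card A v [ffun=> true] [ffun=> true] es.
set D := [set ed v w | w in A :\ v]%SET in cD.
have dE : #|D|%:R = #|A|%:R - 1 :> R.
  by rewrite cD [in RHS](cardsD1 v A) vA natrD addrAC subrr add0r.
have dc : c * n / 2 <= #|D|%:R by rewrite dE; lra.
have d0 : (0 < #|D|)%N by rewrite -(ltr_nat R) dE; lra.
pose F x : R := h x + theta * cliques en N j.+1 x.
apply: norm_le_of_sqr; first by rewrite invr_ge0 exprn_ge0// ltW.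
have := doubling hp (star en v) F; move=> /le_trans; apply.
pose bad u u' : R := (\sum_(e in D) (u e && ~~ u' e)%:R < q * #|D|%:R / 4)%R%:R.
apply: (@le_trans _ _ (esp p (fun u => esp p (fun u' => bad u u' + (y ^+ (2 * K + 1))^-1)))).
  apply: (le_esp hp) => u; apply: (le_esp hp) => u'; rewrite /bad.
  case: ltP => [_|good] /=.
    apply: (@le_trans _ _ 1); last by rewrite lerDl invr_ge0 exprn_ge0// ltW.
    by apply: (esp_abs_le hp) => x; rewrite ler_norml cos_geN1 cos_le1.
  rewrite add0r; move: good; have [_ ->] := star_card A v u u' es.
  set A' := _ :\: _ => cA'.
  (* The count of the second copy goes into the phase. Its vertex set lies in the neighbourhood of
     [v] in [u'], which [A'] avoids, so it ignores the edges inside [A']. *)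
  pose h' x := h (merge (star en v) u x) - h (merge (star en v) u' x) -
    theta * cliques en (N :&: nbr ed u' v) j x.
  have -> : esp p (fun x => cos (F (merge (star en v) u x) - F (merge (star en v) u' x))) =
      esp p (fun x => cos (h' x + theta * cliques en (N :&: nbr ed u v) j x)).
    apply: eq_esp => x; congr cos; rewrite /F /h' !(cliques_merge_star ei ce edE)//; ring.
  have A'A : A' \subset A by apply/fintype.subsetP => w; rewrite !finset.inE => /and3P[].
  apply: (keyIH _ _ _ _ es nE A') => //.
  - apply/fintype.subsetP => w; rewrite !finset.inE => /and3P[_ wA ->].
    by rewrite (fintype.subsetP AN).
  - by rewrite (le_trans _ cA')// -/n; have := ler_wpM2l (ltW q0) dc; lra.
  - have es' : eset en A' \subset eset en A.
      by apply/fintype.subsetP => e; rewrite !finset.inE => /fintype.subset_trans; apply.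
    have ih' := indepS es' ih.
    apply: indepD; last apply: indepN.
      by apply: indepD; [|apply: indepN]; exact: merge_indep.
    move=> x x' xx; congr (_ * _); apply: (indep_cliques _ _ xx) => e.
    rewrite finset.inE => eA'; apply/negP => /fintype.subsetP eN.
    have [w] : exists w, w \in en e.
      by apply/card_gt0P; rewrite ce.
    move=> we; have := fintype.subsetP eA' w we; have := eN w we.
    by rewrite !finset.inE => /andP[_ ->].
rewrite (eq_esp (G := fun u => esp p (bad u) + (y ^+ (2 * K + 1))^-1)); last first.
  by move=> u; rewrite espD esp_cst.
rewrite espD esp_cst.
have h1 : esp p (fun u => esp p (bad u)) <= (y ^+ (2 * K + 1))^-1.
  have := pair_tail hp (2 * K + 1 + 0).+1 d0; move=> /le_trans; apply.
  rewrite -[leLHS]mul1r; apply: key; rewrite -/q.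
  have dp : 0 < #|D|%:R :> R by rewrite ltr0n.
  have qd : 0 < q ^+ 2 * #|D|%:R by rewrite mulr_gt0// exprn_gt0.
  rewrite divr_ge0 ?(ltW qd)//= ler_pdivrMr//.
  have qc : 0 < q ^+ 2 * c by rewrite mulr_gt0// exprn_gt0.
  have e8 : 8 = 16 / (q ^+ 2 * c) / y * (q ^+ 2 * (c * y / 2)).
    by field; rewrite !gt_eqF.
  rewrite {1}e8 ler_wpM2l ?(divr_ge0 D0 (ltW y0))// ler_wpM2l ?sqr_ge0//.
  by have := ler_wpM2l (ltW c0) yn; lra.
apply: (le_trans (lerD h1 (lexx _))).
rewrite exprVn -exprM mulnC -mulr2n -mulr_natr addn1 exprSr invfM -mulrA.
rewrite ler_piMr ?invr_ge0 ?exprn_ge0 ?(ltW y0)//.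
by rewrite ler_pdivrMl// mulr1.
Unshelve. all: by end_near. Qed.

End StarStep.

(** * Intermediate angles: decoupling a cross *)

Section CrossPrelim.
Context {R : realType} {T : finType} (p : R).
Implicit Types (F G : {ffun T -> bool} -> R).

Lemma juntas_merge d M F (B : {set T}) y : juntas d M F ->
  juntas d M (fun x => F (merge B y x)).
Proof.
elim=> [|S {}M J M1 {}F cS iJ JM _ jF]; first exact: juntas_nil.
by apply: juntas_cons cS _ _ jF => //; exact: merge_indep.
Qed.

End CrossPrelim.

Section CrossChar.
Context {R : realType} {p : R} {V E : finType} {en : E -> {set V}} {ed : V -> V -> E}.
Hypothesis hp : 0 < p < 1.
Hypothesis es : edge_system en ed.
Context {M P N A : {set V}}.
Hypothesis MP : [disjoint M & P]%bool.
Hypothesis MN : M \subset N.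
Hypothesis PN : P \subset N.
Hypothesis AN : A \subset N.
Hypothesis AQ : [disjoint A & M :|: P]%bool.
Context {z y y' : {ffun E -> bool}} {j : nat}.
Hypothesis j2 : (2 <= j)%N.
Local Notation n := (#|V|%:R : R).
Local Notation m := (#|M|%:R : R).
Local Notation Q := (M :|: P).

Definition pkappa v : R := kappa p (#|N :&: nbr ed z v :\: Q|).+1 j.

(** The predicted derivative along the edge [ab]: each private clique count is replaced by its mean
    derivative, and counts only if [b] is adjacent to [v]. *)
Definition cross_coef a b : R :=
  \sum_(v in M) zeta ed a y y' v * pkappa v * (b \in nbr ed z v)%:R.

Let AnQ b : b \in A -> b \notin Q.
Proof. by move=> bA; rewrite (disjointFr AQ bA). Qed.

Let PA_neq a b : a \in P -> b \in A -> a != b.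
Proof.
move=> aP bA; apply: contraNneq (AnQ bA) => <-.
by rewrite finset.inE aP orbT.
Qed.

Let n_gt0 a : a \in P -> 0 < n.
Proof. by move=> aP; rewrite ltr0n; apply/card_gt0P; exists a. Qed.

Let card_priv a v : a \in P -> #|priv ed M P N z a v| = (#|N :&: nbr ed z v :\: Q|).+1.
Proof. by move=> aP; rewrite /priv cardsU1 !finset.inE aP orbT. Qed.

Let zeta1 a v : `|zeta ed a y y' v : R| <= 1.
Proof.
rewrite /zeta; case: (y _); case: (y' _);
by rewrite /= ?subrr ?subr0 ?sub0r ?normrN ?normr0 ?normr1.
Qed.

(** Two sources of error: the sets discarded in [cross_error], and the fluctuation of each private
    derivative, bounded by [var_dif_cliques]. If [b] is not adjacent to [v], both the derivative and
    its prediction vanish. *)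
Lemma cross_coef_error a b : a \in P -> b \in A ->
  esp p (fun x => (dif (ed a b) (cross_dif en ed M P N z j y y') x - cross_coef a b) ^+ 2)
    * n ^+ 6 <=
  2 * m ^+ 2 * n ^+ (2 * j) * ('C(j, 2)%:R * n + #|Q|%:R ^+ 2).
Proof.
move=> aP bA; have [ei ce edE] := es.
have bQ := AnQ bA; have aN := fintype.subsetP PN a aP.
have n0 := n_gt0 aP; have ab := PA_neq aP bA.
set cd := cross_dif en ed M P N z j y y'.
pose cm := cross_main (R := R) en ed M P N z a b j y y'.
pose D v x := dif (ed a b) (cliques en (priv ed M P N z a v) j) x -
  pkappa v * (b \in nbr ed z v)%:R.
have cmE x : cm x - cross_coef a b = \sum_(v in M) zeta ed a y y' v * D v x.
  by rewrite /cm /cross_main /cross_coef -sumrB; apply: eq_bigr => v _; rewrite /D; ring.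
have h1 x : (dif (ed a b) cd x - cm x) ^+ 2 * n ^+ 6 <= m ^+ 2 * n ^+ (2 * j) * #|Q|%:R ^+ 2.
  have := cross_error (R := R) ei ce edE MP MN (z := z) aP bQ aN (j := j) (y := y) (y' := y') x.
  rewrite -/cd -/cm => er.
  have : (`|dif (ed a b) cd x - cm x| * n ^+ 4) ^+ 2 <= (m * #|Q|%:R * n ^+ j.+1) ^+ 2.
    by rewrite lerXn2r ?nnegrE ?mulr_ge0 ?exprn_ge0 ?(ltW n0).
  have -> : (`|dif (ed a b) cd x - cm x| * n ^+ 4) ^+ 2 =
      `|dif (ed a b) cd x - cm x| ^+ 2 * n ^+ 6 * n ^+ 2 by ring.
  have nE : (n ^+ j.+1) ^+ 2 = n ^+ (2 * j) * n ^+ 2.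
    by rewrite -exprM -exprD mulnC mulnSr.
  have -> : (m * #|Q|%:R * n ^+ j.+1) ^+ 2 = m ^+ 2 * n ^+ (2 * j) * #|Q|%:R ^+ 2 * n ^+ 2.
    by rewrite exprMn nE; ring.
  by rewrite real_normK ?num_real// ler_pM2r ?exprn_gt0.
have h2 v : v \in M -> esp p (fun x => D v x ^+ 2) * n ^+ 6 <= 'C(j, 2)%:R * n ^+ (2 * j) * n.
  move=> vM; rewrite (exprSr n 5) mulrA ler_pM2r//.
  have [bv|bv] := boolP (b \in nbr ed z v); last first.
    rewrite (_ : esp p _ = 0) ?mul0r ?mulr_ge0 ?exprn_ge0 ?(ltW n0)//.
    transitivity (esp p (fun _ : {ffun E -> bool} => 0 : R)); last by rewrite esp_cst.
    apply: eq_esp => x; rewrite /D (negPf bv) mulr0 subr0.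
    rewrite dif_cliques big_pred0 ?expr0n// => S; apply/negbTE/negP => /and3P[_ Sp eS].
    have : b \in priv ed M P N z a v.
      by apply: (fintype.subsetP Sp); apply: (fintype.subsetP eS); rewrite edE// finset.set22.
    by rewrite /priv !finset.inE in bv *; rewrite eq_sym (negPf ab) (negPf bv) !andbF.
  have eP : en (ed a b) \subset priv ed M P N z a v.
    rewrite edE// finset.subUset !finset.sub1set /priv finset.setU11 /=.
    by rewrite finset.in_setU1 finset.in_setD bQ finset.in_setI (fintype.subsetP AN)// bv orbT.
  have := var_dif_cliques hp ei ce edE eP j2; apply: le_trans.
  rewrite le_eqVlt; apply/orP; left; apply/eqP; congr (_ * _).
  by apply: eq_esp => x; rewrite /D bv mulr1 /pkappa card_priv.
apply: (@le_trans _ _ (esp p (fun x => 2 * (m ^+ 2 * n ^+ (2 * j) * #|Q|%:R ^+ 2) +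
    2 * m * n ^+ 6 * \sum_(v in M) D v x ^+ 2))).
  rewrite -espZr; apply: (le_esp hp) => x.
  have -> : dif (ed a b) cd x - cross_coef a b = (dif (ed a b) cd x - cm x) + (cm x - cross_coef a b).
    by ring.
  set u := dif _ _ _ - cm x in h1 *; have hu := h1 x; rewrite -/u in hu.
  rewrite cmE; set w := \sum_(v in M) _.
  have hw : w ^+ 2 <= m * \sum_(v in M) D v x ^+ 2.
    rewrite (le_trans (sqr_sum_le _ _))// ler_wpM2l//; apply: ler_sum => v _.
    rewrite exprMn ler_piMl ?sqr_ge0// -[zeta _ _ _ _ _ ^+ 2]real_normK ?num_real//.
    by rewrite exprn_ile1.
  have n6 : 0 < n ^+ 6 by rewrite exprn_gt0.
  have := ler_wpM2r (ltW n6) hw; have := sqr_ge0 (u - w).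
  move: hu; rewrite -(ler_pM2r n6 0); rewrite !mulrDl; nra.
rewrite espD esp_cst espZ esp_sum.
have : n ^+ 6 * (\sum_(v in M) esp p (fun x => D v x ^+ 2)) <= m * ('C(j, 2)%:R * n ^+ (2 * j) * n).
  rewrite mulr_sumr [leRHS]mulr_natl -[leRHS]sumr_const; apply: ler_sum => v vM.
  by rewrite mulrC h2.
move=> h3; have := ler_wpM2l (ler0n R #|M|) h3; lra.
Qed.

(** [char_bound] on the edges between [P] and [A]. For fixed [a], the coefficients are a combination
    of the neighbourhood vectors of the [v] in [M], and [gram_lower] bounds their square sum below
    by that of the weights [zeta * pkappa]. *)
Lemma cross_char (A0 : {set V}) (h : {ffun E -> bool} -> R) (theta a0 c eta k0 Z : R) (k : nat) :
  P \subset A0 -> A \subset A0 -> indep (eset en A0) h ->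
  0 <= theta -> theta * (m * n ^+ (j - 2)) <= pi ->
  0 <= a0 -> 0 <= eta -> 0 <= c - eta * m ->
  {in M, forall v, c + a0 - eta <= \sum_(b in A) (b \in nbr ed z v)%:R ^+ 2 :> R} ->
  {in M &, forall v v', v != v' ->
    `|\sum_(b in A) (b \in nbr ed z v)%:R * (b \in nbr ed z v')%:R - a0| <= eta} ->
  0 <= k0 -> {in M, forall v, k0 <= pkappa v} ->
  Z <= \sum_(a in P) \sum_(v in M) zeta ed a y y' v ^+ 2 ->
  `|esp p (fun x => cos (h (reveal en ed M P z y x) - h (reveal en ed M P z y' x) +
      theta * cross_dif en ed M P N z j y y' x))| <=
  (2 ^ k.+1)%:R * (1 + (2 * (theta * (n ^+ j.+1 + n ^+ j.+1)) + 4 * (#|P| * #|A|)%:R)) ^+ (2 ^ k.+1) *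
    expR (- (crho p * (theta ^+ 2 * (k0 ^+ 2 * (c - eta * m)) * Z - 16 * ('C(j.+1, 2) * 2 ^ k.+1)%:R))) +
  hcst p 'C(j.+1, 2) k *
    ((#|P| * #|A|)%:R * (theta ^+ 2 * (2 * m ^+ 2 * n ^+ (2 * j) * ('C(j, 2)%:R * n + #|Q|%:R ^+ 2) / n ^+ 6))) ^+ (2 ^ k).
Proof.
move=> PA AA ih t0 tpi a00 eta0 ceta gd go k00 kge Zle; have [ei ce edE] := es.
set cd := cross_dif en ed M P N z j y y'.
have d0 : (0 < 'C(j.+1, 2))%N by rewrite bin_gt0 leqW.
have jc : juntas 'C(j.+1, 2) (theta * (n ^+ j.+1 + n ^+ j.+1)) (fun x => theta * cd x).
  apply: juntasZ => //; rewrite /cd /cross_dif /reveal.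
  have jN := @juntas_cliques R V E en ei ce ed edE N j.+1.
  have jr u := juntas_merge (cross ed M P) u (juntas_merge (touch en ed M P) z jN).
  exact: juntasD (jr y) (juntasN (jr y')).
have inj : {in finset.setX P A &, injective (fun u : V * V => ed u.1 u.2)}.
  move=> [a b] [a' b']; rewrite !finset.inE /= => /andP[aP bA] /andP[a'P b'A].
  move=> /(ed_eq edE (PA_neq aP bA) (PA_neq a'P b'A))[[-> ->//]|[ab' _]].
  by have := PA_neq aP b'A; rewrite ab' eqxx.
pose B := cross ed P A.
have sumB (f : E -> R) : \sum_(e in B) f e = \sum_(a in P) \sum_(b in A) f (ed a b).
  rewrite /B /cross big_imset//= pair_big_dep /=; apply: eq_bigl => u.
  by rewrite finset.inE.
(* Coefficients must be indexed by edges. An edge comes from a single pair in [P] and [A], so the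
   sum has one term. *)
pose co e : R := theta * \sum_(u in finset.setX P A | ed u.1 u.2 == e) cross_coef u.1 u.2.
have coE a b : a \in P -> b \in A -> co (ed a b) = theta * cross_coef a b.
  move=> aP bA; congr (_ * _); rewrite (big_pred1 (a, b))// => u.
  apply/andP/eqP => [[uX /eqP ue]|->]; last by rewrite finset.inE /= aP bA eqxx.
  by apply: inj => //; rewrite finset.inE /= aP bA.
have coef_le a b : a \in P -> b \in A -> `|co (ed a b)| <= pi.
  move=> aP bA; rewrite coE// normrM ger0_norm// (le_trans _ tpi)// ler_wpM2l//.
  rewrite (le_trans (ler_norm_sum _ _ _))// mulr_natl -sumr_const; apply: ler_sum => v vM.
  have pk0 : 0 <= pkappa v by exact: kappa_ge0.
  have pk1 : pkappa v <= n ^+ (j - 2).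
    by apply: kappa_le => //; rewrite -(card_priv v aP) max_card.
  rewrite 2!normrM (ger0_norm pk0).
  have b1 : `|(b \in nbr ed z v)%:R : R| <= 1 by case: (_ \in _); rewrite /= ?normr0 ?normr1.
  apply: (@le_trans _ _ (1 * pkappa v * 1)); last by rewrite mul1r mulr1.
  apply: ler_pM => //; first by apply: mulr_ge0.
  by apply: ler_wpM2r.
have aB : {in B, forall e, `|co e| <= pi}.
  move=> e /imsetP[[a b]]; rewrite finset.inE /= => /andP[aP bA] ->; exact: coef_le.
have cB : #|B| = (#|P| * #|A|)%N by rewrite /B /cross card_in_imset// cardsX.
have sB : \sum_(e in B) `|co e| <= 4 * (#|P| * #|A|)%:R.
  rewrite -cB mulr_natr -sumr_const; apply: ler_sum => e eB.
  by rewrite (le_trans (aB e eB))// pi_le4.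
have BA0 : B \subset eset en A0.
  apply/fintype.subsetP => e /imsetP[[a b]]; rewrite finset.inE /= => /andP[aP bA] ->.
  by rewrite finset.inE (sub_ed edE) ?PA_neq// (fintype.subsetP PA a aP) (fintype.subsetP AA b bA).
have ih' : indep B (fun x => h (reveal en ed M P z y x) - h (reveal en ed M P z y' x)).
  have ihB := indepS BA0 ih.
  have ir u := merge_indep (cross ed M P) u (merge_indep (touch en ed M P) z ihB).
  exact: indepD (ir y) (indepN (ir y')).
have := char_bound hp k d0 jc ih' aB sB; rewrite -/cd addrA => /le_trans; apply.
have r0 := crho_gt0 hp.
apply: lerD.
  rewrite ler_wpM2l//.
    rewrite mulr_ge0// exprn_ge0// !addr_ge0// ?mulr_ge0// ?addr_ge0// ?exprn_ge0//.
  rewrite ler_expR lerN2 ler_pM2l// lerD2r sumB.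
  apply: (@le_trans _ _ (theta ^+ 2 * (k0 ^+ 2 * (c - eta * m)) *
     \sum_(a in P) \sum_(v in M) zeta ed a y y' v ^+ 2)).
    by rewrite ler_wpM2l// !mulr_ge0 ?sqr_ge0.
  rewrite mulr_sumr; apply: ler_sum => a aP.
  have -> : \sum_(b in A) co (ed a b) ^+ 2 = theta ^+ 2 * \sum_(b in A) cross_coef a b ^+ 2.
    by rewrite mulr_sumr; apply: eq_bigr => b bA; rewrite coE// exprMn.
  rewrite -mulrA ler_wpM2l ?sqr_ge0//.
  have := gram_lower (fun v => zeta ed a y y' v * pkappa v) a00 gd go eta0.
  move=> /(le_trans _); apply; rewrite mulrAC [leRHS]mulrC ler_wpM2r//.
  rewrite mulr_sumr; apply: ler_sum => v vM; rewrite exprMn mulrC ler_wpM2l ?sqr_ge0//.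
  by rewrite lerXn2r ?nnegrE ?(le_trans k00)// kge.
rewrite ler_wpM2l ?(ltW (hcst_gt0 hp _ _))// lerXn2r ?nnegrE//.
- by apply: sumr_ge0 => e _; apply: (esp_ge0 hp) => x; exact: sqr_ge0.
- by rewrite !mulr_ge0 ?invr_ge0 ?sqr_ge0 ?exprn_ge0// ?addr_ge0 ?mulr_ge0 ?sqr_ge0.
rewrite sumB natrM -mulrA [leRHS]mulr_natl -sumr_const; apply: ler_sum => a aP.
rewrite mulr_natl -sumr_const; apply: ler_sum => b bA.
have -> : esp p (fun x => (dif (ed a b) (fun x0 => theta * cd x0) x - co (ed a b)) ^+ 2) =
    theta ^+ 2 * esp p (fun x => (dif (ed a b) cd x - cross_coef a b) ^+ 2).
  by rewrite -espZ; apply: eq_esp => x; rewrite coE// /dif; ring.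
rewrite ler_wpM2l ?sqr_ge0// ler_pdivlMr ?exprn_gt0 ?(n_gt0 aP)//.
exact: cross_coef_error.
Qed.

End CrossChar.

(** * Codegrees of the vertices of a small set *)

Section Codegree.
Context {R : realType} {p : R} {V E : finType} {en : E -> {set V}} {ed : V -> V -> E}.
Hypothesis hp : 0 < p < 1.
Hypothesis es : edge_system en ed.
Context {M A : {set V}}.
Hypothesis AM : [disjoint A & M]%bool.
Implicit Types (z : {ffun E -> bool}).

(** The number of common neighbours of [v] and [v'] in [A]; at [v = v'], the degree of [v] into
    [A]. *)
Definition codeg z v v' : R :=
  \sum_(b in A) (b \in nbr ed z v)%:R * (b \in nbr ed z v')%:R.

Definition mcodeg (v v' : V) : R := (if v == v' then p else p ^+ 2) * #|A|%:R.

Let neq v b : v \in M -> b \in A -> v != b.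
Proof. by move=> vM bA; apply: contraTneq vM => ->; rewrite (disjointFr AM bA). Qed.

Lemma esp_codeg v v' : v \in M -> v' \in M ->
  esp p (fun z => codeg z v v') = mcodeg v v'.
Proof.
move=> vM v'M; have [ei ce edE] := es.
rewrite /codeg esp_sum /mcodeg mulr_natr -sumr_const; apply: eq_bigr => b bA.
have nE z w : w \in M -> (b \in nbr ed z w) = z (ed w b).
  by move=> wM; rewrite finset.inE neq.
under eq_esp do rewrite !nE//.
have e1 w : esp p (fun z : {ffun E -> bool} => (z (ed w b))%:R) = p.
  by rewrite (esp_coord (ed w b) (fun b => b%:R)) /=; ring.
case: eqVneq => [<-|vv].
  rewrite -[RHS](e1 v); apply: eq_esp => z; case: (z _); rewrite /= ?mulr1 ?mulr0//.
rewrite (esp_coordM (e := ed v b) (fun b => b%:R) (G := fun z => (z (ed v' b))%:R)).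
  by rewrite e1 /=; ring.
move=> z z' zz; rewrite zz// finset.in_set1; apply/negP => /eqP.
move=> /(ed_eq edE (neq v'M bA) (neq vM bA))[[v'v _]|[v'b _]].
  by rewrite v'v eqxx in vv.
by have := neq v'M bA; rewrite v'b eqxx.
Qed.

Lemma codeg_tail k (lam : R) v v' : v \in M -> v' \in M -> 0 < lam ->
  esp p (fun z => (lam <= `|codeg z v v' - mcodeg v v'|)%R%:R) <=
  hcst p 2 k * (2 * #|A|%:R / lam ^+ 2) ^+ (2 ^ k).
Proof.
move=> vM v'M l0; have [ei ce edE] := es.
rewrite -(esp_codeg vM v'M).
apply: (disjoint_sum_tail hp (G := fun b z => (b \in nbr ed z v)%:R * (b \in nbr ed z v')%:R)
  (S := fun b => [set ed v b; ed v' b]%SET)) => //.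
- move=> b b' bA b'A bb; apply/setP => e; rewrite !finset.inE; apply/negbTE/negP.
  have h w w' : w \in M -> w' \in M -> ed w b = ed w' b' -> False.
    move=> wM w'M /(ed_eq edE (neq wM bA) (neq w'M b'A))[[_ /eqP]|[wb _]].
      by rewrite (negPf bb).
    by have := neq wM b'A; rewrite wb eqxx.
  by move=> /andP[/orP[] /eqP -> /orP[] /eqP]; exact: h.
- by move=> b; rewrite cards2; case: (_ != _).
- move=> b z z' zz.
  by rewrite !finset.inE !zz ?finset.inE ?negbK ?eqxx ?orbT.
- move=> b z; case: (_ \in _); case: (_ \in _);
  by rewrite /= ?mulr0 ?mul0r ?mulr1 lexx ler01.
Qed.

Definition bad_codeg (lam : R) z : bool :=
  [exists u : V * V, (u \in finset.setX M M) &&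
    (lam <= `|codeg z u.1 u.2 - mcodeg u.1 u.2|)].

Lemma bad_codeg_tail k (lam : R) : 0 < lam ->
  esp p (fun z => (bad_codeg lam z)%:R) <=
  #|M|%:R ^+ 2 * (hcst p 2 k * (2 * #|A|%:R / lam ^+ 2) ^+ (2 ^ k)).
Proof.
move=> l0; apply: (@le_trans _ _ (esp p (fun z => \sum_(u in finset.setX M M)
    (lam <= `|codeg z u.1 u.2 - mcodeg u.1 u.2|)%R%:R))).
  apply: (le_esp hp) => z; rewrite /bad_codeg; case: existsP => [[u /andP[uM hu]]|_] /=.
    by rewrite (bigD1 u)//= hu lerDl; apply: sumr_ge0.
  by apply: sumr_ge0.
rewrite esp_sum -natrX mulr_natl -mulnn -cardsX -sumr_const; apply: ler_sum => -[v v'].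
by rewrite finset.inE /= => /andP[vM v'M]; exact: codeg_tail.
Qed.

End Codegree.

Arguments codeg {R V E} ed A z v v'.
Arguments mcodeg {R} p {V} A v v'.
Arguments bad_codeg {R} p {V E} ed M A lam z.

(** * Balance of signal and noise in the intermediate range *)

Section CrossNumerics.
Context {R : realType}.
Implicit Types (y u n m s al q c k T Q C : R).

(** The sizes [y ^+ 13] of [M] and [u], that is n / y^10, of [P] come from here: as [T * n * k] may
    be as small as 1/y, the square sum is of order y^(-2) m u / n, and this has to reach y. *)
Lemma cross_signal y u n m s al q c (c2 : R) k T :
  0 < y -> 0 < u -> n = u * y ^+ 10 -> y ^+ 13 / 2 <= m -> u / 2 <= s -> 0 < c ->
  c * n / 2 <= al -> 0 < c2 -> 0 < q -> 0 <= k -> y^-1 <= T * n * k ->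
  c2 ^+ 2 * q ^+ 2 * c / 64 * y <= T ^+ 2 * ((c2 * k) ^+ 2 * (q * al / 2)) * (q * (m * s) / 4).
Proof.
move=> y0 u0 nE hm hs c0 ha c20 q0 k0 hT.
have n0 : 0 < n by rewrite nE mulr_gt0 ?exprn_gt0.
have h1 : c * n / 2 * (y ^+ 13 / 2 * (u / 2)) <= al * (m * s).
  by rewrite !ler_pM ?mulr_ge0 ?invr_ge0 ?exprn_ge0 ?(ltW y0) ?(ltW u0) ?(ltW n0) ?(ltW c0).
have h2 : (y^-1) ^+ 2 <= (T * n * k) ^+ 2.
  by rewrite lerXn2r ?nnegrE ?invr_ge0 ?(ltW y0)// (le_trans _ hT)// invr_ge0 ltW.
have -> : T ^+ 2 * ((c2 * k) ^+ 2 * (q * al / 2)) * (q * (m * s) / 4) =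
    (T * n * k) ^+ 2 * (al * (m * s)) * (c2 ^+ 2 * q ^+ 2 / (8 * n ^+ 2)).
  by field; rewrite gt_eqF.
have -> : c2 ^+ 2 * q ^+ 2 * c / 64 * y = (y^-1) ^+ 2 * (c * n / 2 * (y ^+ 13 / 2 * (u / 2))) *
    (c2 ^+ 2 * q ^+ 2 / (8 * n ^+ 2)).
  by rewrite nE; field; rewrite !gt_eqF.
have q2 : 0 <= c2 ^+ 2 * q ^+ 2 / (8 * n ^+ 2).
  by apply: divr_ge0; apply: mulr_ge0 => //; exact: sqr_ge0.
rewrite ler_wpM2r//; apply: ler_pM => //; first exact: sqr_ge0.
by rewrite !mulr_ge0 ?invr_ge0 ?exprn_ge0 ?(ltW y0) ?(ltW u0) ?(ltW n0) ?(ltW c0).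
Qed.

(** Here [T * n * k] may be as large as y, and the noise is of order y^2 m^2 u (n + u^2) / n^3. Its
    two terms are y^8 / u and y^(-2), so [u >= y ^+ 9] is enough; [P] is taken as small as n / y^10
    for the second one. *)
Lemma cross_noise y u n m s al C Q T k :
  1 <= y -> y ^+ 9 <= u -> n = u * y ^+ 10 -> 0 <= m <= y ^+ 13 -> 0 <= s <= u ->
  0 <= al <= n -> 0 <= C -> 0 <= Q <= 2 * u -> 0 <= T -> 0 <= k -> T * n * k <= y ->
  s * al * (T ^+ 2 * (2 * m ^+ 2 * (k * n ^+ 2) ^+ 2 * (C * n + Q ^+ 2) / n ^+ 6)) <=
  (2 * C + 8) / y.
Proof.
move=> y1 yu nE /andP[m0 m1] /andP[s0 s1] /andP[a0 a1] C0 /andP[Q0 Q1] T0 k0 hT.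
have y0 : 0 < y by lra.
have u0 : 0 < u by rewrite (lt_le_trans _ yu)// exprn_gt0.
have n0 : 0 < n by rewrite nE mulr_gt0 ?exprn_gt0.
have -> : s * al * (T ^+ 2 * (2 * m ^+ 2 * (k * n ^+ 2) ^+ 2 * (C * n + Q ^+ 2) / n ^+ 6)) =
    2 / n ^+ 4 * ((s * al) * ((T * n * k) ^+ 2 * (m ^+ 2 * (C * n + Q ^+ 2)))).
  by field; rewrite gt_eqF.
apply: (@le_trans _ _ (2 / n ^+ 4 * ((u * n) * (y ^+ 2 * ((y ^+ 13) ^+ 2 * (C * n + (2 * u) ^+ 2)))))).
  have Tn : 0 <= T * n * k by rewrite !mulr_ge0// ltW.
  have y13 : 0 <= y ^+ 13 by rewrite exprn_ge0// ltW.
  have Cn : 0 <= C * n by rewrite mulr_ge0// ltW.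
  have h1 : (T * n * k) ^+ 2 <= y ^+ 2 by rewrite lerXn2r ?nnegrE ?(ltW y0).
  have h2 : m ^+ 2 <= (y ^+ 13) ^+ 2 by rewrite lerXn2r ?nnegrE.
  have h3 : Q ^+ 2 <= (2 * u) ^+ 2 by rewrite lerXn2r ?nnegrE// (le_trans Q0).
  have h4 : C * n + Q ^+ 2 <= C * n + (2 * u) ^+ 2 by rewrite lerD2l.
  have p1 : 0 <= C * n + Q ^+ 2 by rewrite addr_ge0 ?sqr_ge0.
  have p2 : 0 <= m ^+ 2 * (C * n + Q ^+ 2) := mulr_ge0 (sqr_ge0 _) p1.
  apply: ler_wpM2l; first by rewrite divr_ge0// exprn_ge0// ltW.
  apply: ler_pM; [exact: mulr_ge0| exact: mulr_ge0 (sqr_ge0 _) p2| exact: ler_pM|].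
  apply: ler_pM; [exact: sqr_ge0| exact: p2| exact: h1|].
  by apply: ler_pM => //; exact: sqr_ge0.
have -> : 2 / n ^+ 4 * ((u * n) * (y ^+ 2 * ((y ^+ 13) ^+ 2 * (C * n + (2 * u) ^+ 2)))) =
    2 * C * (y ^+ 8 / u) + 8 / y ^+ 2.
  by rewrite nE; field; rewrite !gt_eqF.
have h5 : y ^+ 8 / u <= 1 / y.
  by rewrite ler_pdivrMr// mul1r mulrC ler_pdivlMr// -exprSr.
have h6 : 8 / y ^+ 2 <= 8 * (1 / y).
  rewrite mul1r ler_wpM2l// lef_pV2 ?posrE ?exprn_gt0//.
  by rewrite -[leLHS]expr1 ler_weXn2l.
have := ler_wpM2l (mulr_ge0 (ler0n R 2) C0) h5; lra.
Qed.

End CrossNumerics.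

Section CrossStep.
Context {R : realType} (p : R).
Hypothesis hp : 0 < p < 1.

Lemma cross_pairs (V E : finType) (en : E -> {set V}) (ed : V -> V -> E) (M P : {set V})
    (y y' : {ffun E -> bool}) : edge_system en ed -> [disjoint M & P]%bool ->
  #|cross ed M P| = (#|M| * #|P|)%N /\
  \sum_(e in cross ed M P) (y e && ~~ y' e)%:R <=
  \sum_(a in P) \sum_(v in M) zeta ed a y y' v ^+ 2 :> R.
Proof.
move=> [ei ce edE] MP.
have neq u : u \in finset.setX M P -> u.1 != u.2.
  rewrite finset.inE => /andP[uM uP]; apply: contraTneq uM => ->.
  by rewrite (disjointFl MP uP).
have inj : {in finset.setX M P &, injective (fun u : V * V => ed u.1 u.2)}.
  move=> u u' uX uX' /(ed_eq edE (neq _ uX) (neq _ uX'))[[]|[uu _]].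
    by case: u {uX} => ? ?; case: u' {uX'} => ? ? /= -> ->.
  move: uX uX'; rewrite !finset.inE uu => /andP[uM _] /andP[_ uP].
  by rewrite (disjointFl MP uP) in uM.
split; first by rewrite /cross card_in_imset// cardsX.
rewrite /cross big_imset//= exchange_big pair_big_dep /=.
rewrite (eq_bigl (fun u => (u.1 \in M) && (u.2 \in P))); last by move=> u; rewrite finset.inE.
apply: ler_sum => u _; rewrite /zeta.
by case: (y _); case: (y' _); rewrite /= ?subrr ?subr0 ?sub0r ?sqrrN ?expr1n ?expr0n.
Qed.

Lemma pick_cross (V : finType) (A : {set V}) (c y u : R) :
  0 < c -> #|V|%:R = u * y ^+ 10 -> 2 <= y -> 8 / c <= y -> y ^+ 17 <= u ->
  c * #|V|%:R <= #|A|%:R ->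
  exists M P : {set V}, [/\ M \subset A, P \subset A, [disjoint M & P]%bool,
    (y ^+ 13 / 2 <= #|M|%:R <= y ^+ 13) && (u / 2 <= #|P|%:R <= u) &
    (#|M :|: P|%:R <= 2 * u) && (c * #|V|%:R / 2 <= #|A :\: (M :|: P)|%:R)].
Proof.
move=> c0 nE y2 cy yu cA; set n : R := #|V|%:R in nE cA *.
have y0 : 0 < y by lra.
have y1 : 1 <= y by lra.
have u0 : 0 < u by rewrite (lt_le_trans _ yu)// exprn_gt0.
have yle (i i' : nat) : (i <= i')%N -> y ^+ i <= y ^+ i' by move=> ii; rewrite ler_weXn2l.
have y13 : 2 <= y ^+ 13 by rewrite (le_trans y2)// -[leLHS]expr1 yle.
have u2 : 2 <= u by rewrite (le_trans _ yu)// (le_trans y2)// -[leLHS]expr1 yle.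
(* [M] and [P] together take at most [2 * u], so at least half of [c * n] is left in [A]. *)
have un : u <= c * n / 8.
  rewrite nE -[leLHS]mulr1 [leRHS](_ : _ = u * (c / 8 * y ^+ 10)); last by ring.
  rewrite ler_wpM2l ?(ltW u0)// (le_trans (_ : 1 <= c / 8 * y))//.
    by rewrite -ler_pdivrMl ?divr_gt0// mulr1 invf_div.
  by rewrite ler_wpM2l ?divr_ge0 ?(ltW c0)// -[leLHS]expr1 yle.
have yu13 : y ^+ 13 <= u by rewrite (le_trans _ yu)// yle.
have [m /andP[m1 m2]] := nat_floor (exprn_ge0 13 (ltW y0)).
have [s /andP[s1 s2]] := nat_floor (ltW u0).
have mA : (m <= #|A|)%N by rewrite -(ler_nat R); lra.
have [M MA cM] := pick_subset mA.
have cAM : #|A :\: M|%:R = #|A|%:R - m%:R :> R.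
  by rewrite cardsDS// cM natrB// -cM.
have sA : (s <= #|A :\: M|)%N by rewrite -(ler_nat R) cAM; lra.
have [P PA cP] := pick_subset sA.
have PA' : P \subset A by rewrite (fintype.subset_trans PA)// finset.subsetDl.
have MP : [disjoint M & P]%bool.
  rewrite disjoint_sym finset.disjoints_subset; apply/fintype.subsetP => x.
  by move=> /(fintype.subsetP PA); rewrite !finset.inE => /andP[].
have cQ : #|M :|: P|%:R <= 2 * u.
  by rewrite (le_trans (_ : _ <= m%:R + s%:R))// ?[m%:R + _]/1; [rewrite -natrD ler_nat cardsU cM cP leq_subr|lra].
exists M, P; split => //; rewrite ?cM ?cP.
  by apply/andP; split; apply/andP; split; lra.
rewrite cQ cardsDS ?finset.subUset ?MA//= natrB; last first.
  by rewrite subset_leq_card// finset.subUset MA.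
lra.
Qed.

(* After decoupling the edges between [M] and [P], the derivative along an edge [ab]
   with [a] in [P] is, up to small errors, a signed sum over the [v] in [M] adjacent to [b];
   the almost orthogonality of the neighbourhoods of the [v] bounds the sum of the
   squares of these derivatives from below. *)
Lemma phase_decay_cross (L j : nat) (c : R) (K : nat) : (30 <= L)%N -> (2 <= j)%N -> 0 < c ->
  \forall y \near +oo,
  forall (V E : finType) (en : E -> {set V}) (ed : V -> V -> E),
  edge_system en ed -> #|V|%:R = y ^+ L ->
  forall (A N : {set V}) (h : {ffun E -> bool} -> R) (theta : R),
  A \subset N -> c * #|V|%:R <= #|A|%:R -> indep (eset en A) h ->
  (y * #|V|%:R ^+ (j - 1))^-1 <= theta <= y / #|V|%:R ^+ (j - 1) ->
  `|esp p (fun x => cos (h x + theta * cliques en N j.+1 x))| <= (y ^+ K)^-1.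
Proof.
move=> L30 j2 c0.
have j1 : (j - 1 = (j - 2).+1)%N by clear -L30 j2; lia.
have jE : (2 * j = (j - 2) * 2 + 2 * 2)%N by clear -L30 j2; lia.
have jS : (j.+1 = (j - 1) + 2)%N by clear -L30 j2; lia.
have LE : (L = (L - 10) + 10)%N by clear -L30 j2; lia.
have L17 : (20 <= L - 10)%N by clear -L30 j2; lia.
have /andP[p0 p1] := hp.
have q0 := pq_gt0 hp; set q := p * (1 - p) in q0.
have qp : q <= p by rewrite /q; nra.
have pc : 0 < p * c / 4 by rewrite divr_gt0// mulr_gt0.
have [c2 c20 kge0] := kappa_lower hp pc j2.
(* Two losses: one factor [y] when exceptional [z] are discarded, then the squaring by the doubling
   with two contributions, hence [2 * K.+1 + 1]. *)
pose K1 := (2 * K.+1 + 1)%N.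
have s0 : 0 < c2 ^+ 2 * q ^+ 2 * c / 64.
  by apply: divr_gt0 => //; apply: mulr_gt0 => //; apply: mulr_gt0; exact: exprn_gt0.
have C10 : 0 <= 8 :> R by [].
have C20 : 0 <= 2 * 'C(j, 2)%:R + 8 :> R by rewrite addr_ge0// mulr_ge0.
have D10 : 0 <= 32 / q ^+ 2 by rewrite divr_ge0// sqr_ge0.
have D20 : 0 <= 16 / (q ^+ 2 * c) by rewrite divr_ge0// mulr_ge0 ?sqr_ge0 ?ltW.
near=> y => V E en ed es nE A N h theta AN cA ih /andP[t1 t2].
have y2 : 2 <= y by near: y; exact: near_ge.
have cy : 8 / c <= y by near: y; exact: near_ge.
have jy : (p * c / 4)^-1 * (2 * j%:R) <= y by near: y; exact: near_ge.
have key : forall X S2 W : R, 0 <= X <= 8 * y ^+ (3 * L) -> c2 ^+ 2 * q ^+ 2 * c / 64 * y <= S2 ->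
    0 <= W <= (2 * 'C(j, 2)%:R + 8) / y ->
    (2 ^ K1.+2)%:R * (1 + X) ^+ (2 ^ K1.+2) *
    expR (- (crho p * (S2 - 16 * ('C(j.+1, 2) * 2 ^ K1.+2)%:R))) +
    hcst p 'C(j.+1, 2) K1.+1 * W ^+ (2 ^ K1.+1) <= (y ^+ K1)^-1.
  by near: y; exact: (near_small_terms hp _ _ _ s0 C10 C20).
have key1 : forall W : R, 0 <= W <= 32 / q ^+ 2 / y ->
  y ^+ 0 * (2 * hcst p 1 (K1 + 0).+1 * W ^+ (2 ^ (K1 + 0).+1)) <= (y ^+ K1)^-1.
  by near: y; exact: near_tail (ler0n R 2) D10.
have key2 : forall W : R, 0 <= W <= 16 / (q ^+ 2 * c) / y ->
  y ^+ 26 * (1 * hcst p 2 (K.+1 + 26).+1 * W ^+ (2 ^ (K.+1 + 26).+1)) <= (y ^+ K.+1)^-1.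
  by near: y; exact: near_tail ler01 D20.
pose u := y ^+ (L - 10); have y0 : 0 < y by lra.
have y1 : 1 <= y by lra.
have yle (i i' : nat) : (i <= i')%N -> y ^+ i <= y ^+ i' by move=> ii; rewrite ler_weXn2l.
have nu : #|V|%:R = u * y ^+ 10 by rewrite nE /u -exprD -LE.
have u0 : 0 < u by rewrite exprn_gt0.
have u17 : y ^+ 17 <= u by rewrite yle// (leq_trans _ L17).
have [M [P [MA PA MP /andP[/andP[m1 m2] /andP[v1 v2]] /andP[Q2 a1]]]] :=
  pick_cross c0 nu y2 cy u17 cA.
set A' := A :\: (M :|: P) in a1.
have AQ : [disjoint A' & M :|: P]%bool.
  by rewrite finset.disjoints_subset; apply/fintype.subsetP => x; rewrite !finset.inE => /andP[].
have A'A : A' \subset A by exact: finset.subsetDl.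
have AM : [disjoint A' & M]%bool.
  by apply: disjointWr AQ; rewrite finset.subsetUl.
have MN := fintype.subset_trans MA AN; have PN := fintype.subset_trans PA AN.
have A'N := fintype.subset_trans A'A AN.
set n : R := #|V|%:R in nE nu t1 t2 cA a1.
set m : R := #|M|%:R in m1 m2; set s : R := #|P|%:R in v1 v2.
set al : R := #|A'|%:R in a1.
have n0 : 0 < n by rewrite nE exprn_gt0.
have al1 : al <= n by rewrite ler_nat max_card.
have al0 : 0 < al by rewrite (lt_le_trans _ a1)// divr_gt0// mulr_gt0.
have m0 : 0 < m by rewrite (lt_le_trans _ m1)// divr_gt0// exprn_gt0.
have m01 : 1 <= m by rewrite ler1n -(ltr0n R).
have s00 : 0 < s by rewrite (lt_le_trans _ v1)// divr_gt0.
(* The largest codegree error for which [gram_lower] keeps half of the gap [q * al]. *)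
pose eta := q * al / (2 * m).
have eta0 : 0 < eta by rewrite divr_gt0// mulr_gt0.
have etam : eta * m = q * al / 2 by rewrite /eta; field; rewrite gt_eqF.
have qaE : q * al - eta * m = q * al / 2 by rewrite etam {1}(splitr (q * al)) addrK.
(* The mean degree [p * al] exceeds the mean codegree [p ^+ 2 * al] by [q * al]: the codegree is the
   rank-one part in [gram_lower], the difference is the gap. *)
have qpE : q * al + p ^+ 2 * al = p * al by rewrite /q; ring.
have etal : eta <= q * al / 2 by rewrite -etam ler_peMr// ltW.
have nj : 0 < n ^+ (j - 2) by rewrite exprn_gt0.
have nj1 : n ^+ (j - 1) = n * n ^+ (j - 2) by rewrite j1 exprS.
have th0 : 0 <= theta.
  by rewrite (le_trans _ t1)// invr_ge0 mulr_ge0 ?exprn_ge0 ?(ltW y0) ?(ltW n0).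
have T1 : y^-1 <= theta * n * n ^+ (j - 2).
  rewrite -mulrA -nj1 -ler_pdivrMr ?exprn_gt0//.
  by rewrite -invfM.
have T2 : theta * n * n ^+ (j - 2) <= y.
  by rewrite -mulrA -nj1 -ler_pdivlMr ?exprn_gt0.
have y14n : y ^+ 14 <= n by rewrite nE yle// (leq_trans _ L30).
have n1 : 1 <= n by rewrite (le_trans y1)// (le_trans _ y14n)// -[leLHS]expr1 yle.
(* Each coefficient is a sum over [M] of terms at most [theta] times n^(j-2). As [theta] times
   n^(j-1) is at most [y], the small size of [M] keeps it below [pi]. *)
have tpi : theta * (m * n ^+ (j - 2)) <= pi.
  apply: (@le_trans _ _ 1); last by rewrite (le_trans _ (pi_ge2 R))// ler1n.
  apply: (@le_trans _ _ (y * y ^+ 13 / n)); last by rewrite -exprS ler_pdivrMr// mul1r.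
  rewrite ler_pdivlMr// [leLHS](_ : _ = theta * n * n ^+ (j - 2) * m); last by ring.
  by rewrite ler_pM ?mulr_ge0 ?(ltW n0) ?(ltW nj) ?(ltW m0).
pose F x : R := h x + theta * cliques en N j.+1 x.
(* The edges at [M] outside the cross are revealed before the doubling, so that the codegrees into
   [A'] are already fixed when it takes place. *)
pose Fz z x : R := F (merge (touch en ed M P) z x).
have Fcos x : `|cos (F x)| <= 1 by rewrite ler_norml cos_geN1 cos_le1.
have yK1 : 0 < y ^+ K.+1 by rewrite exprn_gt0.
have good z : ~~ bad_codeg p ed M A' eta z ->
    `|esp p (fun x => cos (Fz z x))| <= (y ^+ K.+1)^-1.
  move=> /existsPn gz.
  have gc v v' : v \in M -> v' \in M -> `|codeg ed A' z v v' - mcodeg p A' v v'| < eta :> R.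
    move=> vM v'M; have := gz (v, v'); rewrite finset.inE /= vM v'M /=.
    by rewrite -ltNge.
  have gd v : v \in M -> p * al - eta <= codeg ed A' z v v :> R.
    move=> vM; have := gc v v vM vM; rewrite /mcodeg eqxx -/al.
    by rewrite ltr_norml => /andP[/ltW h1 _]; clear -h1; lra.
  have codegE v : codeg ed A' z v v = #|A' :&: nbr ed z v|%:R :> R.
    rewrite /codeg -sum1_card natr_sum [LHS]big_mkcond [RHS]big_mkcond /=.
    apply: eq_bigr => b _; rewrite finset.in_setI.
    by case: (b \in A') => //=; case: (b \in nbr _ _ _); rewrite ?mulr1 ?mulr0.
  have kge : {in M, forall v, c2 * n ^+ (j - 2) <= pkappa (p := p) (ed := ed) (M := M) (P := P) (N := N) (z := z) (j := j) v}.
    move=> v vM; have hc : p * c / 4 * n <= #|N :&: nbr ed z v :\: (M :|: P)|.+1%:R.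
      apply: (@le_trans _ _ (codeg ed A' z v v)).
        apply: le_trans (gd v vM).
        have h1 := ler_wpM2r (ltW al0) qp; have h3 := ler_wpM2l (ltW p0) a1.
        by clear -h1 h3 etal; lra.
      rewrite codegE ler_nat leqW// subset_leq_card//; apply/fintype.subsetP => b.
      rewrite !finset.inE => /andP[/andP[-> bA] ->].
      by rewrite andbT /= (fintype.subsetP AN).
    apply: kge0 => //; apply: le_trans hc.
    by rewrite -ler_pdivrMl// (le_trans jy)// (le_trans _ y14n)// -[leLHS]expr1 yle.
  apply: norm_le_of_sqr; first by rewrite invr_ge0 ltW.
  have := doubling hp (cross ed M P) (Fz z); move=> /le_trans; apply.
  have [cD _] := cross_pairs [ffun=> true] [ffun=> true] es MP.
  pose D := cross ed M P.
  pose bad y1 y2 : R := (\sum_(e in D) (y1 e && ~~ y2 e)%:R < q * #|D|%:R / 4)%R%:R.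
  apply: (@le_trans _ _ (esp p (fun y1 => esp p (fun y2 => bad y1 y2 + (y ^+ K1)^-1)))).
    apply: (le_esp hp) => z1; apply: (le_esp hp) => z2; rewrite /bad.
    case: ltP => [_|gp] /=.
      apply: (@le_trans _ _ 1); last by rewrite lerDl invr_ge0 exprn_ge0// ltW.
      by apply: (esp_abs_le hp) => x; rewrite ler_norml cos_geN1 cos_le1.
    rewrite add0r.
    have gZ : q * (m * s) / 4 <= \sum_(a in P) \sum_(v in M) zeta ed a z1 z2 v ^+ 2.
      have [_ hZ] := cross_pairs z1 z2 es MP; apply: le_trans hZ; apply: le_trans gp.
      by rewrite /D cD natrM.
    have -> : esp p (fun x => cos (Fz z (merge (cross ed M P) z1 x) - Fz z (merge (cross ed M P) z2 x))) =
      esp p (fun x => cos (h (reveal en ed M P z z1 x) - h (reveal en ed M P z z2 x) +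
      theta * cross_dif en ed M P N z j z1 z2 x)).
      by apply: eq_esp => x; congr cos; rewrite /Fz /F /cross_dif /reveal; ring.
    have q20 : 0 <= p ^+ 2 * al by rewrite mulr_ge0 ?sqr_ge0 ?(ltW al0).
    have ceta : 0 <= q * al - eta * m.
      by rewrite qaE divr_ge0// ltW// mulr_gt0.
    have k00 : 0 <= c2 * n ^+ (j - 2) by rewrite mulr_ge0 ?ltW.
    have gdiag : {in M, forall v, q * al + p ^+ 2 * al - eta <= \sum_(b in A') (b \in nbr ed z v)%:R ^+ 2}.
      by move=> v vM; rewrite qpE; exact: gd.
    have goff : {in M &, forall v v', v != v' ->
        `|\sum_(b in A') (b \in nbr ed z v)%:R * (b \in nbr ed z v')%:R - p ^+ 2 * al| <= eta}.
      move=> v v' vM v'M vv; have := gc v v' vM v'M.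
      by rewrite /mcodeg (negPf vv) => /ltW.
    have := cross_char hp es MP MN PN A'N AQ j2 K1.+1 PA A'A ih th0 tpi q20 (ltW eta0) ceta
      gdiag goff k00 kge gZ.
    move=> /le_trans; apply; apply: key.
    - have sal : (#|P| * #|A'|)%:R <= n ^+ 2.
        by rewrite natrM expr2 ler_pM// ler_nat max_card.
      have y1n : y <= n by rewrite (le_trans _ y14n)// -[leLHS]expr1 yle.
      have tn : theta * n ^+ j.+1 <= y * n ^+ 2.
        by rewrite jS exprD nj1 [leLHS]mulrA ler_wpM2r ?sqr_ge0// mulrA.
      have n3 : y * n ^+ 2 <= n ^+ 3 by rewrite exprS ler_wpM2r// sqr_ge0.
      have n23 : n ^+ 2 <= n ^+ 3 by rewrite ler_weXn2l.
      rewrite [(3 * L)%N]mulnC exprM -nE; apply/andP; split; last by clear -sal tn n3 n23; lra.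
      by rewrite addr_ge0// mulr_ge0// mulr_ge0// addr_ge0 ?exprn_ge0 ?(ltW n0).
    - rewrite -/m qaE.
      exact: (cross_signal y0 u0 nu m1 v1 c0 a1 c20 q0 (ltW nj) T1).
    - have := cross_noise (C := 'C(j, 2)%:R) (Q := #|M :|: P|%:R) (s := s) (m := m) (al := al)
        (T := theta) (k := n ^+ (j - 2)) y1 _ nu.
      have -> : n ^+ (2 * j) = (n ^+ (j - 2) * n ^+ 2) ^+ 2.
        by rewrite jE exprD !exprM -exprMn.
      rewrite natrM -/n -/s -/m -/al => -> //.
      + rewrite andbT !mulr_ge0 ?invr_ge0 ?sqr_ge0 ?exprn_ge0 ?(ltW n0) ?(ltW s00) ?(ltW al0)//.
        by rewrite addr_ge0 ?sqr_ge0// mulr_ge0 ?(ltW n0).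
      + by rewrite (le_trans _ u17)// yle.
      + by rewrite (ltW m0).
      + by rewrite (ltW s00).
      + by rewrite (ltW al0).
      + by rewrite ler0n.
      + exact: ltW.
  rewrite (eq_esp (G := fun y1 => esp p (bad y1) + (y ^+ K1)^-1)); last first.
    by move=> z1; rewrite espD esp_cst.
  rewrite espD esp_cst.
  have msE : #|D|%:R = m * s by rewrite /D cD natrM.
  have d0 : (0 < #|D|)%N by rewrite -(ltr0n R) msE mulr_gt0.
  have h1 : esp p (fun y1 => esp p (bad y1)) <= (y ^+ K1)^-1.
    have := pair_tail hp (K1 + 0).+1 d0; move=> /le_trans; apply.
    rewrite -[leLHS]mul1r; apply: key1; rewrite -/q msE.
    have q2 : 0 < q ^+ 2 by rewrite exprn_gt0.
    have ms0 : 0 < m * s by rewrite mulr_gt0.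
    rewrite divr_ge0 ?(ltW (mulr_gt0 q2 ms0))//=.
    have e8 : 8 = 32 / q ^+ 2 / y * (q ^+ 2 * (y / 4)) by field; rewrite !gt_eqF.
    rewrite ler_pdivrMr ?(mulr_gt0 q2 ms0)// {1}e8 ler_wpM2l ?(divr_ge0 D10 (ltW y0))// ler_wpM2l ?(ltW q2)//.
    have hy : y <= y ^+ 13 by rewrite -[leLHS]expr1 yle.
    have hu : 1 <= u by rewrite (le_trans _ u17)// (le_trans y1)// -[leLHS]expr1 yle.
    clear -hy hu m1 v1 y1; apply: (@le_trans _ _ (y / 2 * (1 / 2))); first by lra.
    by apply: ler_pM; lra.
  apply: (le_trans (lerD h1 (lexx _))).
  have -> : (y ^+ K.+1)^-1 ^+ 2 = (y ^+ (2 * K.+1))^-1 by rewrite exprVn -exprM mulnC.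
  rewrite -mulr2n -mulr_natr /K1 addn1 exprSr invfM -mulrA.
  rewrite ler_piMr ?invr_ge0 ?exprn_ge0 ?(ltW y0)//.
  by rewrite ler_pdivrMl// mulr1.
have -> : esp p (fun x => cos (h x + theta * cliques en N j.+1 x)) =
    esp p (fun z => esp p (fun x => cos (Fz z x))).
  rewrite -(esp_resample (touch en ed M P)) esp_exchange; apply: eq_esp => z.
  by [].
apply: (le_trans (ler_norm_esp hp _)).
apply: (@le_trans _ _ (esp p (fun z => (bad_codeg p ed M A' eta z)%:R + (y ^+ K.+1)^-1))).
  apply: (le_esp hp) => z; case: (boolP (bad_codeg _ _ _ _ _ _)) => [_|gz] /=.
    apply: (@le_trans _ _ 1); last by rewrite lerDl invr_ge0 ltW.
    by apply: (esp_abs_le hp) => x; exact: Fcos.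
  by rewrite add0r good.
rewrite espD esp_cst.
(* The tolerance [eta] is of order n / m, so the tail parameter is of order m^2 / n, at most y^26 /
   n; [L >= 30] brings it below 1/y up to a constant. The union bound over pairs in [M] costs the
   factor [y ^+ 26]. *)
have h2 : esp p (fun z => (bad_codeg p ed M A' eta z)%:R) <= (y ^+ K.+1)^-1.
  have := bad_codeg_tail hp es AM (K.+1 + 26).+1 eta0; move=> /le_trans; apply.
  rewrite -/m -/al; have HW : 0 <= 2 * al / eta ^+ 2 <= 16 / (q ^+ 2 * c) / y.
    rewrite divr_ge0 ?sqr_ge0 ?mulr_ge0 ?(ltW al0)//=.
    have -> : 2 * al / eta ^+ 2 = 8 / q ^+ 2 * (m ^+ 2 / al).
      by rewrite /eta; field; rewrite !gt_eqF.
    have -> : 16 / (q ^+ 2 * c) / y = 8 / q ^+ 2 * (2 / (c * y)).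
      by field; rewrite !gt_eqF.
    rewrite ler_wpM2l ?divr_ge0 ?sqr_ge0// ler_pdivrMr// mulrAC ler_pdivlMr ?mulr_gt0//.
    apply: (@le_trans _ _ (y ^+ 26 * (c * y))).
      rewrite ler_wpM2r ?mulr_ge0 ?(ltW c0) ?(ltW y0)//.
      have -> : y ^+ 26 = (y ^+ 13) ^+ 2 by rewrite -exprM.
      by rewrite lerXn2r ?nnegrE ?(ltW m0)// exprn_ge0// ltW.
    have y27 : y ^+ 26 * y <= n by rewrite -exprSr nE yle// (leq_trans _ L30).
    by have h1 := ler_wpM2l (ltW c0) y27; clear -h1 a1; lra.
  have hW0 : 0 <= 1 * hcst p 2 (K.+1 + 26).+1 * (2 * al / eta ^+ 2) ^+ (2 ^ (K.+1 + 26).+1).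
    have /andP[W0 _] := HW.
    by rewrite mul1r mulr_ge0 ?exprn_ge0// ltW// hcst_gt0.
  apply: le_trans (key2 _ HW); rewrite [in leRHS]mul1r; rewrite mul1r in hW0.
  rewrite ler_wpM2r//.
  have -> : y ^+ 26 = (y ^+ 13) ^+ 2 by rewrite -exprM.
  by rewrite lerXn2r ?nnegrE ?(ltW m0)// exprn_ge0// ltW.
apply: (le_trans (lerD h2 (lexx _))).
rewrite -mulr2n -mulr_natr exprSr invfM -mulrA.
rewrite ler_piMr ?invr_ge0 ?exprn_ge0 ?(ltW y0)//.
by rewrite ler_pdivrMl// mulr1.
Unshelve. all: by end_near. Qed.

End CrossStep.

(** From [j] to [j.+1] cliques, the angles are split where [theta] times n^(j-1) equals 1/y and y;
    only the upper range calls on the induction hypothesis. *)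
Lemma phase_decayP (R : realType) (p : R) (hp : 0 < p < 1) (L j : nat) :
  (30 <= L)%N -> (2 <= j)%N -> phase_decay p L j.
Proof.
move=> L30; have L2 : (2 <= L)%N by exact: leq_trans L30.
have L0 : (0 < L)%N by exact: leq_trans L30.
elim: j => // -[|[|j]] IH; rewrite ?ltnS// => j2 c K c0.
  apply: filterS (phase_decay_low hp K L2 (leqnn 2) c0).
  by move=> y low V E en ed es nE A N h theta AN cA ih tt; apply: (low V E en ed es nE A).
have {}IH := IH isT.
apply: filterS3 (phase_decay_low hp K L2 (isT : (2 <= j.+3)%N) c0)
  (phase_decay_cross hp (j := j.+2) K L30 isT c0) (phase_decay_star hp (j := j.+2) K L0 isT IH c0).
move=> y low crossd stard V E en ed es nE A N h theta AN cA ih tt.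
have /andP[t1 t2] := tt.
have [h1|h1] := leP theta (y * #|V|%:R ^+ (j.+2 - 1))^-1.
  by apply: (low V E en ed es nE A) => //; rewrite implybE h1 orbT.
have [h2|h2] := leP (y / #|V|%:R ^+ (j.+2 - 1)) theta.
  by apply: (stard V E en ed es nE A) => //; rewrite h2 t2.
by apply: (crossd V E en ed es nE A) => //; rewrite (ltW h1) (ltW h2).
Qed.

(** * The Gaussian integral *)

Section Comparison.
Context {R : realType}.
Implicit Types (F G f g : R -> R) (a b x : R).

(** Integrals are compared through primitives: [G + F] and [G - F] are nondecreasing. No
    integrability is involved. *)
Lemma derive_compare F G f g a b : a <= b ->
  (forall x, a <= x <= b -> is_derive x 1 F (f x)) ->
  (forall x, a <= x <= b -> is_derive x 1 G (g x)) ->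
  (forall x, a <= x <= b -> `|f x| <= g x) ->
  `|F b - F a| <= G b - G a.
Proof.
move=> ab dF dG fg.
have mono (H h : R -> R) : (forall x, a <= x <= b -> is_derive x 1 H (h x)) ->
    (forall x, a <= x <= b -> 0 <= h x) -> H a <= H b.
  move=> dH h0; have [| |c cab E] := @MVT_segment _ H h a b ab.
  - by move=> x /itvP xab; apply: dH; rewrite !(ltW, xab).
  - apply: continuous_in_subspaceT => x; rewrite inE/= in_itv/= => xab.
    by apply: differentiable_continuous; apply/derivable1_diffP; apply: ex_derive; exact: dH.
  - rewrite -subr_ge0 E mulr_ge0 ?subr_ge0//; apply: h0.
    by move: cab; rewrite in_itv.
rewrite ler_norml; apply/andP; split.
  have := mono (fun x => G x + F x) (fun x => g x + f x) _ _.
  have h1 : forall x, a <= x <= b -> is_derive x 1 (fun x => G x + F x) (g x + f x).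
    by move=> x xab; have d1 := dG x xab; have d2 := dF x xab; exact: is_deriveD.
  have h2 : forall x, a <= x <= b -> 0 <= g x + f x.
    by move=> x /fg; rewrite ler_norml => /andP[]; lra.
  move=> /(_ h1 h2); lra.
have := mono (fun x => G x - F x) (fun x => g x - f x) _ _.
have h1 : forall x, a <= x <= b -> is_derive x 1 (fun x => G x - F x) (g x - f x).
  by move=> x xab; have d1 := dG x xab; have d2 := dF x xab; exact: is_deriveB.
have h2 : forall x, a <= x <= b -> 0 <= g x - f x.
  by move=> x /fg; rewrite ler_norml => /andP[]; lra.
move=> /(_ h1 h2); lra.
Qed.

Lemma exists_primitive f : continuous f ->
  exists F : R -> R, [/\ forall x, 0 <= x -> is_derive x 1 F (f x), F 0 = 0 &
    forall x, 0 <= x ->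
      F x = (\int[@lebesgue_measure R]_(t in `[0, x]) f t)%R].
Proof.
(* Starting the integral at -1 makes 0 an interior point, so that the derivative at 0 is
   two-sided. *)
move=> cf; pose I (x : R) := (\int[@lebesgue_measure R]_(t in `[(-1 : R), x]) f t)%R.
have fi (a b : R) : (@lebesgue_measure R).-integrable `[a, b] (EFin \o f).
  apply: continuous_compact_integrable; first exact: segment_compact.
  exact: continuous_subspaceT.
exists (fun x => I x - I 0); split.
- move=> x x0; have x1 : x < x + 1 by lra.
  have [] := @continuous_FTC1_closed R f (-1) x (x + 1) x1 (fi _ _).
  + lra.
  + exact: cf.
  rewrite derive1E => dI EI; have dI' : is_derive x 1 I (f x) := DeriveDef dI EI.
  by have := is_deriveB dI' (is_derive_cst (I 0) x 1); rewrite subr0.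
- by rewrite subrr.
move=> x x0; rewrite /I (Rintegral_itvB (fi _ _)).
- apply: Rintegral_itv_obnd_cbnd.
  apply: integrableS (fi 0 x) => //.
  by apply: subset_itvr; rewrite bnd_simp.
- by rewrite bnd_simp; lra.
- by rewrite bnd_simp.
Qed.

Lemma is_derive_pow (k : nat) (c x : R) :
  is_derive x 1 (fun w : R => c * w ^+ k.+1) (c * (k.+1%:R * x ^+ k)).
Proof.
rewrite (_ : (fun w : R => _) = c *: ((@id R) ^+ k.+1)); last first.
  by apply/funext => z; rewrite /= exprfctE.
by apply: is_derive_eq; rewrite /GRing.scale /= mulr1.
Qed.

(** The factorial, which [cos_taylor] does without, is needed for the error to vanish after
    integration against the Gaussian. *)
Lemma cos_taylor_fact (K : nat) (u v : R) : 0 <= v ->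
  `|cos (u + v) - \sum_(m < K) v ^+ m / m`!%:R * cos (u + m%:R * (pi / 2))| <=
  v ^+ K / K`!%:R.
Proof.
elim: K u v => [|K IH] u v v0.
  by rewrite big_ord0 subr0 expr0 fact0 divr1 ler_norml cos_le1 cos_geN1.
have := derive_compare v0 (fun x _ => is_derive_cos_taylor K u x)
  (fun x _ => is_derive_pow K (K.+1`!%:R)^-1 x).
have e0 : cos (u + 0) - \sum_(m < K.+1) 0 ^+ m / m`!%:R * cos (u + m%:R * (pi / 2)) = 0.
  rewrite big_ord_recl big1 => [|m _]; last by rewrite expr0n /= !mul0r.
  by rewrite fact0 expr0 divr1 mul1r mul0r !addr0 subrr.
rewrite e0 subr0 expr0n /= mulr0 subr0 => H; rewrite [leRHS]mulrC; apply: H => x /andP[x0 _].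
rewrite (le_trans (IH _ _ x0))// factS natrM.
have n1 : K.+1%:R != 0 :> R by rewrite pnatr_eq0.
have n2 : K`!%:R != 0 :> R by rewrite pnatr_eq0 -lt0n fact_gt0.
have fld (a b z : R) : a != 0 -> b != 0 -> z / b = (a * b)^-1 * (a * z).
  by move=> a0 b0; field; rewrite a0 b0.
by rewrite -fld.
Qed.

Lemma cos_taylor_even (K : nat) (v : R) : 0 <= v ->
  `|cos v - \sum_(k < K) (-1) ^+ k * v ^+ k.*2 / k.*2`!%:R| <= v ^+ K.*2 / K.*2`!%:R.
Proof.
move=> v0; have := cos_taylor_fact K.*2 0 v0; rewrite add0r.
congr (`|_ - _| <= _).
have ck (k : nat) : cos (0 + k.*2%:R * (pi / 2)) = (-1) ^+ k :> R /\
    cos (0 + k.*2.+1%:R * (pi / 2)) = 0 :> R.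
  have sk : cos (k%:R * pi) = (-1) ^+ k :> R /\ sin (k%:R * pi) = 0 :> R.
    elim: k => [|k [IH1 IH2]]; first by rewrite mul0r cos0 sin0.
    by rewrite -natr1 mulrDl mul1r cosDpi sinDpi IH1 IH2 oppr0 exprSr mulrN1.
  have e1 : k.*2%:R * (pi / 2) = k%:R * pi :> R by rewrite -muln2 natrM; field.
  rewrite !add0r e1 -natr1 mulrDl mul1r e1 cosDpihalf; case: sk => -> ->.
  by rewrite oppr0.
elim: K => [|K IH]; first by rewrite !big_ord0.
rewrite doubleS !big_ord_recr /= IH; have [-> ->] := ck K.
by rewrite mulr0 addr0; congr (_ + _); ring.
Qed.

Lemma is_derive_gauss x : is_derive x 1 (@gauss_fun R) (- 2 * x * gauss_fun x).
Proof.
have -> : @gauss_fun R = expR \o (- ((@id R) ^+ 2)) by apply/funext => z; rewrite /= opprfctE exprfctE.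
by apply: is_derive_eq; rewrite /GRing.scale /= /gauss_fun opprfctE exprfctE /=; ring.
Qed.

Lemma gauss_primitive : exists F : R -> R,
  [/\ forall x, 0 <= x -> is_derive x 1 F (gauss_fun x), F 0 = 0 &
      F x @[x --> +oo] --> Num.sqrt pi / 2].
Proof.
have [F [dF F0 FE]] := exists_primitive (@continuous_gauss_fun R).
exists F; split => //.
have h : Num.sqrt (gauss_integral_proof.integral0_gauss x ^+ 2) @[x --> +oo] --> Num.sqrt (pi / 4 : R).
  by apply: continuous_cvg; [exact: sqrt_continuous|exact: gauss_integral_proof.cvg_integral0_gauss_sqr].
have -> : Num.sqrt pi / 2 = Num.sqrt (pi / 4) :> R.
  rewrite sqrtrM ?pi_ge0// (_ : 4^-1 = (2^-1) ^+ 2 :> R); last by field.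
  by rewrite sqrtr_sqr ger0_norm.
apply: cvg_trans h; apply: near_eq_cvg; near=> x.
have x0 : 0 <= x by near: x; exact: near_ge.
by rewrite FE// sqrtr_sqr ger0_norm// gauss_integral_proof.integral0_gauss_ge0.
Unshelve. all: by end_near. Qed.

(** The primitive of [u ^+ k.*2 * gauss_fun u] given by repeated integration by parts, starting from
    the primitive [F] of [gauss_fun]. *)
Fixpoint gauss_moment (F : R -> R) (k : nat) (u : R) : R :=
  if k is k'.+1 then
    k'.*2.+1%:R / 2 * gauss_moment F k' u - u ^+ k'.*2.+1 / 2 * gauss_fun u
  else F u.

Lemma is_derive_gauss_moment F k x : (forall x, 0 <= x -> is_derive x 1 F (gauss_fun x)) ->
  0 <= x -> is_derive x 1 (gauss_moment F k) (x ^+ k.*2 * gauss_fun x).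
Proof.
move=> dF x0; elim: k => [|k IH]; first by rewrite expr0 mul1r; exact: dF.
have -> : gauss_moment F k.+1 = ((k.*2.+1%:R / 2) *: gauss_moment F k) -
    (2^-1 *: ((@id R) ^+ k.*2.+1)) * (@gauss_fun R).
  apply/funext => z /=; rewrite opprfctE /= ; congr (_ - _ * _).
  by rewrite mulrC /GRing.scale /= exprfctE.
have dg := is_derive_gauss x.
apply: is_derive_eq; rewrite /GRing.scale /= exprfctE /= doubleS !exprS /= /GRing.scale /=.
by field.
Qed.

Lemma gauss_moment0 F k : F 0 = 0 -> gauss_moment F k 0 = 0.
Proof. by move=> F0; elim: k => //= k ->; rewrite exprS !mul0r mulr0 subrr. Qed.

Lemma cvg_pow_gauss k : u ^+ k * gauss_fun u @[u --> +oo] --> (0 : R).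
Proof.
apply: (@squeeze_cvgr _ _ _ _ (fun=> 0) (fun u => (k.+1)`!%:R * u^-1)); last first.
- rewrite -[X in _ --> X](mulr0 ((k.+1)`!%:R : R)); apply: cvgM; first exact: cvg_cst.
  by apply/gtr0_cvgV0; [near=> u; near: u; exact: nbhs_pinfty_gt|exact: cvg_id].
- exact: cvg_cst.
near=> u.
have u1 : 1 <= u by near: u; exact: near_ge.
have u0 : 0 < u by lra.
rewrite mulr_ge0 ?exprn_ge0 ?expR_ge0 ?(ltW u0)//=.
rewrite ler_pdivlMr// mulrAC -exprSr /gauss_fun expRN ler_pdivrMr ?expR_gt0//.
have f0 : 0 < (k.+1)`!%:R :> R by rewrite ltr0n fact_gt0.
rewrite -ler_pdivrMl// mulrC; have := expR_ge1Dxn k (ltW u0).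
have : expR u <= expR (u ^+ 2) by rewrite ler_expR -[leLHS]expr1 ler_weXn2l.
lra.
Unshelve. all: by end_near. Qed.

Lemma cvg_gauss_moment F k : F x @[x --> +oo] --> Num.sqrt pi / 2 ->
  gauss_moment F k x @[x --> +oo] -->
  Num.sqrt pi / 2 * \prod_(i < k) (i.*2.+1%:R / 2 : R).
Proof.
move=> cF; elim: k => [|k IH]; first by rewrite big_ord0 mulr1.
rewrite big_ord_recr /= mulrA [X in _ --> X]mulrC -[X in _ --> X]subr0.
apply: cvgB; first by apply: cvgM; [exact: cvg_cst|exact: IH].
rewrite (_ : (fun _ => _) = fun u : R => 2^-1 * (u ^+ k.*2.+1 * gauss_fun u)); last first.
  by apply/funext => u; ring.
rewrite -[X in _ --> X](mulr0 ((2 : R)^-1)); apply: cvgM; first exact: cvg_cst.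
exact: cvg_pow_gauss.
Qed.

(** The identity (2k)! = 2^k k! (2k-1)!!: up to signs, the Gaussian moments turn the cosine series
    at [2 * b * x] into the exponential series at [b ^+ 2]. *)
Lemma gauss_moment_coef (b : R) k :
  (2 * b) ^+ k.*2 / k.*2`!%:R * \prod_(i < k) (i.*2.+1%:R / 2 : R) =
  (b ^+ 2) ^+ k / k`!%:R.
Proof.
elim: k => [|k IH]; first by rewrite big_ord0 !expr0 mulr1.
rewrite big_ord_recr /= doubleS !factS !natrM.
rewrite [in LHS]exprS [in LHS]exprS [in RHS]exprS.
have fld (B a2 a1 f P k1 g : R) : a1 != 0 -> f != 0 -> g != 0 -> k1 != 0 -> a2 = 2 * k1 ->
    B / f * P = (b ^+ 2) ^+ k / g ->
    2 * b * (2 * b * B) / (a2 * (a1 * f)) * (P * (a1 / 2)) = b ^+ 2 * (b ^+ 2) ^+ k / (k1 * g).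
  move=> a10 f0 g0 k10 -> H.
  transitivity (b ^+ 2 / k1 * (B / f * P)); first by field; rewrite a10 f0 k10.
  by rewrite H; field; rewrite g0 k10.
apply: fld IH; rewrite ?pnatr_eq0 -?lt0n ?fact_gt0//.
by rewrite -doubleS -muln2 natrM mulrC.
Qed.

End Comparison.

(** * Fourier transform of the Gaussian and lattice inversion *)

Section GaussFourier.
Context {R : realType}.
Implicit Types (b x : R).

(* The Taylor expansion of the cosine is integrated termwise against the Gaussian. *)
Lemma gauss_fourier b : 0 <= b ->
  exists F : R -> R, [/\ forall x, 0 <= x -> is_derive x 1 F (gauss_fun x * cos (2 * b * x)),
    F 0 = 0 & F x @[x --> +oo] --> Num.sqrt pi / 2 * expR (- b ^+ 2)].
Proof.
move=> b0; have [P [dP P0 cP]] := @gauss_primitive R.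
have cf : continuous (fun x : R => gauss_fun x * cos (2 * b * x)).
  move=> x; apply: cvgM; first exact: continuous_gauss_fun.
  apply: (@continuous_cvg _ _ _ _ _ (fun x => 2 * b * x) cos); first exact: continuous_cos.
  by apply: cvgM; [exact: cvg_cst|exact: cvg_id].
have [F [dF F0 _]] := exists_primitive cf.
exists F; split => //.
pose c k : R := (-1) ^+ k * ((2 * b) ^+ k.*2 / k.*2`!%:R).
pose S K : R -> R := \sum_(k < K) (c k *: gauss_moment P k).
(* [S] integrates the first [K] terms of the Taylor expansion and [e] the size of the next one,
   which dominates the error for every upper limit. *)
pose e K : R -> R := ((2 * b) ^+ K.*2 / K.*2`!%:R) *: gauss_moment P K.
have SE K u : S K u = \sum_(k < K) c k * gauss_moment P k u by rewrite /S fct_sumE.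
have bound K (u : R) : 0 <= u -> `|F u - S K u| <= e K u.
  move=> u0; pose df (x : R) := gauss_fun x * cos (2 * b * x) - \sum_(k < K) c k * (x ^+ k.*2 * gauss_fun x).
  have d1 x : 0 <= x <= u -> is_derive x 1 (F - S K) (df x).
    move=> /andP[x0 _]; have h1 := dF x x0.
    have h2 (k : 'I_K) : is_derive x 1 (c k *: gauss_moment P k) (c k * (x ^+ k.*2 * gauss_fun x)).
      by have h3 := is_derive_gauss_moment k dP x0; exact: is_deriveZ.
    exact: is_deriveB.
  have d2 x : 0 <= x <= u -> is_derive x 1 (e K)
      ((2 * b) ^+ K.*2 / K.*2`!%:R * (x ^+ K.*2 * gauss_fun x)).
    by move=> /andP[x0 _]; have h3 := is_derive_gauss_moment K dP x0; exact: is_deriveZ.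
  have := derive_compare u0 d1 d2.
  rewrite -[(F - S K) u]/(F u - S K u) -[(F - S K) 0]/(F 0 - S K 0) F0.
  have -> : S K 0 = 0 by rewrite SE big1// => k _; rewrite gauss_moment0// mulr0.
  have -> : e K 0 = 0.
    rewrite -[LHS]/(((2 * b) ^+ K.*2 / K.*2`!%:R) * gauss_moment P K 0).
    by rewrite gauss_moment0// mulr0.
  rewrite !subr0; apply => x /andP[x0 _].
  have bx0 : 0 <= 2 * b * x by rewrite !mulr_ge0.
  have := cos_taylor_even K bx0; rewrite exprMn => h.
  have -> : df x = gauss_fun x * (cos (2 * b * x) -
      \sum_(k < K) (-1) ^+ k * (2 * b * x) ^+ k.*2 / k.*2`!%:R).
    rewrite /df mulrBr mulr_sumr; congr (_ - _); apply: eq_bigr => k _.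
    by rewrite exprMn /c; ring.
  rewrite normrM ger0_norm ?gauss_fun_ge0//.
  apply: le_trans (ler_wpM2l (gauss_fun_ge0 x) h) _.
  by rewrite le_eqVlt; apply/orP; left; apply/eqP; ring.
have cS K : S K x @[x --> +oo] --> Num.sqrt pi / 2 * series (exp_coeff (- b ^+ 2)) K.
  rewrite /series /= big_mkord mulr_sumr.
  have -> : \sum_(k < K) Num.sqrt pi / 2 * exp_coeff (- b ^+ 2) k =
      \sum_(k < K) c k * (Num.sqrt pi / 2 * \prod_(i < k) (i.*2.+1%:R / 2 : R)).
    apply: eq_bigr => k _; rewrite /c /exp_coeff /=.
    have -> : (- b ^+ 2) ^+ k / k`!%:R = (-1) ^+ k * ((b ^+ 2) ^+ k / k`!%:R) :> R.
      by rewrite [in LHS]exprNn mulrA.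
    by rewrite -gauss_moment_coef; ring.
  rewrite (_ : S K = fun x => \sum_(k < K) c k * gauss_moment P k x); last exact/funext/SE.
  elim: K => [|K IH].
    by rewrite big_ord0 (_ : (fun _ => _) = cst 0); [exact: cvg_cst|apply/funext => x; rewrite big_ord0].
  rewrite big_ord_recr (_ : (fun _ => _) = fun x => (\sum_(k < K) c k * gauss_moment P k x) +
    c K * gauss_moment P K x); last by apply/funext => x; rewrite big_ord_recr.
  by apply: cvgD => //; apply: cvgM; [exact: cvg_cst|exact: cvg_gauss_moment].
have ce K : e K x @[x --> +oo] --> Num.sqrt pi / 2 * exp_coeff (b ^+ 2) K.
  rewrite /exp_coeff /= -gauss_moment_coef mulrCA.
  by apply: cvgM; [exact: cvg_cst|exact: cvg_gauss_moment].
have cs : Num.sqrt pi / 2 * series (exp_coeff (- b ^+ 2)) K @[K --> \oo] -->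
    Num.sqrt pi / 2 * expR (- b ^+ 2).
  by apply: cvgM; [exact: cvg_cst|exact: is_cvg_series_exp_coeff].
have c0 : Num.sqrt pi / 2 * exp_coeff (b ^+ 2) K @[K --> \oo] --> (0 : R).
  rewrite -[X in _ --> X](mulr0 (Num.sqrt pi / 2 : R)).
  by apply: cvgM; [exact: cvg_cst|exact: cvg_exp_coeff].
apply/cvgrPdist_le => eps eps0.
have e4 : 0 < eps / 4 by rewrite divr_gt0.
(* [K] is fixed before the upper limit tends to infinity, as [bound] holds for all limits at
   once. *)
have [K [hs he]] : exists K : nat,
    `|Num.sqrt pi / 2 * expR (- b ^+ 2) - Num.sqrt pi / 2 * series (exp_coeff (- b ^+ 2)) K| <= eps / 4 /\
    `|0 - Num.sqrt pi / 2 * exp_coeff (b ^+ 2) K| <= eps / 4.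
  have /cvgrPdist_le/(_ _ e4) h1 := cs; have /cvgrPdist_le/(_ _ e4) h2 := c0.
  near \oo => K; exists K; split; near: K; [exact: h1|exact: h2].
have /cvgrPdist_le/(_ _ e4) cSK := cS K; have /cvgrPdist_le/(_ _ e4) ceK := ce K.
near=> u.
have u0 : 0 <= u by near: u; exact: near_ge.
have h1 : `|Num.sqrt pi / 2 * series (exp_coeff (- b ^+ 2)) K - S K u| <= eps / 4.
  by near: u; exact: cSK.
have h2 : `|Num.sqrt pi / 2 * exp_coeff (b ^+ 2) K - e K u| <= eps / 4.
  by near: u; exact: ceK.
have h3 := bound K u u0.
move: hs he h1 h2 h3; rewrite !ler_norml => /andP[? ?] /andP[? ?] /andP[? ?] /andP[? ?] /andP[? ?].
by apply/andP; split; lra.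
Unshelve. all: by end_near. Qed.

(* [P = G pi / pi] is the inversion formula on the lattice of integers. *)
Lemma inversion_bound (G g : R -> R) (P s x T d1 d2 : R) :
  0 < s -> 0 <= x -> 0 < T <= pi ->
  (forall t, 0 <= t <= pi -> is_derive t 1 G (g t)) -> G 0 = 0 -> G pi = pi * P ->
  (forall t, 0 <= t <= T -> `|g t - expR (- (s ^+ 2 * t ^+ 2 / 2)) * cos (t * x)| <= d1) ->
  (forall t, T <= t <= pi -> `|g t| <= d2) ->
  `|P - 1 / (Num.sqrt (2 * pi) * s) * expR (- (x ^+ 2 / (2 * s ^+ 2)))| <=
  T * d1 + 4 * d2 + 2 / (s ^+ 2 * T) * expR (- (s ^+ 2 * T ^+ 2 / 2)).
Proof.
move=> s0 x0 /andP[T0 Tpi] dG G0 Gpi h1 h2.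
have r2 : 0 < Num.sqrt 2 :> R by rewrite sqrtr_gt0.
have r22 : Num.sqrt 2 ^+ 2 = 2 :> R by rewrite sqr_sqrtr.
(* The substitution by [k * t] gives the wanted integrand since [2 * b * k = x] and
   [k ^+ 2 = s ^+ 2 / 2]. *)
pose b := x / (Num.sqrt 2 * s).
pose k := s / Num.sqrt 2.
have k0 : 0 < k by rewrite divr_gt0.
have b0 : 0 <= b by rewrite divr_ge0// mulr_ge0// ltW.
have [F [dF F0 cF]] := gauss_fourier b0.
pose h (t : R) := expR (- (s ^+ 2 * t ^+ 2 / 2)) * cos (t * x).
pose H : R -> R := k^-1 *: (F \o ( *%R k)).
have hE t : gauss_fun (k * t) * cos (2 * b * (k * t)) = h t.
  rewrite /h /gauss_fun /k /b; congr (expR (- _) * cos _).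
    by rewrite exprMn expr_div_n r22; field.
  transitivity (2 / Num.sqrt 2 ^+ 2 * (t * x)); first by field; rewrite !gt_eqF.
  by rewrite r22 divff// mul1r.
have dH (t : R) : 0 <= t -> is_derive t 1 H (h t).
  move=> t0; have kt : 0 <= k * t by rewrite mulr_ge0// ltW.
  have dk : is_derive t 1 ( *%R k) k.
    by have := is_deriveZ k (is_derive_id t (1 : R)); rewrite /GRing.scale /= mulr1.
  have dF' := dF _ kt; rewrite hE in dF'.
  have dc := @is_derive1_comp _ F ( *%R k) t _ _ dF' dk.
  have := is_deriveZ k^-1 dc; rewrite /GRing.scale /=.
  by rewrite mulrCA mulVf ?mulr1// gt_eqF.
have H0 : H 0 = 0 by rewrite -[H 0]/(k^-1 * F (k * 0)) mulr0 F0 mulr0.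
have cH : H t @[t --> +oo] --> k^-1 * (Num.sqrt pi / 2 * expR (- b ^+ 2)).
  apply: cvgM; first exact: cvg_cst.
  apply: (@cvg_comp _ _ _ ( *%R k) F _ _ _ _ cF).
  exact: gt0_cvgMry.
set Hoo := k^-1 * _ in cH.
have HE : Hoo / pi = 1 / (Num.sqrt (2 * pi) * s) * expR (- (x ^+ 2 / (2 * s ^+ 2))).
  have -> : expR (- (x ^+ 2 / (2 * s ^+ 2))) = expR (- b ^+ 2).
    by rewrite /b expr_div_n exprMn r22.
  rewrite /Hoo /k sqrtrM//; set a := Num.sqrt pi; set ex := expR _.
  have a0 : 0 < a by rewrite sqrtr_gt0 pi_gt0.
  have -> : pi = a ^+ 2 by rewrite sqr_sqrtr// pi_ge0.
  have -> : a / 2 = a / Num.sqrt 2 ^+ 2 by rewrite r22.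
  by field; rewrite !gt_eqF.
have e1 : `|(G - H) T - (G - H) 0| <= d1 * T - d1 * 0.
  apply: (@derive_compare _ (G - H) (fun t => d1 * t) (fun t => g t - h t) (fun=> d1)) => //.
  - exact: ltW.
  - move=> t /andP[t0 tT]; have dg : is_derive t 1 G (g t) by apply: dG; rewrite t0 (le_trans tT).
    by have dh := dH t t0; exact: is_deriveB.
  - move=> t _; have := is_deriveZ d1 (is_derive_id t (1 : R)).
    by rewrite /GRing.scale /= mulr1.
have e2 : `|G pi - G T| <= d2 * pi - d2 * T.
  apply: (@derive_compare _ G (fun t => d2 * t) g (fun=> d2)) => //.
  - move=> t /andP[t0 tT]; apply: dG; rewrite tT andbT.
    by rewrite (le_trans _ t0)// ltW.
  - move=> t _; have := is_deriveZ d2 (is_derive_id t (1 : R)).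
    by rewrite /GRing.scale /= mulr1.
(* Beyond [T], the exponent [s ^+ 2 * t ^+ 2 / 2] is at least [w * t], so the Gaussian tail is
   bounded by an exponential with an explicit primitive. *)
pose w := s ^+ 2 * T / 2.
have w0 : 0 < w by rewrite divr_gt0// mulr_gt0// exprn_gt0.
have e3 : `|Hoo - H T| <= w^-1 * expR (- (w * T)).
  have cHT : `|H t - H T| @[t --> +oo] --> `|Hoo - H T|.
    by apply: cvg_norm; apply: cvgB => //; exact: cvg_cst.
  apply: (cvgr_to_le cHT).
  near=> t; have Tt : T <= t by near: t; exact: near_ge.
  pose W : R -> R := (- w^-1) *: (expR \o (- w \*o @id R)).
  have dW (z : R) : is_derive z 1 W (expR (- (w * z))).
    have dl : is_derive z 1 (- w \*o @id R) (- w).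
      by have := is_deriveZ (- w) (is_derive_id z (1 : R)); rewrite /GRing.scale /= mulr1.
    apply: (is_derive_eq (is_deriveZ (- w^-1)
      (@is_derive1_comp _ expR (- w \*o @id R) z _ _ (is_derive_expR _) dl))).
    rewrite -[LHS]/(- w^-1 * (expR (- w * z) * - w)) mulNr (mulNr w z).
    by rewrite mulrN mulrN opprK mulrCA mulVf ?gt_eqF// mulr1.
  have := @derive_compare _ H W h (fun z => expR (- (w * z))) T t Tt.
  have q1 (z : R) : T <= z <= t -> is_derive z 1 H (h z).
    by move=> /andP[Tz _]; apply: dH; rewrite (le_trans _ Tz)// ltW.
  have q2 (z : R) : T <= z <= t -> is_derive z 1 W (expR (- (w * z))) by move=> _.
  move=> /(_ q1 q2) q3.
  have {}q3 : `|H t - H T| <= W t - W T.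
    apply: q3 => z /andP[Tz _].
    rewrite /h normrM ger0_norm ?expR_ge0//.
    rewrite (le_trans (ler_piMr (expR_ge0 _) _))//; first by rewrite ler_norml cos_geN1 cos_le1.
    rewrite ler_expR lerN2 /w [leRHS](_ : _ = s ^+ 2 * (z * z) / 2); last by rewrite expr2.
    rewrite mulrAC ler_wpM2r// -mulrA ler_wpM2l ?sqr_ge0// ler_wpM2r//.
    by rewrite (le_trans _ Tz)// ltW.
  apply: (le_trans q3).
  have WE (z : R) : W z = - (w^-1 * expR (- (w * z))).
    by rewrite -[LHS]/(- w^-1 * expR (- w * z)) mulNr (mulNr w z).
  have Wt : 0 <= w^-1 * expR (- (w * t)) by rewrite mulr_ge0 ?expR_ge0// invr_ge0 ltW.
  rewrite !WE; lra.
have -> : 2 / (s ^+ 2 * T) * expR (- (s ^+ 2 * T ^+ 2 / 2)) = w^-1 * expR (- (w * T)).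
  have -> : s ^+ 2 * T ^+ 2 / 2 = w * T by rewrite /w; field.
  by congr (_ * _); rewrite /w; field; rewrite !gt_eqF// exprn_gt0.
rewrite -HE; set er := w^-1 * _ in e3 *.
have -> : P - Hoo / pi = ((G pi - G T) + ((G - H) T - (G - H) 0) - (Hoo - H T)) / pi.
  rewrite -[(G - H) T]/(G T - H T) -[(G - H) 0]/(G 0 - H 0) G0 H0 Gpi.
  have fld (a e c d q : R) : q != 0 -> a - e / q = (q * a - c + (c - d - (0 - 0)) - (e - d)) / q.
    by move=> q0; field; exact: q0.
  exact: fld (lt0r_neq0 (pi_gt0 R)).
have pi1 : 1 <= pi :> R by rewrite (le_trans _ (pi_ge2 R))// ler1n.
have d20 : 0 <= d2.
  by apply: le_trans (h2 pi _); rewrite ?normr_ge0// lexx Tpi.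
have er0 : 0 <= er by rewrite /er mulr_ge0 ?expR_ge0// invr_ge0 ltW.
have d10 : 0 <= d1.
  by apply: le_trans (h1 0 _); rewrite ?normr_ge0// lexx ltW.
rewrite normrM [X in _ * X]ger0_norm ?invr_ge0 ?pi_ge0//.
rewrite ler_pdivrMr ?pi_gt0//.
have := ler_normB (G pi - G T + ((G - H) T - (G - H) 0)) (Hoo - H T).
have := ler_normD (G pi - G T) ((G - H) T - (G - H) 0).
have Td : 0 <= T * d1 by rewrite mulr_ge0// ltW.
have a1 : T * d1 <= T * d1 * pi by rewrite ler_peMr.
have a2 : er <= er * pi by rewrite ler_peMr.
have a3 : 0 <= d2 * pi by rewrite mulr_ge0// pi_ge0.
have a4 : 0 <= d2 * T by rewrite mulr_ge0// ltW.
rewrite !mulrDl; move: e1 e2 e3; lra.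
Unshelve. all: by end_near. Qed.

End GaussFourier.

(** * The central range *)

Section GaussianPhase.
Context {R : realType} {T : finType} {p : R}.
Hypothesis hp : 0 < p < 1.
Implicit Types (F G : {ffun T -> bool} -> R) (x : {ffun T -> bool}) (B : {set T}) (e : T).

Lemma exp_sub1_le (s : R) : 0 <= s -> `|expR (- s) - (1 - s)| <= s ^+ 2.
Proof.
move=> s0; have h1 := expR_ge1Dx (- s); have h2 := expR_ge1Dx s.
have e0 := expR_gt0 (- s).
have h3 : expR (- s) * (1 + s) <= 1.
  by rewrite -[leRHS]expR0 -(addNr s) expRD ler_wpM2l// ltW.
rewrite ger0_norm; last by lra.
by have := mulr_ge0 (ltW e0) (sqr_ge0 s); nra.
Qed.

(** A centred bit has no first-order term, and its second-order term is that of the Gaussian factor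
    of the same variance; the rest is cubic in [u]. *)
Lemma bit_gauss (u phi : R) : `|u| <= 1 ->
  `|p * cos (phi + u * (1 - p)) + (1 - p) * cos (phi + u * (- p)) -
     expR (- (p * (1 - p) * u ^+ 2 / 2)) * cos phi| <= 2 * `|u| ^+ 3.
Proof.
move=> u1; have /andP[p0 p1] := hp; have q4 := pq_le (p := p).
set q := p * (1 - p) in q4 *; have q0 : 0 <= q := pq_ge0 hp.
have u0 := normr_ge0 u.
have tay v : `|v| <= `|u| ->
    `|cos (phi + v) - (cos phi + v * cos (phi + pi / 2) - v ^+ 2 / 2 * cos phi)| <= `|u| ^+ 3.
  move=> vu; have := cos_taylor 3 phi v.
  rewrite !big_ord_recl big_ord0 /= expr0 fact0 divr1 mul1r mul0r addr0.
  rewrite (_ : (bump 0 0)%N = 1%N)// (_ : (bump 0 (bump 0 0))%N = 2%N)// expr1 !factS fact0.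
  rewrite mul1n muln1 divr1 mul1r addr0 (_ : 2 * (pi / 2) = pi) ?cosDpi; last by field.
  rewrite [X in cos _ - X](_ : _ = cos phi + v * cos (phi + pi / 2) - v ^+ 2 / 2 * cos phi); last by ring.
  move=> /le_trans; apply; rewrite lerXn2r ?nnegrE//.
have t1 : `|u * (1 - p)| <= `|u|.
  by rewrite normrM ler_piMr// ger0_norm; lra.
have t2 : `|u * - p| <= `|u|.
  by rewrite normrM normrN ler_piMr// ger0_norm; lra.
have := tay _ t1; have := tay _ t2.
set c := cos phi; set c' := cos (phi + pi / 2); set A := cos (_ + _); set B := cos (_ + _).
move=> hB hA.
have hc : `|c| <= 1 by rewrite ler_norml cos_le1 cos_geN1.
have s0 : 0 <= q * u ^+ 2 / 2 by rewrite divr_ge0// mulr_ge0// sqr_ge0.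
have uu : u ^+ 2 = `|u| ^+ 2 by rewrite real_normK ?num_real.
have ex : `|expR (- (q * u ^+ 2 / 2)) - (1 - q * u ^+ 2 / 2)| <= `|u| ^+ 3.
  apply: (le_trans (exp_sub1_le s0)); rewrite uu.
  apply: (@le_trans _ _ (`|u| ^+ 4)).
    have -> : `|u| ^+ 4 = (`|u| ^+ 2) ^+ 2 by rewrite -exprM.
    rewrite lerXn2r ?nnegrE ?sqr_ge0//; first by rewrite -uu.
    have := sqr_ge0 `|u|; nra.
  by rewrite exprS ler_piMl// exprn_ge0.
set E := expR _ in ex *.
have hE : `|E * c - (1 - q * u ^+ 2 / 2) * c| <= `|u| ^+ 3.
  by rewrite -mulrBl normrM (le_trans _ ex)// ler_piMr.
have -> : p * B + (1 - p) * A - E * c =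
   p * (B - (c + u * (1 - p) * c' - (u * (1 - p)) ^+ 2 / 2 * c)) +
   (1 - p) * (A - (c + u * - p * c' - (u * - p) ^+ 2 / 2 * c)) -
   (E * c - (1 - q * u ^+ 2 / 2) * c).
  by rewrite /q; field.
move: hA hB hE; set a := _ - _; set b := _ - _; set d := _ - _; set w := `|u| ^+ 3.
rewrite !ler_norml => /andP[a1 a2] /andP[b1 b2] /andP[d1 d2].
have := ler_wpM2l (ltW p0) a1; have := ler_wpM2l (ltW p0) a2.
have p10 : 0 <= 1 - p by lra.
have := ler_wpM2l p10 b1; have := ler_wpM2l p10 b2.
by move=> *; apply/andP; split; lra.
Qed.

(** One bit at a time: the error made so far is only multiplied by a factor at most 1, so the errors
    of the bits add up. *)
Lemma sum_chi_gauss (u phi : R) B : `|u| <= 1 ->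
  `|esp p (fun x => cos (phi + \sum_(e in B) u * chi p e x)) -
    expR (- (p * (1 - p) * u ^+ 2 / 2 * #|B|%:R)) * cos phi| <= #|B|%:R * (2 * `|u| ^+ 3).
Proof.
move=> u1; move: {2}#|B| (erefl #|B|) => k; elim: k B => [|k IH] B cB.
  have -> : B = finset.set0 by apply/eqP; rewrite -cards_eq0 cB.
  rewrite cards0 mulr0 oppr0 expR0 mul1r mul0r (eq_esp (G := fun=> cos phi)).
    by rewrite esp_cst subrr normr0.
  by move=> x; rewrite big_set0 addr0.
have /card_gt0P[e eB] : (0 < #|B|)%N by rewrite cB.
have cB' : #|B :\ e| = k by move: cB; rewrite (cardsD1 e) eB => -[].
set q := p * (1 - p); set a := q * u ^+ 2 / 2.
pose S x := phi + \sum_(i in B :\ e) u * chi p i x.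
have SE b x : S (set_at e b x) = S x.
  congr (_ + _); apply: eq_bigr => i; rewrite !finset.inE => /andP[/negPf ie _].
  by rewrite /chi set_atE ie.
have -> : esp p (fun x => cos (phi + \sum_(i in B) u * chi p i x)) =
    esp p (fun x => p * cos (S x + u * (1 - p)) + (1 - p) * cos (S x + u * - p)).
  rewrite (esp_av e); apply: eq_esp => x.
  have h b : phi + \sum_(i in B) u * chi p i (set_at e b x) = S x + u * (b%:R - p).
    rewrite (big_setD1 e eB) /= -(SE b x) /S [chi p e _]/chi set_atE eqxx; ring.
  by rewrite !h /= sub0r.
have := IH _ cB'; rewrite -/q -/a => hI.
have e1 : `|esp p (fun x => p * cos (S x + u * (1 - p)) + (1 - p) * cos (S x + u * - p)) -
    expR (- a) * esp p (fun x => cos (S x))| <= 2 * `|u| ^+ 3.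
  rewrite -espZ -espB; apply: (esp_abs_le hp) => x; exact: bit_gauss.
have aE : expR (- (a * #|B|%:R)) = expR (- a) * expR (- (a * k%:R)).
  by rewrite -expRD cB -natr1; congr expR; ring.
have a0 : 0 <= a by rewrite divr_ge0// mulr_ge0 ?sqr_ge0// pq_ge0.
have ea : expR (- a) <= 1 by rewrite -[leRHS]expR0 ler_expR oppr_le0.
rewrite aE; rewrite cB' in hI.
set X := esp p _ in e1 *; set Y := esp p (fun x => cos (S x)) in e1 hI.
have e2 : `|expR (- a) * Y - expR (- a) * (expR (- (a * k%:R)) * cos phi)| <= k%:R * (2 * `|u| ^+ 3).
  by rewrite -mulrBr normrM ger0_norm ?expR_ge0// (le_trans (ler_wpM2r _ ea))// mul1r.
rewrite cB -natr1 mulrDl mul1r -mulrA.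
rewrite (le_trans (ler_distD (expR (- a) * Y) _ _))// addrC lerD//.
Qed.

Lemma esp_chi_dif e F : esp p (fun x => chi p e x * F x) = p * (1 - p) * esp p (dif e F).
Proof.
rewrite (esp_av e) -espZ; apply: eq_esp => x; rewrite /chi !set_atE eqxx /dif /=; ring.
Qed.

Lemma dif_sum_chi e x : dif e (fun x => \sum_i chi p i x) x = 1.
Proof.
rewrite /dif -sumrB (bigD1 e)//= big1 => [|i /negPf ie]; rewrite /chi !set_atE ?eqxx ?ie /=; ring.
Qed.

(* The remainder is orthogonal to the linear part, as its discrete derivatives are centred. *)
Lemma linear_split F (k : R) : (forall e, esp p (dif e F) = k) ->
  let rem x := F x - esp p F - k * \sum_e chi p e x in
  [/\ esp p (fun x => (F x - esp p F) ^+ 2) =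
      p * (1 - p) * k ^+ 2 * #|T|%:R + esp p (fun x => rem x ^+ 2) &
      esp p (fun x => rem x ^+ 2) <= p * (1 - p) * \sum_e esp p (fun x => (dif e F x - k) ^+ 2)].
Proof.
move=> Fk rem.
have dr e x : dif e rem x = dif e F x - k.
  have := dif_sum_chi e x; rewrite /dif /rem; set a := \sum_i _; set b := \sum_i _ => h.
  transitivity (F (set_at e true x) - F (set_at e false x) - k * (a - b)); first by ring.
  by rewrite h mulr1.
have dr0 e : esp p (dif e rem) = 0.
  by rewrite (eq_esp (dr e)) espB esp_cst Fk subrr.
have Echi : esp p (fun x => \sum_e chi p e x) = 0.
  rewrite esp_sum big1// => e _.
  by rewrite (esp_coord e (fun b => b%:R - p)) /=; ring.
have Er : esp p rem = 0 by rewrite /rem !espB espZ esp_cst Echi mulr0 subr0 subrr.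
have Ex G : esp p (fun x => (\sum_e chi p e x) * G x) = \sum_e p * (1 - p) * esp p (dif e G).
  rewrite (eq_esp (G := fun x => \sum_e chi p e x * G x)); last by move=> x; rewrite mulr_suml.
  by rewrite esp_sum; apply: eq_bigr => e _; exact: esp_chi_dif.
split.
  rewrite (eq_esp (G := fun x => k ^+ 2 * ((\sum_e chi p e x) * (\sum_e chi p e x)) +
      2 * k * ((\sum_e chi p e x) * rem x) + rem x ^+ 2)); last first.
    by move=> x; rewrite /rem; ring.
  rewrite !espD !espZ !Ex [X in 2 * k * X]big1 ?mulr0 ?addr0; last by move=> e _; rewrite dr0 mulr0.
  congr (_ + _); rewrite (eq_bigr (fun=> p * (1 - p))); last first.
    move=> e _; rewrite (eq_esp (G := fun=> 1)) ?esp_cst ?mulr1// => x; exact: dif_sum_chi.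
  by rewrite sumr_const -[_ *+ _]mulr_natr; ring.
have := efron_stein_var hp rem; rewrite Er.
rewrite (eq_esp (G := fun x => rem x ^+ 2)); last by move=> x; rewrite subr0.
move=> /le_trans; apply; rewrite ler_wpM2l ?pq_ge0// le_eqVlt; apply/orP; left; apply/eqP.
by apply: eq_bigr => e _; apply: eq_esp => x; rewrite dr.
Qed.

Lemma expR_dist (a b : R) : 0 <= a -> 0 <= b -> `|expR (- (a + b)) - expR (- a)| <= b.
Proof.
move=> a0 b0; have h := expR_ge1Dx (- b).
have e1 : expR (- a) <= 1 by rewrite -[leRHS]expR0 ler_expR oppr_le0.
have e2 : expR (- b) <= 1 by rewrite -[leRHS]expR0 ler_expR oppr_le0.
have e0 := expR_gt0 (- a).
rewrite opprD expRD distrC -{1}[expR (- a)]mulr1 -mulrBr normrM ger0_norm ?expR_ge0//.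
rewrite ger0_norm ?subr_ge0//; nra.
Qed.

(** Three errors: dropping the nonlinear remainder costs [theta * rho], replacing the bits by
    Gaussians costs the cubic term, and restoring the full variance in place of that of the linear
    part costs [(theta * rho) ^+ 2]. *)
Lemma central_phase F (k m theta rho : R) : (forall e, esp p (dif e F) = k) ->
  0 <= theta -> `|theta * k| <= 1 -> 0 <= rho ->
  p * (1 - p) * \sum_e esp p (fun x => (dif e F x - k) ^+ 2) <= rho ^+ 2 ->
  `|esp p (fun x => cos (theta * (F x - m))) -
    expR (- (esp p (fun x => (F x - esp p F) ^+ 2) * theta ^+ 2 / 2)) * cos (theta * `|esp p F - m|)| <=
  theta * rho + #|T|%:R * (2 * `|theta * k| ^+ 3) + (theta * rho) ^+ 2.
Proof.
move=> Fk t0 tk r0 hr; set s2 := esp p (fun x => (F x - esp p F) ^+ 2).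
pose rem x := F x - esp p F - k * \sum_e chi p e x.
have [sE sR] : s2 = p * (1 - p) * k ^+ 2 * #|T|%:R + esp p (fun x => rem x ^+ 2) /\
    esp p (fun x => rem x ^+ 2) <= p * (1 - p) * \sum_e esp p (fun x => (dif e F x - k) ^+ 2).
  exact: linear_split Fk.
set phi := theta * (esp p F - m).
have -> : cos (theta * `|esp p F - m|) = cos phi.
  by rewrite -[theta in LHS](ger0_norm t0) -normrM cos_norm.
have er : esp p (fun x => rem x ^+ 2) <= rho ^+ 2 := le_trans sR hr.
have er1 : esp p (fun x => `|rem x|) <= rho.
  rewrite -ler_sqr ?nnegrE//; last by apply: (esp_ge0 hp) => x.
  apply: le_trans er; apply: le_trans (esp_sqr_le hp _) _.
  by rewrite le_eqVlt; apply/orP; left; apply/eqP; apply: eq_esp => x; rewrite real_normK ?num_real.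
have h1 : `|esp p (fun x => cos (theta * (F x - m))) -
    esp p (fun x => cos (phi + \sum_(e in [set: T]%SET) (theta * k) * chi p e x))| <= theta * rho.
  rewrite -espB (le_trans (ler_norm_esp hp _))//.
  apply: (@le_trans _ _ (esp p (fun x => theta * `|rem x|))).
    apply: (le_esp hp) => x.
    have -> : \sum_(e in [set: T]%SET) theta * k * chi p e x = theta * (k * \sum_e chi p e x).
      rewrite mulrA mulr_sumr; apply: eq_bigl => e; exact: finset.in_setT.
    have -> : theta * (F x - m) = (phi + theta * (k * \sum_e chi p e x)) + theta * rem x.
      by rewrite /phi /rem; ring.
    have := cos_taylor 1 (phi + theta * (k * \sum_e chi p e x)) (theta * rem x).
    rewrite big_ord_recl big_ord0 expr0 fact0 divr1 mul1r mul0r !addr0 expr1.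
    by rewrite normrM (ger0_norm t0).
  by rewrite espZ ler_wpM2l.
have h2 := sum_chi_gauss phi [set: T]%SET tk; rewrite cardsT in h2.
have h3 : `|expR (- (s2 * theta ^+ 2 / 2)) - expR (- (p * (1 - p) * (theta * k) ^+ 2 / 2 * #|T|%:R))| <=
    (theta * rho) ^+ 2.
  have -> : s2 * theta ^+ 2 / 2 = p * (1 - p) * (theta * k) ^+ 2 / 2 * #|T|%:R +
      esp p (fun x => rem x ^+ 2) * theta ^+ 2 / 2 by rewrite sE; field.
  have r20 : 0 <= esp p (fun x => rem x ^+ 2) by apply: (esp_ge0 hp) => x; exact: sqr_ge0.
  apply: le_trans (expR_dist _ _) _.
  - apply: mulr_ge0 => //; apply: divr_ge0 => //.
    by apply: mulr_ge0; [exact: pq_ge0|exact: sqr_ge0].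
  - by apply: divr_ge0 => //; apply: mulr_ge0 => //; exact: sqr_ge0.
  rewrite exprMn [leRHS]mulrC; have := ler_wpM2r (sqr_ge0 theta) er.
  have := mulr_ge0 r20 (sqr_ge0 theta); lra.
have hc : `|cos phi| <= 1 by rewrite ler_norml cos_le1 cos_geN1.
have h4 : `|expR (- (p * (1 - p) * (theta * k) ^+ 2 / 2 * #|T|%:R)) * cos phi -
     expR (- (s2 * theta ^+ 2 / 2)) * cos phi| <= (theta * rho) ^+ 2.
  by rewrite -mulrBl normrM distrC (le_trans (ler_piMr _ hc)).
move: h1 h2 h4; set A := esp p _; set B := esp p _; set C := _ * cos phi; set D := _ * cos phi.
move=> h1 h2 h4.
rewrite (le_trans (ler_distD C _ _))// lerD//.
by rewrite (le_trans (ler_distD B _ _))// lerD.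
Qed.

End GaussianPhase.

(** * Local limit theorem for clique counts *)

Section LatticeInversion.
Context {R : realType} {T : finType} {p : R}.
Hypothesis hp : 0 < p < 1.

Lemma is_derive_sum_fin (I : Type) (r : seq I) (h : I -> R -> R) (dh : I -> R) (x : R) :
  (forall i, is_derive x 1 (h i) (dh i)) ->
  is_derive x 1 (fun y => \sum_(i <- r) h i y) (\sum_(i <- r) dh i).
Proof.
move=> H; elim: r => [|i r IH].
  rewrite big_nil (_ : (fun y => _) = cst 0); first exact: is_derive_cst.
  by apply/funext => y; rewrite big_nil.
rewrite big_cons (_ : (fun y => _) = h i + fun y => \sum_(j <- r) h j y).
  by have hi := H i; exact: is_deriveD.
by apply/funext => y; rewrite big_cons.
Qed.

Lemma sin_natpi (k : nat) : sin (k%:R * pi) = 0 :> R.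
Proof.
elim: k => [|k IH]; first by rewrite mul0r sin0.
by rewrite -natr1 mulrDl mul1r sinDpi IH oppr0.
Qed.

(** The primitive [S z] of [cos (t * d z)] is [t] if [f z = m], and [sin (t * d z) / d z] otherwise.
    At [pi] the sine vanishes since [d z] is an integer, so only the event [f z = m] is left. *)
Lemma lattice_inversion (f : {ffun T -> bool} -> nat) (m : nat) (s x t0 d1 d2 : R) :
  0 < s -> 0 <= x -> 0 < t0 <= pi ->
  (forall t, 0 <= t <= t0 -> `|esp p (fun z => cos (t * ((f z)%:R - m%:R))) -
     expR (- (s ^+ 2 * t ^+ 2 / 2)) * cos (t * x)| <= d1) ->
  (forall t, t0 <= t <= pi -> `|esp p (fun z => cos (t * ((f z)%:R - m%:R)))| <= d2) ->
  `|esp p (fun z => (f z == m)%:R) -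
     1 / (Num.sqrt (2 * pi) * s) * expR (- (x ^+ 2 / (2 * s ^+ 2)))| <=
  t0 * d1 + 4 * d2 + 2 / (s ^+ 2 * t0) * expR (- (s ^+ 2 * t0 ^+ 2 / 2)).
Proof.
move=> s0 x0 ht h1 h2.
pose d z : R := (f z)%:R - m%:R.
pose S z (t : R) : R := if f z == m then t else sin (t * d z) / d z.
pose G (t : R) : R := \sum_(z : {ffun T -> bool}) wt p z * S z t.
apply: (@inversion_bound _ G (fun t => esp p (fun z => cos (t * d z)))) => //.
- move=> t _; apply: is_derive_sum_fin => z.
  have dS : is_derive t 1 (S z) (cos (t * d z)).
    rewrite /S /d; case: eqVneq => [->|fm].
      by rewrite subrr mulr0 cos0; exact: is_derive_id.
    have dn0 : (f z)%:R - m%:R != 0 :> R by rewrite subr_eq0 eqr_nat.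
    rewrite (_ : (fun t => _) = ((f z)%:R - m%:R)^-1 *: (sin \o ( *%R ((f z)%:R - m%:R)))); last first.
      by apply/funext => u /=; rewrite [u * _]mulrC [RHS]mulrC.
    have dk : is_derive t 1 ( *%R ((f z)%:R - m%:R)) ((f z)%:R - m%:R).
      by have := is_deriveZ ((f z)%:R - m%:R) (is_derive_id t (1 : R)); rewrite /GRing.scale /= mulr1.
    apply: (is_derive_eq (is_deriveZ _ (@is_derive1_comp _ sin _ t _ _ (is_derive_sin _) dk))).
    by rewrite -[LHS]/(((f z)%:R - m%:R)^-1 * (cos (((f z)%:R - m%:R) * t) * ((f z)%:R - m%:R)))
      mulrCA mulVf// mulr1 mulrC.
  by have := is_deriveZ (wt p z) dS.
- rewrite /G big1// => z _; rewrite /S mul0r sin0 mul0r; case: ifP; rewrite mulr0//.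
- rewrite -espZ /G /esp; apply: eq_bigr => z _; congr (_ * _); rewrite /S.
  case: eqVneq => [_|_]; first by rewrite mulr1.
  transitivity (0 : R); last exact/esym/mulr0.
  by rewrite /d [pi * _]mulrC mulrBl sinB !sin_natpi !(mul0r, mulr0) subr0 mul0r.
Qed.

End LatticeInversion.

Section LocalLimit.
Context {R : realType} (p : R).
Hypothesis hp : 0 < p < 1.

(** Powers of [n] measure the error here; the upper bound on [s] is what later converts it to a
    multiple of 1 / sigma. *)
Lemma clique_local_limit (r L : nat) : (2 <= r)%N -> (30 <= L)%N ->
  exists C : R, 0 <= C /\ \forall y \near +oo,
  forall (V E : finType) (en : E -> {set V}) (ed : V -> V -> E) (f : {ffun E -> bool} -> nat),
  edge_system en ed -> #|V|%:R = y ^+ L ->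
  (forall x, (f x)%:R = cliques en [set: V]%SET r x :> R) ->
  forall m : nat,
  let n := #|V|%:R : R in
  let mu := esp p (fun x => (f x)%:R) in
  let s := Num.sqrt (esp p (fun x => ((f x)%:R - mu) ^+ 2)) in
  [/\ 0 < s, s <= C * n ^+ (r - 1) &
    `|esp p (fun x => (f x == m)%:R) -
      1 / (Num.sqrt (2 * pi) * s) * expR (- ((m%:R - mu) ^+ 2 / (2 * s ^+ 2)))| <=
    C * (y ^+ 4 / (n ^+ (r - 1) * Num.sqrt n))].
Proof.
move=> r2 L30.
have r1 : (r - 1 = (r - 2).+1)%N by clear -r2; lia.
have rE : (2 * r = (r - 1) * 2 + 2)%N by clear -r2; lia.
have rS : (r = (r - 1).+1)%N by clear -r2; lia.
have L1 : (1 <= L)%N by exact: leq_trans L30.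
have q0 := pq_gt0 hp; have q4 := pq_le (p := p); set q := p * (1 - p) in q0 q4.
set d := 'C(r, 2).
have [c2 c20 kge0] := kappa_lower hp (ltr01 : 0 < 1 :> R) r2.
(* The linear part alone has variance at least [s0] times n^(2r-2): at least n^2 / 4 edges, each
   with coefficient at least [c2] times n^(r-2). *)
pose s0 := q * c2 ^+ 2 / 4.
have s00 : 0 < s0 by rewrite divr_gt0// mulr_gt0// exprn_gt0.
have s02 : 0 < s0 / 2 by rewrite divr_gt0.
have d1 : 1 <= d%:R :> R by rewrite ler1n bin_gt0.
(* The first three summands come from the three errors of [central_phase]; 5 is 4 for the angles
   above [T] and 1 for the Gaussian tail. *)
exists (d%:R + 2 + d%:R ^+ 2 + 5); split.
  by rewrite !addr_ge0// sqr_ge0.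
(* The exponent [L * r] makes the characteristic function at most n^(-r), below the error
   allowed. *)
have := phase_decayP hp L30 r2 (L * r)%N (ltr01 : 0 < 1 :> R); apply: filter_app.
near=> y => key V E en ed f es nE fE m.
set n : R := #|V|%:R; set mu := esp p (fun x => (f x)%:R : R).
set s := Num.sqrt (esp p (fun x => ((f x)%:R - mu) ^+ 2)).
have y1 : 1 <= y by near: y; exact: near_ge.
have ry : 2 * r%:R <= y by near: y; exact: near_ge.
have sy : 2 / s0 <= y by near: y; exact: near_ge.
have ey : 1 * y ^+ L * expR (- (s0 / 2 * y)) <= 1 by near: y; exact: near_exp.
have y0 : 0 < y by lra.
have [ei ce edE] := es.
rewrite -/n in nE.
have n0 : 0 < n by rewrite nE exprn_gt0.
have ynle : y <= n by rewrite nE -[leLHS]expr1 ler_weXn2l.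
have n1 : 1 <= n by lra.
pose rt := Num.sqrt n.
have rt0 : 0 < rt by rewrite sqrtr_gt0.
have rtE : rt ^+ 2 = n by rewrite sqr_sqrtr// ltW.
have rt1 : 1 <= rt by rewrite -[leLHS]sqrtr1 ler_sqrt.
have rtn : rt <= n by rewrite -rtE expr2 ler_peMr// ltW.
pose N := n ^+ (r - 1).
have N0 : 0 < N by rewrite exprn_gt0.
have NE : N = n * n ^+ (r - 2) by rewrite /N r1 exprS.
have nN : n <= N by rewrite NE ler_peMr ?(ltW n0)// exprn_ege1.
have n2r : n ^+ (2 * r) = N ^+ 2 * n ^+ 2 by rewrite rE exprD exprM.
pose F (x : {ffun E -> bool}) : R := (f x)%:R.
have fF : F = cliques en [set: V]%SET r by exact/funext.
pose ka := kappa p #|V| r.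
have Fk e : esp p (dif e F) = ka.
  rewrite fF; have := esp_dif_cliques (p := p) ei ce edE (N := [set: V]%SET) (e := e) (finset.subsetT _) r2.
  by rewrite cardsT.
have kle : ka <= n ^+ (r - 2) by exact: kappa_le.
have kge : c2 * n ^+ (r - 2) <= ka.
  by apply: kge0; [rewrite mul1r|rewrite (le_trans ry)].
have k0 : 0 <= ka by exact: kappa_ge0.
have cE : #|E| = 'C(#|V|, 2).
  rewrite -(cardsT V) -(card_eset ei ce edE [set: V]%SET) -cardsT; apply: eq_card => e.
  by rewrite !finset.inE finset.subsetT.
have cE1 : #|E|%:R <= n ^+ 2 by rewrite /n -natrX ler_nat cE leq_bin_exp.
have V2 : (2 <= #|V|)%N.
  rewrite -(ler_nat R) -/n; have r2' : 2 <= r%:R :> R by rewrite (ler_nat R 2).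
  by clear -ry r2' ynle; lra.
have cE2 : n ^+ 2 / 4 <= #|E|%:R by rewrite cE (bin2_ge hp V2).
(* The standard deviation of the nonlinear remainder: at most n^2 derivatives, of variance at most d
   n^(2r-5) each. *)
pose rho := d%:R * N / rt.
have rho0 : 0 <= rho by rewrite divr_ge0 ?mulr_ge0 ?(ltW N0) ?(ltW rt0).
have rho2 : rho ^+ 2 = d%:R ^+ 2 * N ^+ 2 / n by rewrite /rho expr_div_n exprMn rtE.
have hrho : q * \sum_e esp p (fun x => (dif e F x - ka) ^+ 2) <= rho ^+ 2.
  rewrite fF.
  have hs : \sum_e esp p (fun x => (dif e (cliques en [set: V]%SET r) x - ka) ^+ 2) <=
      #|E|%:R * (d%:R * (N ^+ 2 / n ^+ 3)).
    rewrite mulr_natl -sumr_const; apply: ler_sum => e _.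
    have -> : d%:R * (N ^+ 2 / n ^+ 3) = d%:R * n ^+ (2 * r) / n ^+ 5.
      by rewrite n2r; field; rewrite gt_eqF.
    rewrite ler_pdivlMr ?exprn_gt0//.
    have := var_dif_cliques hp ei ce edE (N := [set: V]%SET) (e := e) (finset.subsetT _) r2.
    by rewrite cardsT.
  have Nn : 0 <= N ^+ 2 / n ^+ 3 by rewrite divr_ge0 ?sqr_ge0 ?exprn_ge0 ?(ltW n0).
  apply: (@le_trans _ _ (1 * (n ^+ 2 * (d%:R * (N ^+ 2 / n ^+ 3))))).
    apply: ler_pM => //; first exact: ltW.
    - by apply: sumr_ge0 => e _; apply: (esp_ge0 hp) => x; exact: sqr_ge0.
    - by clear -q4; lra.
    - by apply: (le_trans hs); rewrite ler_wpM2r// mulr_ge0.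
  have -> : 1 * (n ^+ 2 * (d%:R * (N ^+ 2 / n ^+ 3))) = d%:R * (N ^+ 2 / n).
    by field; rewrite gt_eqF.
  rewrite rho2 -mulrA ler_wpM2r ?divr_ge0 ?sqr_ge0 ?(ltW n0)//.
  by rewrite expr2 ler_peMr.
have [s2E s2R] := linear_split hp Fk.
set s2 := esp p (fun x => (F x - esp p F) ^+ 2) in s2E.
set rem2 := esp p _ in s2E s2R.
have sE : s = Num.sqrt s2 by [].
have rem0 : 0 <= rem2 by apply: (esp_ge0 hp) => x; exact: sqr_ge0.
have remle : rem2 <= rho ^+ 2 := le_trans s2R hrho.
have s2ge : s0 * N ^+ 2 <= s2.
  rewrite s2E -[leLHS]addr0 lerD//.
  have -> : s0 * N ^+ 2 = q * (c2 * n ^+ (r - 2)) ^+ 2 * (n ^+ 2 / 4).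
    by rewrite /s0 NE; field.
  have kk : (c2 * n ^+ (r - 2)) ^+ 2 <= ka ^+ 2.
    by rewrite lerXn2r ?nnegrE// mulr_ge0 ?exprn_ge0 ?(ltW c20) ?(ltW n0).
  apply: ler_pM => //.
  - by apply: mulr_ge0; [exact: ltW|exact: sqr_ge0].
  - by apply: divr_ge0 => //; exact: sqr_ge0.
  - by rewrite ler_wpM2l// ltW.
have s2le : s2 <= ((d%:R + 1) * N) ^+ 2.
  rewrite s2E; have h1 : q * ka ^+ 2 * #|E|%:R <= N ^+ 2.
    have -> : N ^+ 2 = 1 * (n ^+ (r - 2)) ^+ 2 * n ^+ 2 by rewrite NE; ring.
    apply: ler_pM => //.
    - by apply: mulr_ge0; [exact: ltW|exact: sqr_ge0].
    - apply: ler_pM; [exact: ltW|exact: sqr_ge0|by clear -q4; lra|].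
      by rewrite lerXn2r ?nnegrE// exprn_ge0// ltW.
  have h2 : rem2 <= d%:R ^+ 2 * N ^+ 2.
    rewrite (le_trans remle)// rho2 ler_pdivrMr// ler_peMr//.
    by apply: mulr_ge0; exact: sqr_ge0.
  have -> : ((d%:R + 1) * N) ^+ 2 = d%:R ^+ 2 * N ^+ 2 + N ^+ 2 + 2 * d%:R * N ^+ 2 by ring.
  have h3 : 0 <= 2 * d%:R * N ^+ 2 by rewrite mulr_ge0 ?sqr_ge0.
  by apply: le_trans (lerD h1 h2) _; rewrite [leLHS]addrC lerDl.
have N2 : 0 < N ^+ 2 by rewrite exprn_gt0.
have s2gt : 0 < s2 by rewrite (lt_le_trans _ s2ge)// mulr_gt0.
have sgt : 0 < s by rewrite sE sqrtr_gt0.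
have ss : s ^+ 2 = s2 by rewrite sE sqr_sqrtr// ltW.
have Nle : (d%:R + 1) * N <= (d%:R + 2 + d%:R ^+ 2 + 5) * N.
  by rewrite ler_wpM2r ?(ltW N0)//; have := sqr_ge0 (d%:R : R); clear; lra.
split => //.
  apply: le_trans Nle; have dN : 0 <= (d%:R + 1) * N by rewrite mulr_ge0 ?addr_ge0// ltW.
  by rewrite sE -(ger0_norm dN) -sqrtr_sqr ler_wsqrtr.
(* The smallest angle covered by [phase_decay]; as [s] is of order [N], the Gaussian there is
   already below exp(-c y^2) for some constant c > 0. *)
pose T := y / N.
have T0 : 0 < T by rewrite divr_gt0.
have TN : T <= pi.
  rewrite (le_trans (_ : _ <= 1))//; first by rewrite ler_pdivrMr// mul1r (le_trans ynle).
  by rewrite (le_trans _ (pi_ge2 R))// ler1n.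
pose d1' := T * rho + n ^+ 2 * (2 * (y / n) ^+ 3) + (T * rho) ^+ 2.
pose d2' := (y ^+ (L * r))^-1.
have := @lattice_inversion R E p f m s `|mu - m%:R| T d1' d2' sgt (normr_ge0 _).
rewrite T0 TN real_normK ?num_real// -[(mu - m%:R) ^+ 2]sqrrN opprB => /(_ isT) inv.
have A1 t : 0 <= t <= T -> `|esp p (fun z => cos (t * ((f z)%:R - m%:R))) -
    expR (- (s ^+ 2 * t ^+ 2 / 2)) * cos (t * `|mu - m%:R|)| <= d1'.
  move=> /andP[t0 tT].
  have tk0 : 0 <= t * ka by rewrite mulr_ge0.
  have tk : t * ka <= y / n.
    have -> : y / n = T * n ^+ (r - 2).
      by rewrite /T NE; field; rewrite !gt_eqF// exprn_gt0.
    by apply: ler_pM.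
  have yn : y / n <= 1 by rewrite ler_pdivrMr// mul1r.
  have tk1 : `|t * ka| <= 1 by rewrite ger0_norm// (le_trans tk).
  have := central_phase hp m%:R Fk t0 tk1 rho0 hrho; rewrite -/s2 -ss => /le_trans; apply.
  have tr : t * rho <= T * rho by rewrite ler_wpM2r.
  have tr0 : 0 <= t * rho by rewrite mulr_ge0.
  rewrite /d1'; apply: lerD; last by rewrite lerXn2r ?nnegrE// (le_trans tr0).
  apply: lerD => //; rewrite (ger0_norm tk0).
  apply: ler_pM => //; first by rewrite mulr_ge0// exprn_ge0.
  rewrite ler_wpM2l// lerXn2r ?nnegrE// (le_trans tk0)//.
have A2 t : T <= t <= pi -> `|esp p (fun z => cos (t * ((f z)%:R - m%:R)))| <= d2'.
  move=> tT; have := key V E en ed es nE [set: V]%SET [set: V]%SET (fun=> - (t * m%:R)) t.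
  rewrite finset.subsetT cardsT mul1r lexx => /(_ isT isT) kk.
  have -> : esp p (fun z => cos (t * ((f z)%:R - m%:R))) =
      esp p (fun x => cos (- (t * m%:R) + t * cliques en [set: V]%SET r x)).
    by apply: eq_esp => x; congr cos; rewrite -fE; ring.
  by apply: kk.
apply: (le_trans (inv A1 A2)).
have Nrt : 0 < N * rt by rewrite mulr_gt0.
pose Z := y ^+ 4 / (N * rt).
have y4 : 1 <= y ^+ 4 by rewrite exprn_ege1.
have inrt : n^-1 <= rt^-1 by rewrite lef_pV2 ?posrE.
have Z1 : (N * rt)^-1 <= Z by rewrite /Z ler_peMl// invr_ge0 ltW.
have B2 : 4 * d2' <= 4 * Z.
  rewrite ler_wpM2l// (le_trans _ Z1)// /d2' exprM -nE rS exprSr -/N !invfM.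
  by rewrite ler_wpM2l// invr_ge0 ltW.
have B3 : 2 / (s ^+ 2 * T) * expR (- (s ^+ 2 * T ^+ 2 / 2)) <= Z.
  rewrite (le_trans _ Z1)// ss [leRHS]invfM.
  have g1 : s0 * N * y <= s2 * T.
    have -> : s0 * N * y = s0 * N ^+ 2 * T by rewrite /T; field; rewrite gt_eqF.
    by rewrite ler_wpM2r// ltW.
  have g2 : s0 * y ^+ 2 <= s2 * T ^+ 2.
    have -> : s0 * y ^+ 2 = s0 * N ^+ 2 * T ^+ 2 by rewrite /T; field; rewrite gt_eqF.
    by rewrite ler_wpM2r// sqr_ge0.
  apply: ler_pM; rewrite ?expR_ge0//.
  - by rewrite divr_ge0// mulr_ge0// ltW.
  - rewrite ler_pdivrMr ?(mulr_gt0 s2gt T0)// ler_pdivlMl//.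
    apply: le_trans g1; rewrite [s0 * N]mulrC -mulrA ler_wpM2l ?(ltW N0)//.
    by rewrite -ler_pdivrMl// mulrC.
  apply: (@le_trans _ _ n^-1) => //.
  apply: (@le_trans _ _ (expR (- (s0 / 2 * y)))).
    rewrite ler_expR lerN2; have yy : y <= y ^+ 2 by rewrite -[leLHS]expr1 ler_weXn2l.
    by have := ler_wpM2l (ltW s00) yy; clear -g2; lra.
  by rewrite -[leRHS]div1r ler_pdivlMr// mulrC nE -[y ^+ L]mul1r.
have B1 : T * d1' <= (d%:R + 2 + d%:R ^+ 2) * Z.
  have -> : Z = T * (y ^+ 3 / rt) by rewrite /Z /T; field; rewrite !gt_eqF.
  rewrite [leRHS]mulrCA ler_wpM2l ?(ltW T0)// /d1'.
  have -> : T * rho = d%:R * (y / rt) by rewrite /T /rho; field; rewrite !gt_eqF.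
  have -> : n ^+ 2 * (2 * (y / n) ^+ 3) = 2 * (y ^+ 3 / n) by field; rewrite gt_eqF.
  have -> : (d%:R * (y / rt)) ^+ 2 = d%:R ^+ 2 * (y ^+ 2 / n).
    by rewrite -rtE; field; rewrite gt_eqF.
  rewrite !mulrDl; apply: lerD; first apply: lerD.
  - rewrite ler_wpM2l// ler_wpM2r ?invr_ge0 ?(ltW rt0)//.
    by rewrite -[leLHS]expr1 ler_weXn2l.
  - by rewrite !mul1r lerD// ler_wpM2l// exprn_ge0// ltW.
  - rewrite ler_wpM2l ?sqr_ge0//; apply: ler_pM; rewrite ?invr_ge0 ?exprn_ge0 ?(ltW y0) ?(ltW n0)//.
    by rewrite ler_weXn2l.
rewrite -/Z; clear -B1 B2 B3; lra.
Unshelve. all: by end_near. Qed.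

End LocalLimit.

(** * The random graph *)

Section Bridge.
Context {R : realType} (n : nat) (p : R).
Hypothesis hp : 0 < p < 1.
Local Notation T := (graph n).

Let p01 : 0 <= p <= 1.
Proof. by case/andP: hp => /ltW -> /ltW ->. Qed.

Lemma gnp_esum (A : set T) :
  gnp n p A = (\sum_(g : T) (gnp_pmf p g * (g \in A)%:R)%:E)%E.
Proof.
rewrite /gnp p01 esum_mkcond.
have fT : finite_set [set: T] by exact: finite_finset.
rewrite esum_fset//; last first.
  by move=> g _; case: ifP => // _; rewrite lee_fin gnp_pmf_ge0.
rewrite fsbig_finite//= (perm_big (index_enum T)) /=.
  by apply: eq_bigr => g _; case: ifP => _; rewrite ?mulr1 ?mulr0.
apply: uniq_perm; rewrite ?finmap.fset_uniq ?index_enum_uniq // => g.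
rewrite in_fset_set//; transitivity true; first exact/mem_set.
by apply/esym; exact: mem_index_enum.
Qed.

Lemma sum_enum (W : Type) (idx : W) (op : Monoid.com_law idx) (F : T -> W) :
  \big[op/idx]_(g : T) F g = \big[op/idx]_(i < #|T|) F (nth point (enum T) i).
Proof.
rewrite -(big_mkord xpredT (fun i => F (nth point (enum T) i))).
by rewrite cardE -(big_nth point xpredT F) big_enum.
Qed.

Lemma gnp_prob (A : set T) : fine (gnp n p A) = esp p (fun g => (g \in A)%:R).
Proof. by rewrite gnp_esum sumEFin. Qed.

(** The measure is written as a finite sum of weighted Dirac masses, for which the integral of a
    nonnegative function is explicit. *)
Lemma gnp_expectation (X : T -> R) : (forall g, 0 <= X g) ->
  ('E_(gnp n p)[X] = (esp p X)%:E)%E.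
Proof.
move=> X0; rewrite unlock.
pose m_ (i : nat) : {measure set T -> \bar R} :=
  mscale (NngNum (gnp_pmf_ge0 (nth point (enum T) i) p01)) (\d_(nth point (enum T) i)).
have gE (A : set T) : measurable A -> A `<=` setT -> gnp n p A = msum m_ #|T| A.
  move=> _ _; rewrite gnp_esum /msum /= sum_enum; apply: eq_bigr => i _.
  by rewrite /mscale /= diracE EFinM.
rewrite (eq_measure_integral (msum m_ #|T|)); last exact: gE.
have X0' : forall g : T, [set: T] g -> (0 <= (X g)%:E)%E by move=> g _; rewrite lee_fin.
rewrite ge0_integral_measure_sum//.
transitivity (\sum_(i < #|T|) (gnp_pmf p (nth point (enum T) i) * X (nth point (enum T) i))%:E)%E.
  apply: eq_bigr => i _; rewrite ge0_integral_mscale//.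
  rewrite integral_dirac//.
  by rewrite diracT mul1e EFinM.
rewrite sumEFin /esp; congr EFin.
by rewrite -(sum_enum _ (fun g => gnp_pmf p g * X g)).
Qed.

Lemma clique_meanE (r : nat) :
  clique_mean r n p = esp p (fun g : T => (clique_count r g)%:R).
Proof. by rewrite /clique_mean gnp_expectation. Qed.

Lemma clique_sdE (r : nat) : clique_sd r n p =
  Num.sqrt (esp p (fun g : T => ((clique_count r g)%:R - clique_mean r n p) ^+ 2)).
Proof.
rewrite /clique_sd /variance unlock -/(clique_mean r n p).
rewrite (_ : (_ * _)%R = fun g : T => ((clique_count r g)%:R - clique_mean r n p) ^+ 2) //.
by rewrite gnp_expectation// => g; exact: sqr_ge0.
Qed.

Lemma clique_countE (r : nat) (g : T) :
  (clique_count r g)%:R = cliques (fun e : edge n => val e) [set: 'I_n]%SET r g :> R.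
Proof.
rewrite /clique_count /cliques natr_sum; apply: eq_big => S; first by rewrite finset.subsetT andbT.
move=> _; rewrite natr_prod clqE big_mkcond /=; apply: eq_bigr => e _.
by case: ifP.
Qed.

End Bridge.

(** Passes from the scale [y] to the number of vertices through [y ^+ L = n]. *)
Lemma near_root (R : realType) (L : nat) (P : R -> Prop) : (0 < L)%N ->
  (\forall y \near +oo, P y) -> \forall n \near \oo, P ((n%:R : R) `^ (L%:R)^-1).
Proof.
move=> L0 [M [_ hM]]; near=> n; apply: hM.
have Mn : (`|M| + 1) ^+ L <= n%:R.
  by near: n; exact: nbhs_infty_ger.
have M1 : 0 <= `|M| + 1 by rewrite addr_ge0.
have L0' : L%:R != 0 :> R by rewrite pnatr_eq0 -lt0n.
have ME : `|M| + 1 = ((`|M| + 1) ^+ L) `^ (L%:R)^-1.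
  by rewrite -powR_mulrn// -powRrM mulfV// powRr1.
apply: (@lt_le_trans _ _ (`|M| + 1)).
  by rewrite (le_lt_trans (ler_norm _))// ltrDl.
rewrite {1}ME; apply: ge0_ler_powR => //; rewrite ?nnegrE ?invr_ge0 ?exprn_ge0//.
Unshelve. all: by end_near. Qed.

Lemma edge_system_complete (n : nat) : (2 <= n)%N ->
  exists ed : 'I_n -> 'I_n -> edge n, edge_system (fun e : edge n => val e) ed.
Proof.
move=> n2; have [B _ B2] : exists2 B : {set 'I_n}, B \subset [set: 'I_n]%SET & #|B| = 2%N.
  by apply: pick_subset; rewrite cardsT card_ord.
(* Any edge will do: it is the value of [ed] on the diagonal. *)
have e0 : edge n by exists B; rewrite B2.
exists (fun u v => insubd e0 [set u; v]%SET); split; first exact: val_inj.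
  by move=> e; exact/eqP/(valP e).
by move=> u v uv; rewrite insubdK// -topredE /= cards2 uv.
Qed.

Theorem theorem1 (R : realType) (r : nat) (p tau : R)
    (hr : (3 <= r)%N) (hp : 0 < p < 1)
    (htau : 0 < tau < Num.min (1 / 12) (1 / (2 * r%:R))) :
  exists C : R, \forall n \near \oo, forall m : nat,
    let mu := clique_mean r n p in
    let sigma := clique_sd r n p in
    `| fine (gnp n p [set g : graph n | clique_count r g = m])
       - 1 / (Num.sqrt (2 * pi) * sigma)
         * expR (- ((m%:R - mu) ^+ 2 / (2 * sigma ^+ 2))) |
      <= C * (1 / (sigma * n%:R `^ (1 / 2 - tau))).
Proof.
have /andP[tau0 _] := htau.
(* [L] exceeds [4 / tau], so the loss [y ^+ 4] in the local limit is at most n^tau. *)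
have [b /andP[b1 _]] : exists b : nat, 4 / tau <= b%:R <= 4 / tau + 1.
  by apply: nat_ceil; rewrite divr_ge0// ltW.
pose L := (b + 30)%N.
have L30 : (30 <= L)%N by exact: leq_addl.
have L0 : (0 < L)%N by exact: leq_trans L30.
have L0' : 0 < L%:R :> R by rewrite ltr0n.
have L4 : (L%:R)^-1 * 4 <= tau.
  rewrite mulrC ler_pdivrMr//; move: b1; rewrite ler_pdivrMr// => /le_trans; apply.
  by rewrite mulrC ler_wpM2l ?(ltW tau0)// ler_nat leq_addr.
have [C [C0 hC]] := clique_local_limit hp (ltnW hr) L30.
(* One factor is the constant of the error, the other comes from [s <= C * n ^+ (r - 1)]. *)
exists (C * C).
have := near_root L0 hC; apply: filter_app; near=> n => {}hC m.
have n2 : (2 <= n)%N by near: n; exact: nbhs_infty_ge.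
cbv zeta.
have n1 : 1 <= n%:R :> R by rewrite ler1n (leq_trans _ n2).
have n0 : 0 < n%:R :> R by lra.
set y := _ `^ _ in hC.
have yE : y ^+ L = n%:R.
  by rewrite -powR_mulrn ?powR_ge0// -powRrM mulVf ?gt_eqF// powRr1// ltW.
have y4 : y ^+ 4 <= n%:R `^ tau.
  by rewrite -powR_mulrn ?powR_ge0// -powRrM ler_powR.
have [ed es] := edge_system_complete n2.
have := hC _ _ _ ed (fun g => clique_count r g) es _ (fun g => clique_countE r g) m.
rewrite card_ord yE => /(_ erefl) [].
rewrite gnp_prob// clique_sdE// clique_meanE//.
rewrite (eq_esp (F := fun g : graph n => (g \in [set g0 : graph n | clique_count r g0 = m])%:R)
  (G := fun g => (clique_count r g == m)%:R)); last first.
  by move=> g; congr (nat_of_bool _)%:R; apply/idP/eqP; rewrite inE.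
set s := Num.sqrt _ => s0 sN /le_trans; apply.
have N0 : 0 < (n%:R : R) ^+ (r - 1) by rewrite exprn_gt0.
rewrite -mulrA ler_wpM2l//.
have -> : Num.sqrt n%:R = n%:R `^ (1 / 2) :> R by rewrite div1r powR12_sqrt// ltW.
have ht : n%:R `^ (1 / 2) = n%:R `^ (1 / 2 - tau) * n%:R `^ tau :> R.
  by rewrite -powRD ?subrK// gt_eqF// implybT.
have p1 : 0 < n%:R `^ (1 / 2 - tau) :> R by rewrite powR_gt0.
have p2 : 0 < n%:R `^ tau :> R by rewrite powR_gt0.
rewrite ht; set u := n%:R `^ (_ - _) in p1 *; set v := n%:R `^ tau in p2 y4 *.
rewrite ler_pdivrMr ?mulr_gt0//.
have -> : C * (1 / (s * u)) * (n%:R ^+ (r - 1) * (u * v)) = (C * n%:R ^+ (r - 1)) / s * v.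
  by field; rewrite !gt_eqF.
rewrite (le_trans y4)// ler_peMl ?(ltW p2)//.
by rewrite ler_pdivlMr// mul1r.
Unshelve. all: by end_near. Qed.
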